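(* Let $n\geq 1$ be an integer, let $\mathbb{F}_q$ be a finite field, and let $A$ be the path algebra over $\mathbb{F}_q$ of the bound quiver with vertices $1,2,\ldots,n$, one arrow $i\to i+1$ for each $1\leq i\leq n-1$, one loop $\alpha$ at the vertex $n$, and the single relation $\alpha^2=0$. Let $\mathfrak{g}(A)$ be the $\mathbb{Z}$-submodule of the degenerate Ringel--Hall algebra $\mathcal{H}(A)_1$ spanned by the isomorphism classes of indecomposable $A$-modules. Then $\mathfrak{g}(A)$ is a Lie subalgebra of $\mathcal{H}(A)_1$ (with the commutator bracket), with the following Lie bracket, where an indecomposable module stands for its isomorphism class and $\delta_{i,j}$ is the Kronecker symbol: (a) $[W_{i,j},W_{l,m}]=\delta_{j+1,l}W_{i,m}-\delta_{m+1,i}W_{l,j}$ for $1\leq i\leq j\leq n-1$ and $1\leq l\leq m\leq n-1$; (b) $[W_{i,j},V_l]=\delta_{j+1,l}V_i$ for $1\leq i\leq j\leq n-1$ and $1\leq l\leq n$; (c) $[W_{i,j},U_{l,m}]=\delta_{j+1,m}U_{l,i}+\delta_{j+1,l}U_{i,m}$ for $1\leq i\leq j\leq n-1$ and $1\leq l,m\leq n$; (d) $[V_i,V_j]=U_{j,i}-U_{i,j}$ for $1\leq i,j\leq n$. For all other (unordered) pairs of indecomposable modules, the Lie bracket equals $0$.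
   Context: Modules are finite-dimensional left modules, and $A$-modules are identified with finite-dimensional representations over $K=\mathbb{F}_q$ of the quiver $1\to 2\to\cdots\to n$ with a loop $\alpha$ at $n$, satisfying $\alpha^2=0$. A complete set of representatives of the isomorphism classes of indecomposable $A$-modules is given by the following representations. - $W_{i,j}$ for $1\leq i\leq j<n$: the space $K$ at the vertices $i,\ldots,j$ and $0$ elsewhere, with identity maps on the arrows between the vertices $i,\ldots,j$ and all other maps (including $\alpha$) zero. - $V_i$ for $1\leq i\leq n$: the space $K$ at the vertices $i,\ldots,n$ and $0$ elsewhere, with identity maps on the arrows between the vertices $i,\ldots,n$, and $\alpha$ acting by $0$. - $U_{i,j}$ for $1\leq i,j\leq n$: the space $K^2$, with standard basis $e_1,e_2$, at each vertex $v$ with $\max(i,j)\leq v\leq n$; the space $K$ at each vertex $v$ with $\min(i,j)\leq v<\max(i,j)$; and $0$ at the vertices $v<\min(i,j)$. The arrows between two vertices carrying $K$ act by $1$, those between two vertices carrying $K^2$ act by the identity matrix, and the arrow from a vertex carrying $K$ to one carrying $K^2$ (if $i\neq j$) acts by $1\mapsto e_1$ if $j<i$ and by $1\mapsto e_2$ if $i<j$. The loop $\alpha$ acts at $n$ by $e_1\mapsto e_2$, $e_2\mapsto 0$. Hall numbers: for modules $N_1,N_2,M$ over a finite-dimensional algebra over a finite field, $F_{N_1N_2}^M$ denotes the number of submodules $U$ of $M$ such that $U\cong N_2$ and $M/U\cong N_1$. Hall polynomials: for a field extension $E$ of $K$ and a $K$-space $V$ put $V^E:=V\otimes_K E$. A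 (finite) field extension $E$ of $K$ is conservative for $A$ if $(\mathrm{End}\,M/\mathrm{rad}\,\mathrm{End}\,M)^E$ is a field for every indecomposable $A$-module $M$. The algebra $A$ has Hall polynomials, i.e. for all $A$-modules $X,Y,M$ there is a polynomial $\varphi_{XY}^M\in\mathbb{Z}[T]$ with $\varphi_{XY}^M(|E|)=F_{X^E\,Y^E}^{M^E}$ for every conservative field extension $E$ of $K$. The degenerate Ringel--Hall algebra $\mathcal{H}(A)_1$ is the associative $\mathbb{Z}$-algebra which is free over $\mathbb{Z}$ with basis the isomorphism classes $[M]$ of all $A$-modules, with multiplication $[N_1][N_2]=\sum_{[M]}\varphi_{N_1N_2}^M(1)\,[M]$. *)

(* Defs.v *)
From HB Require Import structures.
From mathcomp Require Import all_boot all_order all_algebra.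
From mathcomp Require Import generic_quotient mxrepresentation.
From mathcomp Require Import boolp classical_sets fsbigop.
From mathcomp Require Import freeg.

Set Implicit Arguments.
Unset Strict Implicit.
Unset Printing Implicit Defensive.

Import GRing.Theory.

Local Open Scope ring_scope.
Local Open Scope classical_set_scope.
Local Open Scope quotient_scope.

(* The quiver has vertices 1, ..., n; the ordinal v : 'I_n stands for the
   vertex v.+1.  Each vertex is the source of exactly one arrow, so arrows are
   indexed by their source: the arrow leaving v ends at [arrow_end v], which is the
   following vertex, or v itself when v is the last vertex (the loop alpha). *)
Definition arrow_end n (v : 'I_n) : 'I_n := insubd v v.+1.

(* Representations have coordinate spaces 'rV_(vdim v) at the vertices, and
   matrices act on row vectors from the right. *)
Record qrep (F : fieldType) (n : nat) := QRep {
  vdim : 'I_n -> nat;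
  vmap : forall v : 'I_n, 'M[F]_(vdim v, vdim (arrow_end v)) }.

(* The relation alpha ^ 2 = 0; note that [arrow_end v = v] for the last vertex. *)
Definition bound (F : fieldType) n (M : qrep F n) : Prop :=
  forall v : 'I_n, v.+1 = n -> vmap M v *m vmap M (arrow_end v) = 0.

Record amod (F : fieldType) n := AMod {
  rep_of :> qrep F n;
  amodP : bound rep_of }.

Definition is_hom (F : fieldType) n (M N : qrep F n)
    (f : forall v, 'M[F]_(vdim M v, vdim N v)) : Prop :=
  forall v, vmap M v *m f (arrow_end v) = f v *m vmap N v.

Definition isom (F : fieldType) n (M N : qrep F n) : Prop :=
  exists (f : forall v, 'M[F]_(vdim M v, vdim N v))
         (g : forall v, 'M[F]_(vdim N v, vdim M v)),
    [/\ is_hom f, is_hom g,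
        forall v, f v *m g v = 1%:M & forall v, g v *m f v = 1%:M].

Definition is_zero (F : fieldType) n (M : qrep F n) : Prop :=
  forall v, vdim M v = 0%N.

Definition dsum (F : fieldType) n (M N : qrep F n) : qrep F n :=
  @QRep F n (fun v => (vdim M v + vdim N v)%N)
    (fun v => block_mx (vmap M v) 0 0 (vmap N v)).

Definition indecomposable (F : fieldType) n (M : amod F n) : Prop :=
  ~ is_zero M /\
  forall X Y : amod F n, isom M (dsum X Y) -> is_zero X \/ is_zero Y.

(* A family of subspaces is given by the row spaces of square matrices. *)
Definition subfam (F : fieldType) n (M : qrep F n) : Type :=
  {dffun forall v : 'I_n, 'M[F]_(vdim M v)}.

Definition stable_fam (F : fieldType) n (M : qrep F n) (U : subfam M) : bool :=
  [forall v, (U v *m vmap M v <= U (arrow_end v))%MS].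

Definition sub_rep (F : fieldType) n (M : qrep F n) (U : subfam M) : qrep F n :=
  @QRep F n (fun v => \rank (U v))
    (fun v => in_submod (U (arrow_end v)) (val_submod 1%:M *m vmap M v)).

Definition quo_rep (F : fieldType) n (M : qrep F n) (U : subfam M) : qrep F n :=
  @QRep F n (fun v => \rank (cokermx (U v)))
    (fun v => in_factmod (U (arrow_end v)) (val_factmod 1%:M *m vmap M v)).

(* <<A>>%MS depends only on the row space of A, so the condition
   <<U v>>%MS == U v makes each subrepresentation be counted exactly once. *)
Definition hall_number (F : finFieldType) n (N1 N2 M : qrep F n) : nat :=
  #|[set U : subfam M | [&& [forall v, <<U v>>%MS == U v], stable_fam U,
      `[< isom (sub_rep U) N2 >] & `[< isom (quo_rep U) N1 >]]]%SET|.

Definition extend (K E : fieldType) (iota : {rmorphism K -> E}) n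
    (M : qrep K n) : qrep E n :=
  @QRep E n (vdim M) (fun v => map_mx iota (vmap M v)).

Section Endomorphisms.

Variables (F : fieldType) (n : nat) (M : qrep F n).

Definition fam : Type := forall v : 'I_n, 'M[F]_(vdim M v).
Definition fam0 : fam := fun v => 0.
Definition fam1 : fam := fun v => 1%:M.
Definition fam_add (f g : fam) : fam := fun v => f v + g v.
Definition fam_sub (f g : fam) : fam := fun v => f v - g v.
(* f after g, for maps acting on row vectors *)
Definition fam_mul (f g : fam) : fam := fun v => g v *m f v.

Definition endo : set fam := [set f | is_hom (M := M) (N := M) f].

Definition left_ideal (I : set fam) : Prop :=
  [/\ I `<=` endo, I fam0,
      forall f g, I f -> I g -> I (fam_add f g) &
      forall f g, endo f -> I g -> I (fam_mul f g)].

Definition maximal_left_ideal (I : set fam) : Prop :=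
  [/\ left_ideal I, I <> endo &
      forall J, left_ideal J -> I `<=` J -> J = I \/ J = endo].

Definition rad_endo : set fam :=
  [set f | endo f /\ forall I, maximal_left_ideal I -> I f].

(* For a subalgebra S and an ideal J of S: the algebra S / J is a field. *)
Definition quotient_is_field (S J : set fam) : Prop :=
  [/\ ~ J fam1,
      forall f g, S f -> S g -> J (fam_sub (fam_mul f g) (fam_mul g f)) &
      forall f, S f -> ~ J f ->
        exists2 g, S g & J (fam_sub (fam_mul f g) fam1)].

End Endomorphisms.

Arguments endo {F n} M.
Arguments rad_endo {F n} M.

(* For a K-subspace S of a product of matrix spaces over K, S (x)_K E is
   identified with the E-span of S in the same product over E. *)
Definition extend_space (K E : fieldType) (iota : {rmorphism K -> E}) n
    (M : qrep K n) (S : set (fam M)) : set (fam (extend iota M)) :=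
  [set f | exists m (c : 'I_m -> E) (g : 'I_m -> fam M),
     (forall i, S (g i)) /\
     forall v, f v = \sum_(i < m) c i *: map_mx iota (g i v)].
Arguments extend_space {K E} iota {n M} S.

(* (End M / rad End M)^E is identified with (End M)^E / (rad End M)^E. *)
Definition conservative (K E : fieldType) (iota : {rmorphism K -> E})
    (n : nat) : Prop :=
  forall M : amod K n, indecomposable M ->
    quotient_is_field (extend_space iota (endo M))
                      (extend_space iota (rad_endo M)).

(* A finite extension of the finite field K is a finite field E with a ring
   morphism from K to E. *)
Definition is_hall_poly (K : finFieldType) n (X Y M : amod K n)
    (p : {poly int}) : Prop :=
  forall (E : finFieldType) (iota : {rmorphism K -> E}),
    conservative iota n ->
    p.[#|E|%:R] =
      (hall_number (extend iota X) (extend iota Y) (extend iota M))%:R.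

(* The polynomial is unique: every nonzero power of #|K| is the cardinal of a
   conservative extension.  The default value 0 is never used, since Hall
   polynomials exist. *)
Definition hall_poly (K : finFieldType) n (X Y M : amod K n) : {poly int} :=
  xget 0 [set p | is_hall_poly X Y M p].

Section IsoClasses.

Variables (F : fieldType) (n : nat).

Lemma isom_refl (M : qrep F n) : isom M M.
Proof.
exists (fun v => 1%:M), (fun v => 1%:M).
by split=> v; rewrite ?mulmx1 ?mul1mx.
Qed.

Lemma isom_sym (M N : qrep F n) : isom M N -> isom N M.
Proof. by move=> [f [g [hf hg fg gf]]]; exists g, f; split. Qed.

Lemma isom_trans (M N P : qrep F n) : isom M N -> isom N P -> isom M P.
Proof.
move=> [f [g [hf hg fg gf]]] [f' [g' [hf' hg' fg' gf']]].
exists (fun v => f v *m f' v), (fun v => g' v *m g v); split=> v.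
- by rewrite mulmxA hf -mulmxA hf' mulmxA.
- by rewrite mulmxA hg' -mulmxA hg mulmxA.
- by rewrite mulmxA -(mulmxA (f v)) fg' mulmx1 fg.
- by rewrite mulmxA -(mulmxA (g' v)) gf mulmx1 gf'.
Qed.

HB.instance Definition _ := gen_eqMixin (amod F n).
HB.instance Definition _ := gen_choiceMixin (amod F n).

Definition isomb : rel (amod F n) := fun M N => `[< isom M N >].

Lemma isomb_refl : reflexive isomb.
Proof. by move=> M; apply/asboolP/isom_refl. Qed.

Lemma isomb_sym : symmetric isomb.
Proof. by move=> M N; apply/asboolP/asboolP; apply: isom_sym. Qed.

Lemma isomb_trans : transitive isomb.
Proof.
by move=> N M P /asboolP MN /asboolP NP; apply/asboolP/(isom_trans MN).
Qed.

Canonical isomb_equiv := EquivRel isomb isomb_refl isomb_sym isomb_trans.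

End IsoClasses.

Notation isoclass F n := {eq_quot (isomb_equiv F n)}.

(* The degenerate Ringel--Hall algebra.  The sum over all isomorphism classes
   in [isoclass_mul] has finite support: a nonzero term forces the dimension
   vector of [c] to be the sum of those of [a] and [b]. *)
Notation hall_alg K n := {freeg (isoclass K n) / int}.

Definition cls (K : finFieldType) n (M : amod K n) : hall_alg K n :=
  << \pi_(isoclass K n) M >>.

Definition isoclass_mul (K : finFieldType) n (a b : isoclass K n) :
    hall_alg K n :=
  \sum_(c \in [set: isoclass K n])
     (hall_poly (repr a) (repr b) (repr c)).[1] *: << c >>.

Definition hall_mul (K : finFieldType) n (x y : hall_alg K n) : hall_alg K n :=
  fglift (fun a => fglift (fun b => isoclass_mul a b) y) x.

Definition bracket (K : finFieldType) n (x y : hall_alg K n) : hall_alg K n :=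
  hall_mul x y - hall_mul y x.

Definition indec_span (K : finFieldType) n : set (hall_alg K n) :=
  [set x | exists m (c : 'I_m -> int) (M : 'I_m -> amod K n),
     (forall i, indecomposable (M i)) /\ x = \sum_(i < m) c i *: cls (M i)].
Arguments indec_span : clear implicits.

(* The axioms of a Lie algebra are required on L because associativity is not
   part of the definition of [hall_mul]. *)
Definition lie_subalgebra (K : finFieldType) n (L : set (hall_alg K n)) : Prop :=
  [/\ L 0,
      forall (a : int) x y, L x -> L y -> L (a *: x + y),
      forall x y, L x -> L y -> L (bracket x y),
      forall x, L x -> bracket x x = 0 &
      forall x y z, L x -> L y -> L z ->
        bracket x (bracket y z) + bracket y (bracket z x) +
        bracket z (bracket x y) = 0].

Definition id_map (F : fieldType) p q : 'M[F]_(p, q) :=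
  \matrix_(a, b) (a == b :> nat)%:R.

Section Indecomposables.

Variables (F : fieldType) (n : nat).

Definition interval_rep (d : 'I_n -> nat) : qrep F n :=
  @QRep F n d (fun v => if v.+1 == n then 0 else id_map F _ _).

Lemma interval_bound d : bound (interval_rep d).
Proof. by move=> v hv; rewrite /= hv eqxx mul0mx. Qed.

Definition W (i j : nat) : amod F n :=
  AMod (@interval_bound (fun v => (i <= v.+1 <= j)%N : nat)).

Definition V (i : nat) : amod F n :=
  AMod (@interval_bound (fun v => (i <= v.+1)%N : nat)).

Definition U_dim (i j : nat) (v : 'I_n) : nat :=
  if (maxn i j <= v.+1)%N then 2%N
  else if (minn i j <= v.+1)%N then 1%N else 0%N.

(* e_1 and e_2 have indices 0 and 1, and row a of a matrix is the image of the
   basis vector with index a. *)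
Definition U_rep (i j : nat) : qrep F n :=
  @QRep F n (U_dim i j) (fun v =>
    if v.+1 == n then \matrix_(a, b) ((a == 0%N :> nat) && (b == 1%N :> nat))%:R
    else if U_dim i j v == U_dim i j (arrow_end v) then id_map F _ _
    else \matrix_(a, b) (b == (i < j)%N :> nat)%:R).

Lemma U_bound i j : bound (U_rep i j).
Proof.
move=> v hv; have nv : (arrow_end v).+1 == n.
  by rewrite /arrow_end /insubd insubF ?hv ?ltnn.
apply/matrixP=> a b; rewrite /= (eqP nv) hv !eqxx !mxE big1 // => c _.
rewrite !mxE.
by case: (_ =P 1%N) => [->|_]; rewrite ?andbF ?mul0r ?mulr0.
Qed.

Definition U (i j : nat) : amod F n := AMod (U_bound i j).

Definition is_W (X : amod F n) : Prop :=
  exists i j, (1 <= i <= j)%N /\ (j < n)%N /\ isom X (W i j).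
Definition is_V (X : amod F n) : Prop :=
  exists i, (1 <= i <= n)%N /\ isom X (V i).
Definition is_U (X : amod F n) : Prop :=
  exists i j, (1 <= i <= n)%N /\ (1 <= j <= n)%N /\ isom X (U i j).

(* the ordered pairs of indecomposables with a bracket given in the table *)
Definition tabulated (X Y : amod F n) : Prop :=
  is_W X /\ (is_W Y \/ is_V Y \/ is_U Y) \/ is_V X /\ is_V Y.

End Indecomposables.

(* Main.v *)
(* A middle term M = M1 (+) M2 contributes nothing to the bracket of two
   indecomposables X and Y.  Over a field E the torus E^* acts on the submodules of M
   by scaling M1, freely outside the homogeneous submodules, so |E| - 1 divides the
   Hall number F_{XY}^M unless {X, Y} = {M1, M2}; as there are conservative extensions
   E of arbitrarily large size, the Hall polynomial vanishes at 1.  If M = X (+) Y and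
   X is not isomorphic to Y, every submodule isomorphic to Y with quotient X is the
   graph of a homomorphism Y -> X, so the Hall polynomial is a power of T; both orders
   of the product then contribute [X (+) Y] once.  What remains are the indecomposable
   middle terms, where W_{i,j} and V_i are segments and U_{i,j} is a chain of subspaces
   of a plane with a square-zero endomorphism; there the Hall polynomials are 0, 1, T or
   T - 1.  The Jacobi identity is read off the resulting structure constants. *)

From HB Require Import structures.
From mathcomp Require Import all_boot all_order all_algebra.
From mathcomp Require Import fingroup cyclic fieldext galois finfield cyclotomic separable.
From mathcomp Require Import mxrepresentation mxabelem.
From mathcomp Require Import generic_quotient boolp classical_sets fsbigop freeg.
From mathcomp Require Import zify ring.
Require Import Defs.

Set Implicit Arguments.
Unset Strict Implicit.
Unset Printing Implicit Defensive.

Import GRing.Theory.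
Local Open Scope ring_scope.

(** * Representations as chains of subspaces *)

Section Matrices.
Variable F : fieldType.

(** Hall numbers are needed over all extensions of K at once. The classification is therefore proved
    over an arbitrary field, with representatives whose matrices have entries 0 and 1, so that
    extending scalars turns [std K n l] into [std E n l]. Much rests on one property, [nice]: the
    endomorphism ring is F or F[e]/(e^2), a local ring with residue field F. It makes every
    extension conservative and excludes nontrivial idempotents. Explicit Hall polynomials are given
    for X (+) Y and for the indecomposable middle terms that can occur; elsewhere the value 0 at 1
    comes from divisibility by |E| - 1, or from the default of [hall_poly]. For equal labels the
    bracket vanishes by antisymmetry, so products are computed only for distinct x and y. As V_i has
    the shape of W_{i,n}, both are treated as segments, and (a), (b), (d) become a single
    formula. *)

Lemma eq_mx_row0 m n (A B : 'M[F]_(m, n)) : m = 0%N -> A = B.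
Proof. by move=> m0; apply/matrixP=> i; have := ltn_ord i; rewrite [X in (_ < X)%N]m0. Qed.

Lemma eq_mx_col0 m n (A B : 'M[F]_(m, n)) : n = 0%N -> A = B.
Proof. by move=> n0; apply/matrixP=> i j; have := ltn_ord j; rewrite [X in (_ < X)%N]n0. Qed.

Lemma row_free_cancel m n p (A B : 'M[F]_(p, m)) (C : 'M[F]_(m, n)) :
  row_free C -> A *m C = B *m C -> A = B.
Proof. by move=> fC AB; rewrite -(mulmxKp fC A) AB mulmxKp. Qed.

Lemma row_full_cancel m n p (A B : 'M[F]_(n, p)) (C : 'M[F]_(m, n)) :
  row_full C -> C *m A = C *m B -> A = B.
Proof.
move=> fC AB; rewrite -[A]mul1mx -[B]mul1mx -(mulVpmx fC).
by rewrite -!mulmxA AB.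
Qed.

Lemma row_freeM m n p (A : 'M[F]_(m, n)) (B : 'M[F]_(n, p)) :
  row_free A -> row_free B -> row_free (A *m B).
Proof. by move=> fA fB; rewrite /row_free mxrankMfree. Qed.

Lemma row_free_Ml m n p (A : 'M[F]_(m, n)) (B : 'M[F]_(n, p)) :
  row_free (A *m B) -> row_free A.
Proof.
rewrite /row_free => /eqP AB; rewrite eqn_leq rank_leq_row /=.
by apply: leq_trans (mxrankM_maxl A B); rewrite AB.
Qed.

Lemma row_free0 m n (A : 'M[F]_(m, n)) : m = 0%N -> row_free A.
Proof. by move=> m0; rewrite /row_free eqn_leq rank_leq_row [X in (X <= _)%N]m0. Qed.

Lemma row_full0 m n (A : 'M[F]_(m, n)) : n = 0%N -> row_full A.
Proof. by move=> n0; rewrite /row_full eqn_leq rank_leq_col [X in (X <= _)%N]n0. Qed.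

Lemma row_free_eq0 m n (A : 'M[F]_(m, n)) : row_free A -> A = 0 -> m = 0%N.
Proof. by rewrite /row_free => + A0; rewrite A0 mxrank0 => /eqP. Qed.

(** Some column of [cokermx A] does not vanish on y; it kills A, and rescaling makes it 1 on y.
    These functionals supply the retractions onto summands in the classification. *)
Lemma separating_functional m n (A : 'M[F]_(m, n)) (y : 'rV[F]_n) :
  ~~ (y <= A)%MS -> exists l : 'cV[F]_n, y *m l = 1%:M /\ A *m l = 0.
Proof.
rewrite submxE => /eqP yA.
have [k yk] : exists k, (y *m cokermx A) 0 k != 0.
  apply: contrapT => no; apply: yA; apply/matrixP=> i k.
  rewrite [RHS]mxE ord1; apply/eqP; apply: contrapT => /negP ck.
  by apply: no; exists k.
set c := (y *m cokermx A) 0 k in yk.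
exists (c^-1 *: col k (cokermx A)); split; last first.
  by rewrite -scalemxAr colE mulmxA mulmx_coker mul0mx scaler0.
rewrite -scalemxAr colE mulmxA -colE; apply/matrixP=> i j.
by rewrite !ord1 [LHS]mxE [X in _ * X]mxE -/c mulVf // mxE.
Qed.

Lemma eqmx_row_free m1 m2 n p (A : 'M[F]_(m1, n)) (B : 'M[F]_(m2, n))
    (C : 'M[F]_(n, p)) :
  row_free C -> (A *m C :=: B *m C)%MS -> (A :=: B)%MS.
Proof.
move=> fC AB; rewrite -(mulmxKp fC A) -(mulmxKp fC B).
exact: eqmxMr.
Qed.

End Matrices.

Section Arrows.
Variable n : nat.
Implicit Types v w : 'I_n.

Lemma val_arrow_end v : arrow_end v = (if (v.+1 < n)%N then v.+1 else v) :> nat.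
Proof. by rewrite /arrow_end val_insubd. Qed.

Lemma arrow_end_lt v : (v.+1 < n)%N -> arrow_end v = v.+1 :> nat.
Proof. by rewrite val_arrow_end => ->. Qed.

Lemma arrow_end_last v : v.+1 = n -> arrow_end v = v.
Proof. by move=> vn; apply: val_inj; rewrite /= val_arrow_end vn ltnn. Qed.

Lemma arrow_end_surj v : (0 < v)%N -> exists w, arrow_end w = v /\ w.+1 = v :> nat.
Proof.
case: v => [[//|m] mn] _; exists (Ordinal (ltnW mn)); split=> //.
by apply: val_inj; rewrite /= val_arrow_end mn.
Qed.

End Arrows.

(** * Homomorphisms between chains of subspaces *)

Section Flags.
Variables (F : fieldType) (n : nat).
Implicit Types M X Y : qrep F n.

(* A representation whose maps are injective below its top vertex t and which
   vanishes above t is a chain of subspaces of its space at t: th v embeds the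
   space at v, and N is the action of the loop (0 if t is not the last vertex). *)
Definition flag M (t : 'I_n) D (th : forall v, 'M[F]_(vdim M v, D))
    (N : 'M[F]_D) : Prop :=
  [/\ forall v, row_free (th v),
      forall v, vmap M v *m th (arrow_end v) = th v *m (if v == t then N else 1%:M),
      row_full (th t) &
      forall v : 'I_n, (t < v)%N -> vdim M v = 0%N].

Lemma flag_mono M t D th N : @flag M t D th N ->
  forall v w : 'I_n, (v <= w <= t)%N -> (th v <= th w)%MS.
Proof.
move=> [_ hm _ _] v w; have [k] := ubnP (w - v); elim: k w => // k IH w lek.
rewrite leq_eqVlt => /andP[/orP[/eqP/val_inj->//|vw] wt].
have [|u [uw u1]] := @arrow_end_surj _ w; first by lia.
subst w.
apply: (submx_trans (IH u _ _)); [by lia|by lia|].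
have := hm u; case: eqP => [ut|_]; first by subst u; lia.
by rewrite mulmx1 => <-; apply: submxMl.
Qed.

(** Above t' the target is zero, so only the vertices up to t' matter; the endomorphisms N and N'
    constrain phi only if the two tops coincide. *)
Lemma flag_hom M t D th N M' t' D' th' N' (phi : 'M[F]_(D, D')) :
  @flag M t D th N -> @flag M' t' D' th' N' -> (t' <= t)%N ->
  (forall v : 'I_n, (v <= t')%N -> (th v *m phi <= th' v)%MS) ->
  (t = t' -> N *m phi = phi *m N') ->
  exists f, @is_hom F n M M' f /\
    forall v : 'I_n, (v <= t')%N -> f v *m th' v = th v *m phi.
Proof.
move=> [_ hm _ _] [hf' hm' _ h0'] tt' sub com.
pose f v : 'M_(vdim M v, vdim M' v) :=
  if (v <= t')%N then th v *m phi *m pinvmx (th' v) else 0.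
have fE (v : 'I_n) : (v <= t')%N -> f v *m th' v = th v *m phi.
  by move=> vt; rewrite /f vt mulmxKpV ?sub.
exists f; split=> // v.
have [vt|vt] := leqP (arrow_end v) t'; last by apply/eq_mx_col0/h0'.
apply: (row_free_cancel (hf' (arrow_end v))).
have ve : (v <= t')%N by move: vt; rewrite val_arrow_end; case: ifP; lia.
rewrite -!mulmxA hm' fE // mulmxA hm [RHS]mulmxA fE //.
case: (v =P t') => [vt'|vt'].
  have lv : v.+1 = n.
    by move: vt (ltn_ord v); rewrite val_arrow_end -vt'; case: ifP; lia.
  have tE : t = t'.
    by apply: val_inj; move: (ltn_ord t) tt'; rewrite -vt' /=; lia.
  by subst v; rewrite -tE eqxx -!mulmxA com.
case: (v =P t) => [vE|_]; last by rewrite -!mulmxA mul1mx mulmx1.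
by case: vt'; apply: val_inj => /=; subst v; lia.
Qed.

(** Here phi is an arbitrary extension of f at t' to the ambient space D, so it need not be unique
    when t' < t. Compatibility with the arrows carries the formula down from t' to every earlier
    vertex. *)
Lemma hom_flag M t D th N M' t' D' th' N' f :
  @flag M t D th N -> @flag M' t' D' th' N' -> (t' <= t)%N ->
  @is_hom F n M M' f ->
  exists phi : 'M[F]_(D, D'),
    (forall v : 'I_n, (v <= t')%N -> f v *m th' v = th v *m phi) /\
    (t = t' -> N *m phi = phi *m N').
Proof.
move=> [hf hm hF h0] [hf' hm' _ h0'] tt' homf.
have [phi phiE] : exists phi, f t' *m th' t' = th t' *m phi.
  by exists (pinvmx (th t') *m (f t' *m th' t')); rewrite mulmxA mulmxVp // mul1mx.
have E (v : 'I_n) : (v <= t')%N -> f v *m th' v = th v *m phi.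
  have [k] := ubnP (t' - v); elim: k v => // k IH v lek vt.
  have [/val_inj->//|vne] := (v : nat) =P t'.
  have vn : (v.+1 < n)%N by move: (ltn_ord t'); lia.
  have av := arrow_end_lt vn.
  have vt' : (v == t') = false by apply/eqP => vE; apply: vne; subst v.
  have vt2 : (v == t) = false by apply/eqP => vE; subst v; lia.
  have := hm v; have := hm' v; rewrite vt' vt2 !mulmx1 => <- <-.
  by rewrite mulmxA -homf -!mulmxA IH // av; lia.
exists phi; split=> // tE; subst t'.
apply: (row_full_cancel hF).
have := hm t; have := hm' t; rewrite eqxx => e' e.
rewrite !mulmxA -e -E // -[RHS]mulmxA -e' mulmxA -homf -!mulmxA.
have [at_|at_] := leqP (arrow_end t) t; first by rewrite E.
by rewrite (eq_mx_col0 (vmap M t) 0 (h0 _ at_)) !mul0mx.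
Qed.

(** The arrow leaving t kills the space of M at t but is injective on that of M'. This treats the
    order of tops left out of [flag_hom] and [hom_flag]. *)
Lemma flag_hom_top_lt M t D th N M' t' D' th' N' f :
  @flag M t D th N -> @flag M' t' D' th' N' -> (t < t')%N ->
  @is_hom F n M M' f -> f t = 0.
Proof.
move=> [hf hm hF h0] [hf' hm' _ h0'] tt' homf.
have tn : (t.+1 < n)%N by move: (ltn_ord t'); lia.
have at_ : arrow_end t = t.+1 :> nat by apply: arrow_end_lt.
apply: (row_free_cancel (hf' t)); rewrite mul0mx.
have := hm' t; case: eqP => [tE|_]; first by subst t'; lia.
rewrite mulmx1 => <-; rewrite mulmxA -homf -mulmxA.
by rewrite (_ : vmap M t = 0) ?mul0mx //; apply/eq_mx_col0/h0; rewrite at_.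
Qed.

Lemma flag_isom M M' t D th N : isom M M' -> @flag M t D th N ->
  exists th', @flag M' t D th' N.
Proof.
move=> [a [b [ha hb ab ba]]] [hf hm hF h0].
have bf v : row_free (b v).
  by apply: (@row_free_Ml _ _ _ _ _ (a v)); rewrite ba row_free_unit unitmx1.
have dE v : vdim M v = vdim M' v.
  apply/eqP; rewrite eqn_leq; apply/andP; split.
    rewrite -[X in (X <= _)%N](mxrank1 F) -ab.
    exact: leq_trans (mxrankM_maxl _ _) (rank_leq_col _).
  rewrite -[X in (X <= _)%N](mxrank1 F) -ba.
  exact: leq_trans (mxrankM_maxl _ _) (rank_leq_col _).
exists (fun v => b v *m th v); split=> [v|v||v tv].
- exact: row_freeM.
- by rewrite mulmxA hb -!mulmxA hm.
- rewrite -sub1mx; apply: (@submx_trans _ _ _ _ _ _ (th t)).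
    by rewrite sub1mx.
  by rewrite -[X in (X <= _)%MS]mul1mx -ab -mulmxA; apply: submxMl.
- by rewrite -dE h0.
Qed.

End Flags.

(** * Explicit chains in a line and in a plane *)

Section ExplicitFlags.
Variable F : fieldType.

Definition seg_flag (d : nat) : 'M[F]_(d, 1) := const_mx 1.

Lemma row_free_seg_flag (b : bool) : row_free (seg_flag b).
Proof.
case: b; last exact: row_free0.
rewrite (_ : seg_flag _ = 1%:M) ?row_free_unit ?unitmx1 //.
by apply/matrixP=> i j; rewrite !ord1 !mxE.
Qed.

Lemma seg_flag_step (b1 b2 : bool) :
  (b1 -> b2) -> id_map F b1 b2 *m seg_flag b2 = seg_flag b1.
Proof.
case: b1 b2 => [] [] b12; try exact: eq_mx_row0; last by have := b12 isT.
apply/matrixP=> i j; rewrite !mxE big_ord_recl big_ord0 !mxE !ord1 /=.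
by rewrite mulr1 addr0.
Qed.

Definition sq_nil : 'M[F]_2 := \matrix_(a, b) ((a == 0%N :> nat) && (b == 1%N :> nat))%:R.

(** Coordinate subspaces of the plane as square matrices: up to row space they replace the matrices
    [quad_flag], whose number of rows depends on the vertex. *)
Definition axes (b0 b1 : bool) : 'M[F]_2 :=
  \matrix_(a, b) ((a == b :> nat) && (if a == 0%N :> nat then b0 else b1))%:R.

(** The boolean s selects the basis vector that spans the one-dimensional members of the chain: e_1
    for false, e_2 for true. *)
Definition quad_flag (s : bool) (d : nat) : 'M[F]_(d, 2) :=
  \matrix_(a, b) (if d == 2 then a == b :> nat else b == s :> nat)%:R.

Lemma forall_I2 (P : 'I_2 -> Prop) : P 0 -> P 1 -> forall i, P i.
Proof.
move=> P0 P1 [[|[|//]] i2].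
  by rewrite (_ : Ordinal _ = 0) //; apply: val_inj.
by rewrite (_ : Ordinal _ = 1) //; apply: val_inj.
Qed.

Lemma sum_I2 (f : 'I_2 -> F) : \sum_i f i = f 0 + f 1.
Proof.
by rewrite big_ord_recl big_ord_recl big_ord0 addr0; congr (_ + f _); apply: val_inj.
Qed.

Lemma matrix2P (A B : 'M[F]_2) :
  A 0 0 = B 0 0 -> A 0 1 = B 0 1 -> A 1 0 = B 1 0 -> A 1 1 = B 1 1 -> A = B.
Proof. by move=> ????; apply/matrixP; do 2![apply: forall_I2]. Qed.

Lemma row0_col_mx m (x z : 'M[F]_(1, m)) : row (0 : 'I_2) (col_mx x z) = x.
Proof. by apply/rowP => k; rewrite !mxE; case: splitP => // j' _; rewrite ord1. Qed.

Lemma row1_col_mx m (x z : 'M[F]_(1, m)) : row (1 : 'I_2) (col_mx x z) = z.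
Proof. by apply/rowP => k; rewrite !mxE; case: splitP => [[[]] //|k' _]; rewrite ord1. Qed.

Lemma col0_row_mx m (x z : 'M[F]_(m, 1)) : col (0 : 'I_2) (row_mx x z) = x.
Proof. by apply/colP => k; rewrite !mxE; case: splitP => // j' _; rewrite ord1. Qed.

Lemma col1_row_mx m (x z : 'M[F]_(m, 1)) : col (1 : 'I_2) (row_mx x z) = z.
Proof. by apply/colP => k; rewrite !mxE; case: splitP => [[[]] //|k' _]; rewrite ord1. Qed.

Lemma col_mulmx m p q (A : 'M[F]_(m, p)) (B : 'M_(p, q)) j :
  col j (A *m B) = A *m col j B.
Proof. by rewrite !colE mulmxA. Qed.

Lemma mulmx_entry m p q (A : 'M[F]_(m, p)) (B : 'M_(p, q)) i j :
  (A *m B) i j = (row i A *m col j B) 0 0.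
Proof. by rewrite !mxE; apply: eq_bigr => k _; rewrite !mxE. Qed.

Lemma row0_axes b0 b1 m (A : 'M[F]_(2, m)) :
  row 0 (axes b0 b1 *m A) = b0%:R *: row 0 A.
Proof. by apply/rowP => k; rewrite !mxE sum_I2 !mxE /= mul0r addr0. Qed.

Lemma row1_axes b0 b1 m (A : 'M[F]_(2, m)) :
  row 1 (axes b0 b1 *m A) = b1%:R *: row 1 A.
Proof. by apply/rowP => k; rewrite !mxE sum_I2 !mxE /= mul0r add0r. Qed.

Lemma row0_sq_nil m (A : 'M[F]_(2, m)) : row 0 (sq_nil *m A) = row 1 A.
Proof. by apply/rowP => k; rewrite !mxE sum_I2 !mxE /= mul0r mul1r add0r. Qed.

Lemma row1_sq_nil m (A : 'M[F]_(2, m)) : row 1 (sq_nil *m A) = 0.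
Proof. by apply/rowP => k; rewrite !mxE sum_I2 !mxE /= !mul0r addr0. Qed.

Lemma col0_sq_nil m (A : 'M[F]_(m, 2)) : col 0 (A *m sq_nil) = 0.
Proof. by apply/colP => k; rewrite !mxE sum_I2 !mxE /= !mulr0 addr0. Qed.

Lemma col1_sq_nil m (A : 'M[F]_(m, 2)) : col 1 (A *m sq_nil) = col 0 A.
Proof. by apply/colP => k; rewrite !mxE sum_I2 !mxE /= mulr1 mulr0 addr0. Qed.

Lemma sub_axesP m (A : 'M[F]_(m, 2)) b0 b1 :
  (A <= axes b0 b1)%MS <-> forall r, (b0 \/ A r 0 = 0) /\ (b1 \/ A r 1 = 0).
Proof.
split.
  case/submxP=> C -> r; rewrite !mxE !sum_I2 !mxE /=.
  by split; [case: b0|case: b1]; [left|right|left|right] => //; rewrite !mulr0 addr0.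
move=> H; rewrite (_ : A = A *m axes b0 b1) ?submxMl //.
apply/matrixP=> r; apply: forall_I2; rewrite !mxE !sum_I2 !mxE /= !mulr0.
  by case: (H r) => -[->|->] _; rewrite ?mulr1 ?mul0r addr0.
by case: (H r) => _ [->|->]; rewrite ?mulr1 ?mul0r add0r.
Qed.

Lemma quad_flag_step (s : bool) d1 d2 : (d1 <= d2 <= 2)%N -> 
  (if d1 == d2 then id_map F d1 d2 else \matrix_(a, b) (b == s :> nat)%:R)
    *m quad_flag s d2 = quad_flag s d1.
Proof.
case: d1 => [|[|[|d1]]] H; [exact: eq_mx_row0| | |by lia].
  case: d2 H => [|[|[|//]]] // _ /=; apply/matrixP=> i j.
    by rewrite !ord1 !mxE big_ord_recl big_ord0 !mxE /= mul1r addr0.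
  rewrite !mxE sum_I2 !mxE /=; case: s; rewrite /= ?mul0r ?mul1r ?add0r ?addr0.
    by congr (_%:R); rewrite eq_sym.
  by congr (_%:R); rewrite eq_sym.
case: d2 H => [|[|[|//]]] // _ /=; apply/matrixP=> i j.
rewrite !mxE sum_I2 !mxE; move: i j.
by do 2!apply: forall_I2; rewrite /= ?(mul0r, mul1r, mulr0, addr0, add0r).
Qed.

Lemma quad_flag_axes (s b0 b1 : bool) :
  (b0 && ~~ b1 -> ~~ s) -> (b1 && ~~ b0 -> s) ->
  (quad_flag s (b0 + b1) :=: axes b0 b1)%MS.
Proof.
move=> s0 s1; apply/eqmxP/andP; split.
  apply/sub_axesP; case: b0 b1 s0 s1 => [] [] //= s0 s1 r; rewrite !mxE /=.
  - by split; left.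
  - by rewrite (negPf (s0 isT)); split; [left|right].
  - by rewrite (s1 isT); split; [right|left].
  - by case: r.
case: b0 b1 s0 s1 => [] [] //= s0 s1.
- rewrite (_ : axes _ _ = quad_flag s 2) ?submx_refl //.
  by apply/matrix2P; rewrite !mxE.
- rewrite (_ : axes _ _ = (\col_a (a == 0%N :> nat)%:R) *m quad_flag s 1) ?submxMl //.
  rewrite (negPf (s0 isT)).
  by apply/matrix2P; rewrite !mxE big_ord_recl big_ord0 !mxE /= ?mul0r ?mulr0 ?mulr1 ?addr0.
- rewrite (_ : axes _ _ = (\col_a (a == 1%N :> nat)%:R) *m quad_flag s 1) ?submxMl //.
  rewrite (s1 isT).
  by apply/matrix2P; rewrite !mxE big_ord_recl big_ord0 !mxE /= ?mul0r ?mulr0 ?mulr1 ?addr0.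
- rewrite (_ : axes _ _ = 0) ?sub0mx //.
  by apply/matrix2P; rewrite !mxE.
Qed.

Lemma row_free_quad_flag s d : (d <= 2)%N -> row_free (quad_flag s d).
Proof.
case: d => [|[|[|//]]] _; first exact: row_free0.
  rewrite -kermx_eq0; apply/eqP/row_matrixP=> i; rewrite row0.
  have: (row i (kermx (quad_flag s 1)) <= kermx (quad_flag s 1))%MS by exact: row_sub.
  move/sub_kermxP; move: (row i _) => x xq; apply/matrixP=> a b.
  have := congr1 (fun A : 'M_(1, 2) => A 0 (if s then 1 else 0)) xq.
  rewrite !ord1 !mxE big_ord_recl big_ord0 !mxE addr0 /=.
  by case: (s); rewrite /= mulr1 => <-; congr (x _ _); apply: val_inj.
rewrite (_ : quad_flag _ _ = 1%:M) ?row_free_unit ?unitmx1 //.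
by apply/matrix2P; rewrite !mxE.
Qed.

Lemma sq_nil2 : sq_nil *m sq_nil = 0.
Proof. by apply/matrix2P; rewrite !mxE sum_I2 !mxE /= ?(mul0r, mulr0, addr0). Qed.

(** A Jordan block is a cyclic matrix, so its centralizer consists of the polynomials in it. *)
Lemma sq_nil_comm (A : 'M[F]_2) : sq_nil *m A = A *m sq_nil ->
  A = (A 0 0)%:M + A 0 1 *: sq_nil.
Proof.
move=> com.
have := congr1 (fun A : 'M_2 => A 0 0) com; have := congr1 (fun A : 'M_2 => A 0 1) com.
rewrite !mxE !sum_I2 !mxE /= ?(mul0r, mul1r, mulr0, mulr1, addr0, add0r) => e11 e10.
by apply/matrix2P; rewrite !mxE /= ?(mulr0, mulr1, mulr0n, mulr1n, add0r, addr0).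
Qed.

End ExplicitFlags.

(** The side condition is a polynomial identity, so [ring] can deduce one equation from another by
    comparing differences. *)
Lemma subr_eq_trans (V : zmodType) (x y u v : V) :
  x = y -> u - v = x - y -> u = v.
Proof. by move=> ->; rewrite subrr => /eqP; rewrite subr_eq0 => /eqP. Qed.

(** * Standard representations and their endomorphism rings *)

Section Standard.
Variables (F : fieldType) (n : nat).

(** The case j = n is allowed and will stand for V_i: there the loop acts as 0, while for j < n the
    arrow leaving t ends in a zero space. *)
Lemma W_flag i j (t : 'I_n) : (1 <= i <= j)%N -> t.+1 = j ->
  flag (M := W F n i j) t (fun v => seg_flag F (i <= v.+1 <= j)%N) 0.
Proof.
move=> ij tj; split=> [v|v||v tv].
- exact: row_free_seg_flag.
- case: eqP => [->|vt] /=.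
    case: eqP => [_|tn]; first by rewrite mul0mx mulmx0.
    have tn' : (t.+1 < n)%N by move: (ltn_ord t); lia.
    rewrite mulmx0 [X in X *m _](_ : _ = 0) ?mul0mx //; apply: eq_mx_col0.
    by rewrite (arrow_end_lt tn'); lia.
  have [tv|tv] := leqP v t; last by apply: eq_mx_row0; rewrite /=; lia.
  have vt' : (v < t)%N.
    by rewrite ltn_neqAle tv andbT; apply/eqP => /val_inj.
  case: eqP => [vn|vn]; first by move: (ltn_ord t); lia.
  rewrite mulmx1; apply: seg_flag_step.
  by rewrite arrow_end_lt; move: (ltn_ord t); lia.
- suff full d : d = 1%N -> row_full (seg_flag F d) by apply: full => /=; lia.
  by move=> ->; have := row_free_seg_flag F true; rewrite /row_free /row_full.
- by rewrite /=; lia.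
Qed.

Lemma U_dimE i j (v : 'I_n) : U_dim i j v = ((j <= v.+1) + (i <= v.+1))%N.
Proof. by rewrite /U_dim; case: ifP; [|case: ifP]; lia. Qed.

Definition U_th i j (v : 'I_n) : 'M[F]_(vdim (U F n i j) v, 2) :=
  quad_flag F (i < j)%N (U_dim i j v).

(** The vector e_1 is present from the vertex j on and e_2 from the vertex i on; this crossing of
    the indices recurs in all later computations with U_{i,j}. *)
Lemma U_th_axes i j v :
  (U_th i j v :=: axes F (j <= v.+1)%N (i <= v.+1)%N)%MS.
Proof.
by rewrite /U_th /= U_dimE; apply: quad_flag_axes; lia.
Qed.

Lemma U_flag i j (t : 'I_n) : (1 <= i <= n)%N -> (1 <= j <= n)%N -> t.+1 = n ->
  flag (M := U F n i j) t (U_th i j) (sq_nil F).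
Proof.
move=> hi hj tn; split=> [v|v||v tv].
- by apply: row_free_quad_flag; rewrite /= U_dimE; lia.
- rewrite /= /U_th /=; case: (v =P t) => [vt|vt].
    have vn : v.+1 = n by rewrite vt.
    have de : U_dim i j (arrow_end v) = 2%N by rewrite U_dimE arrow_end_last //; lia.
    have dv : U_dim i j v = 2%N by rewrite U_dimE; lia.
    rewrite vn eqxx; move: (U_dim i j (arrow_end v)) (U_dim i j v) de dv => d1 d2 -> -> {d1 d2}.
    by apply/matrix2P; rewrite !mxE !sum_I2 !mxE /= ?(mulr0, mul0r, addr0, add0r, mulr1).
  have vn : (v.+1 < n)%N.
    rewrite ltn_neqAle ltn_ord andbT; apply/eqP => vn; apply: vt.
    by apply: val_inj => /=; lia.
  rewrite (_ : (v.+1 == n) = false); last by lia.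
  rewrite mulmx1; apply: quad_flag_step.
  by rewrite !U_dimE arrow_end_lt //; lia.
- rewrite -sub1mx U_th_axes; apply/sub_axesP => r.
  by split; left; lia.
- by move: (ltn_ord v); lia.
Qed.

(* The endomorphisms of M are the matrices commuting with N that preserve the
   chain th, so End M is F or F[e]/(e^2). *)
Definition nice (M : qrep F n) : Prop := exists t D th N,
  [/\ @flag F n M t D th N, (0 < D)%N, N *m N = 0 &
      forall phi, N *m phi = phi *m N -> exists c b, phi = c%:M + b *: N].

Lemma nice_isom M M' : isom M M' -> nice M -> nice M'.
Proof.
move=> MM' [t [D [th [N [fl D0 N2 com]]]]].
by have [th' fl'] := flag_isom MM' fl; exists t, D, th', N.
Qed.

Lemma nice_W i j : (1 <= i <= j)%N -> (j <= n)%N -> nice (W F n i j).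
Proof.
move=> ij jn; have tn : (j.-1 < n)%N by lia.
exists (Ordinal tn), 1%N, (fun v => seg_flag F (i <= v.+1 <= j)%N), 0; split=> //.
- by apply: W_flag => //=; lia.
- by rewrite mul0mx.
- move=> phi _; exists (phi 0 0), 0.
  by rewrite scale0r addr0 -mx11_scalar.
Qed.

Lemma nice_U i j : (1 <= i <= n)%N -> (1 <= j <= n)%N -> nice (U F n i j).
Proof.
move=> hi hj; have tn : (n.-1 < n)%N by lia.
exists (Ordinal tn), 2%N, (U_th i j), (sq_nil F); split=> //.
- by apply: U_flag => //=; lia.
- exact: sq_nil2.
- by move=> phi /sq_nil_comm ->; exists (phi 0 0), (phi 0 1).
Qed.

Lemma nice_nonzero M : nice M -> ~ is_zero M.
Proof.
move=> [t [D [th [N [[_ _ + _] D0 _ _]]]]] z.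
by rewrite /row_full => /eqP E; move: (rank_leq_row (th t)); rewrite E z; lia.
Qed.

Lemma hom_id M : @is_hom F n M M (fun v => 1%:M).
Proof. by move=> v; rewrite mulmx1 mul1mx. Qed.

Lemma hom_comp M1 M2 M3 f g : @is_hom F n M1 M2 f -> @is_hom F n M2 M3 g ->
  is_hom (fun v => f v *m g v).
Proof. by move=> hf hg v; rewrite mulmxA hf -mulmxA hg mulmxA. Qed.

Lemma hom_add M1 M2 f g : @is_hom F n M1 M2 f -> @is_hom F n M1 M2 g ->
  is_hom (fun v => f v + g v).
Proof. by move=> hf hg v; rewrite mulmxDr mulmxDl hf hg. Qed.

Lemma hom_scale M1 M2 f (c : F) : @is_hom F n M1 M2 f ->
  is_hom (fun v => c *: f v).
Proof. by move=> hf v; rewrite -scalemxAr -scalemxAl hf. Qed.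

Lemma hom_sub M1 M2 f g : @is_hom F n M1 M2 f -> @is_hom F n M1 M2 g ->
  is_hom (fun v => f v - g v).
Proof. by move=> hf hg v; rewrite mulmxBr mulmxBl hf hg. Qed.

Lemma hom0 M1 M2 : @is_hom F n M1 M2 (fun v => 0).
Proof. by move=> v; rewrite mulmx0 mul0mx. Qed.

Lemma hom_invl M1 M2 M3 f g : @is_hom F n M1 M3 f -> @is_hom F n M2 M3 g ->
  (forall v, row_free (g v)) ->
  forall h, (forall v, h v *m g v = f v) -> @is_hom F n M1 M2 h.
Proof.
move=> hf hg fg h hE v; apply: (row_free_cancel (fg (arrow_end v))).
by rewrite -!mulmxA hE hf hg mulmxA hE.
Qed.

Lemma hom_invr M1 M2 M3 f g : @is_hom F n M1 M3 f -> @is_hom F n M1 M2 g ->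
  (forall v, row_full (g v)) ->
  forall h, (forall v, g v *m h v = f v) -> @is_hom F n M2 M3 h.
Proof.
move=> hf hg fg h hE v; apply: (row_full_cancel (fg v)).
by rewrite !mulmxA -hg -mulmxA !hE hf.
Qed.

Lemma nice_endo M t D th N f : @flag F n M t D th N ->
  (forall phi, N *m phi = phi *m N -> exists c b, phi = c%:M + b *: N) ->
  @is_hom F n M M f ->
  exists c b, forall v, f v *m th v = th v *m (c%:M + b *: N).
Proof.
move=> fl com hf; have [phi [E /(_ erefl) /com[c [b phiE]]]] := hom_flag fl fl (leqnn t) hf.
exists c, b => v; rewrite -phiE; have [/E//|vt] := leqP v t.
by apply: eq_mx_row0; case: fl => _ _ _ ->.
Qed.

(** Comparing scalar and nilpotent parts, an idempotent c + b N satisfies c^2 = c and b (1 - 2 c) N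
    = 0. As 1 - 2 c is then 1 or -1, b N = 0 in every characteristic. *)
Lemma nice_idem M e : nice M -> @is_hom F n M M e ->
  (forall v, e v *m e v = e v) ->
  (forall v, e v = 1%:M) \/ (forall v, e v = 0).
Proof.
move=> [t [D [th [N [fl D0 N2 com]]]]] he ee.
have [c [b E]] := nice_endo fl com he.
case: (fl) => fr _ ff _.
have: (c%:M + b *: N) *m (c%:M + b *: N) = c%:M + b *: N.
  apply: (row_full_cancel ff); rewrite mulmxA -E -[LHS]mulmxA -E mulmxA ee E //.
rewrite mulmxDl !mulmxDr -!scalemxAl -!scalemxAr N2 !scaler0 addr0.
rewrite !mul_scalar_mx !mul_mx_scalar scale_scalar_mx.
have nz : (1%:M : 'M[F]_D) != 0.
  by apply/eqP => /matrixP/(_ (Ordinal D0) (Ordinal D0))/eqP; rewrite !mxE eqxx oner_eq0.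
(* Multiplication by N removes the nilpotent part of Q. Hence c^2 <> c would force N = 0, which Q
   then contradicts. *)
move=> Q; have cN : (c * c - c) *: N = 0.
  have := congr1 (fun A => A *m N) Q; rewrite !mulmxDl -!scalemxAl !N2 !scaler0 !addr0.
  by rewrite !mul_scalar_mx scalerBl => ->; rewrite subrr.
have : (c * c - c) *: (1%:M : 'M[F]_D) = (b - (c * b + b * c)) *: N.
  apply/matrixP=> i j; apply: (subr_eq_trans (congr1 (fun A : 'M_D => A i j) Q)).
  by rewrite !mxE; case: (i == j); rewrite ?mulr1n ?mulr0n; ring.
have [c0|c0] := eqVneq (c * c - c) 0; last first.
  move: cN => /eqP; rewrite scaler_eq0 (negPf c0) /= => /eqP ->.
  by move/eqP; rewrite scaler0 scaler_eq0 (negPf c0) (negPf nz).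
rewrite c0 scale0r => /esym/eqP; rewrite scaler_eq0 => bN.
have bN0 : c = 0 \/ c = 1 -> b *: N = 0.
  case/orP: bN => /eqP; last by move=> ->; rewrite scaler0.
  move=> + [] c01; rewrite c01 ?(mul0r, mulr0, mul1r, mulr1, addr0, subr0).
    by move=> ->; rewrite scale0r.
  rewrite opprD addrA subrr add0r => /eqP; rewrite oppr_eq0 => /eqP ->.
  by rewrite scale0r.
have {c0}c01 : c = 0 \/ c = 1.
  have /eqP: c * (c - 1) = 0 by rewrite mulrBr mulr1.
  by rewrite mulf_eq0 subr_eq0 => /orP[]/eqP ->; [left|right].
case: c01 (bN0 c01) => cE {}bN0; [right|left] => v; apply: (row_free_cancel (fr v)).
  by rewrite E bN0 addr0 cE -scalemx1 scale0r mulmx0 mul0mx.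
by rewrite E bN0 addr0 cE mulmx1 mul1mx.
Qed.

Lemma scalar_nil_unit D (N : 'M[F]_D) c b : N *m N = 0 -> c != 0 ->
  (c%:M + b *: N) *m (c^-1%:M - (c ^- 2 * b) *: N) = 1%:M.
Proof.
move=> N2 c0; rewrite mulmxDl !mulmxBr -!scalemxAl -!scalemxAr N2 !scaler0 subr0.
rewrite !mul_scalar_mx !mul_mx_scalar scale_scalar_mx mulfV // !scalerA.
rewrite -addrA -scaleNr -scalerDl (_ : - _ + _ = 0) ?scale0r ?addr0 //.
by field.
Qed.

(** An endomorphism c + b N with c <> 0 is invertible. If both scalar parts were 0, the identity
    would be a multiple of N and have square zero. *)
Lemma nice_local M e1 e2 : nice M -> @is_hom F n M M e1 -> @is_hom F n M M e2 ->
  (forall v, e1 v + e2 v = 1%:M) ->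
  (forall v, e1 v \in unitmx) \/ (forall v, e2 v \in unitmx).
Proof.
move=> [t [D [th [N [fl D0 N2 com]]]]] h1 h2 e12.
have [c1 [b1 E1]] := nice_endo fl com h1.
have [c2 [b2 E2]] := nice_endo fl com h2.
case: (fl) => fr _ ff _.
have U e c b : (forall v, e v *m th v = th v *m (c%:M + b *: N)) -> c != 0 ->
    forall v, e v \in unitmx.
  move=> E c0 v; rewrite -row_free_unit; apply: (@row_free_Ml _ _ _ _ _ (th v)).
  rewrite E; apply: row_freeM => //; rewrite row_free_unit.
  by have /mulmx1_unit[] := scalar_nil_unit b N2 c0.
have [c10|c1n] := eqVneq c1 0; last by left; apply: U E1 _.
have [c20|c2n] := eqVneq c2 0; last by right; apply: U E2 _.
have Z : 1%:M = (b1 + b2) *: N.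
  apply: (row_full_cancel ff); rewrite mulmx1.
  have := congr1 (fun A => A *m th t) (e12 t); rewrite mul1mx mulmxDl E1 E2 => E12.
  rewrite -[LHS]E12.
  by rewrite c10 c20 -mulmxDr -scalemx1 scale0r !add0r scalerDl.
have : (1%:M : 'M[F]_D) = 0.
  rewrite -[LHS]mulmx1 [X in X *m _]Z [X in _ *m X]Z -scalemxAl -scalemxAr N2.
  by rewrite !scaler0.
by move=> /matrixP/(_ (Ordinal D0) (Ordinal D0))/eqP; rewrite !mxE eqxx oner_eq0.
Qed.

(** A decomposition of M yields the idempotent projecting onto the first summand; since it is 1 or
    0, one of the summands is zero. *)
Lemma nice_indec (M : amod F n) : nice M -> indecomposable M.
Proof.
move=> nM; split=> [|X Y [f [g [hf hg fg gf]]]]; first exact: nice_nonzero.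
pose p v : 'M[F]_(vdim (dsum X Y) v) := block_mx 1%:M 0 0 0.
have pp v : p v *m p v = p v.
  by rewrite mulmx_block !(mulmx0, mul0mx, mulmx1, mul1mx, addr0, add0r).
pose e v := f v *m p v *m g v.
have he : is_hom e.
  apply: (@hom_comp M (dsum X Y) M (fun v => f v *m p v) g) => //.
  apply: (@hom_comp M (dsum X Y) (dsum X Y) f p) => // v.
  by rewrite /= !mulmx_block !(mulmx0, mul0mx, mulmx1, mul1mx, addr0, add0r).
have [v|e1|e0] := nice_idem nM he.
- by rewrite /e -!mulmxA (mulmxA (g v)) gf mul1mx (mulmxA (p v)) pp.
- right=> v; have : (block_mx 1%:M 0 0 0 : 'M[F]_(vdim X v + vdim Y v)) = 1%:M.
    have := congr1 (fun A => g v *m A *m f v) (e1 v).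
    by rewrite /e mulmx1 -!mulmxA gf mulmx1 mulmxA gf mul1mx.
  rewrite (@scalar_mx_block _ _ _ 1) => /eq_block_mx[_ _ _ E].
  by rewrite -[LHS](mxrank1 F) -E mxrank0.
- left=> v; have : (block_mx 1%:M 0 0 0 : 'M[F]_(vdim X v + vdim Y v)) = 0.
    have := congr1 (fun A => g v *m A *m f v) (e0 v).
    by rewrite /e mulmx0 mul0mx -!mulmxA gf mulmx1 mulmxA gf mul1mx.
  rewrite -[RHS]block_mx0 => /eq_block_mx[E _ _ _].
  by rewrite -[LHS](mxrank1 F) E mxrank0.
Qed.

End Standard.

(** * Radicals of endomorphism rings and conservative extensions *)

Section Radical.
Local Open Scope classical_set_scope.
Variables (F : fieldType) (n : nat) (M : qrep F n).
Variables (t : 'I_n) (D : nat) (th : forall v, 'M[F]_(vdim M v, D)) (N : 'M[F]_D).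
Hypotheses (fl : flag t th N) (D0 : (0 < D)%N) (N2 : N *m N = 0).
Hypothesis com : forall phi, N *m phi = phi *m N -> exists c b, phi = c%:M + b *: N.

(** The candidate for the radical: the endomorphisms with scalar part 0. It contains every proper
    left ideal, because an endomorphism outside it is invertible. *)
Definition nil_endo : set (fam M) :=
  [set f | endo M f /\ exists b, forall v, f v *m th v = th v *m (b *: N)].

Let fr v : row_free (th v). Proof. by case: fl. Qed.
Let ff : row_full (th t). Proof. by case: fl. Qed.

Lemma endo_decomp f : endo M f -> exists c, nil_endo (fun v => f v - c%:M).
Proof.
move=> hf; have [c [b E]] := nice_endo fl com hf.
exists c; split.
  apply: hom_sub => // v; by rewrite mul_mx_scalar mul_scalar_mx.
by exists b => v; rewrite mulmxBl E mulmxDr mul_scalar_mx mul_mx_scalar addrC addKr.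
Qed.

Lemma nil_endoM f g : nil_endo f -> nil_endo g -> forall v, f v *m g v = 0.
Proof.
move=> [_ [b Ef]] [_ [c Eg]] v; apply: (row_free_cancel (fr v)).
by rewrite -mulmxA Eg mulmxA Ef -!scalemxAr -!scalemxAl -mulmxA N2 mulmx0 !scaler0 mul0mx.
Qed.

Lemma nil_endoZ c f : nil_endo f -> nil_endo (fun v => c *: f v).
Proof.
move=> [hf [b E]]; split; first exact: hom_scale.
by exists (c * b) => v; rewrite -scalemxAl E -!scalemxAr scalerA.
Qed.

Lemma nil_endoD f g : nil_endo f -> nil_endo g -> nil_endo (fam_add f g).
Proof.
move=> [hf [b Ef]] [hg [c Eg]]; split; first exact: hom_add.
by exists (b + c) => v; rewrite /fam_add mulmxDl Ef Eg scalerDl mulmxDr.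
Qed.

Lemma endo_scalar c : endo M (fun v => c%:M).
Proof. by move=> v; rewrite mul_mx_scalar mul_scalar_mx. Qed.

Lemma nil_endo1 : ~ nil_endo (@fam1 F n M).
Proof.
move=> [_ [b /(_ t)]]; rewrite /fam1 mul1mx -[LHS]mulmx1 => /(row_full_cancel ff) E.
have : (1%:M : 'M[F]_D) = 0.
  by rewrite -[LHS]mulmx1 [X in X *m _]E [X in _ *m X]E -scalemxAl -scalemxAr N2 !scaler0.
by move=> /matrixP/(_ (Ordinal D0) (Ordinal D0))/eqP; rewrite !mxE eqxx oner_eq0.
Qed.

Lemma nil_endo_ideal : left_ideal nil_endo.
Proof.
split=> [f [] //||f g|f g hf Ng]; [|exact: nil_endoD|].
  split; first exact: hom0.
  by exists 0 => v; rewrite mul0mx scale0r mulmx0.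
split; first by case: Ng => hg _; apply: (hom_comp hg hf).
have [c [b E]] := nice_endo fl com hf.
case: Ng => _ [b' E']; exists (b' * c) => v.
rewrite /fam_mul -mulmxA E mulmxA E' -mulmxA mulmxDr -!scalemxAl -scalemxAr N2.
by rewrite !scaler0 addr0 mul_mx_scalar scalerA.
Qed.

Lemma left_ideal_all (I : set (fam M)) : left_ideal I -> I (@fam1 F n M) -> I = endo M.
Proof.
move=> [Ie _ _ Im] I1; apply/seteqP; split=> // f hf.
rewrite (_ : f = fam_mul f (@fam1 F n M)); first exact: Im.
by apply: functional_extensionality_dep => v; rewrite /fam_mul mul1mx.
Qed.

Lemma proper_left_ideal (I : set (fam M)) : left_ideal I -> I <> endo M -> I `<=` nil_endo.
Proof.
move=> lI pI f If; have [Ie I0 Ia Im] := lI.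
have [c Nf] := endo_decomp (Ie _ If); have [c0|c0] := eqVneq c 0.
  rewrite (_ : f = (fun v => f v - c%:M)) //.
  by apply: functional_extensionality_dep => v; rewrite c0 -scalemx1 scale0r subr0.
case: pI; apply: left_ideal_all => //.
(* The inverse of c + nu with nu^2 = 0 is c^-1 - c^-2 nu. *)
pose g := fam_add (fun v => c^-1%:M) (fun v => (- c ^- 2) *: (f v - c%:M)).
have hg : endo M g.
  by apply: hom_add; [exact: endo_scalar|case: (nil_endoZ (- c ^- 2) Nf)].
rewrite (_ : (@fam1 F n M) = fam_mul g f); first exact: Im.
apply: functional_extensionality_dep => v; rewrite /fam_mul /g /fam_add /fam1.
have := nil_endoM Nf Nf v; set nu := f v - _ => nu2.
have -> : f v = c%:M + nu by rewrite addrC subrK.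
rewrite mulmxDl !mulmxDr -!scalemxAr nu2 scaler0 addr0 !mul_scalar_mx mul_mx_scalar.
rewrite scale_scalar_mx mulfV // scalerA -addrA -scalerDl (_ : - c ^- 2 * c + c^-1 = 0)
  ?scale0r ?addr0 //.
by field.
Qed.

Lemma nil_endo_maximal : maximal_left_ideal nil_endo.
Proof.
split; first exact: nil_endo_ideal.
  by move=> E; apply: nil_endo1; rewrite E; apply: endo_scalar.
move=> J lJ NJ; have [JE|JE] := pselect (J = endo M); [by right|left].
by apply/seteqP; split=> //; apply: proper_left_ideal.
Qed.

Lemma rad_endoE : rad_endo M = nil_endo.
Proof.
apply/seteqP; split=> f; first by move=> [_]; apply; apply: nil_endo_maximal.
move=> Nf; split=> [|I [lI pI mI]]; first by case: Nf.
have [<- //|E] := mI _ nil_endo_ideal (proper_left_ideal lI pI).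
by case: nil_endo1; rewrite E; apply: endo_scalar.
Qed.

Section Extension.
Variables (E : fieldType) (iota : {rmorphism F -> E}).

Let J := extend_space iota (rad_endo M).

Lemma extend_space_sum (S : set (fam M)) k (c : 'I_k -> E) (f : 'I_k -> fam (extend iota M)) :
  (forall i, extend_space iota S (f i)) ->
  extend_space iota S (fun v => \sum_i c i *: f i v).
Proof.
elim: k c f => [|k IH] c f H.
  by exists 0%N, (fun=> 0), (fun=> @fam0 F n M); split=> [[]//|v]; rewrite !big_ord0.
have [m [d [g [Sg gE]]]] := IH (fun i => c (fintype.lift ord0 i)) (fun i => f (fintype.lift
  ord0 i)) (fun i => H _).
have [m' [d' [g' [Sg' gE']]]] := H ord0.
exists (m' + m)%N, (fun i => match split i with inl i => c ord0 * d' i | inr i => d i end),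
  (fun i => match split i with inl i => g' i | inr i => g i end); split.
  by move=> i; case: (split i).
move=> v; rewrite big_ord_recl big_split_ord /=; congr (_ + _).
  rewrite gE' scaler_sumr; apply: eq_bigr => i _.
  by rewrite scalerA (unsplitK (inl i : 'I_m' + 'I_m)).
rewrite gE; apply: eq_bigr => i _.
by rewrite (unsplitK (inr i : 'I_m' + 'I_m)).
Qed.

Lemma extend_space_sub (S : set (fam M)) f :
  S f -> extend_space iota S (fun v => map_mx iota (f v)).
Proof.
move=> Sf; exists 1%N, (fun=> 1), (fun=> f); split=> // v.
by rewrite big_ord_recl big_ord0 addr0 scale1r.
Qed.

Lemma ext_radM f g : J f -> J g -> forall v, f v *m g v = 0.
Proof.
move=> [k [c [f' [Nf fE]]]] [k' [c' [g' [Ng gE]]]] v.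
rewrite fE gE mulmx_suml big1 // => i _; rewrite mulmx_sumr big1 // => j _.
rewrite -scalemxAl -scalemxAr -map_mxM.
have := nil_endoM _ _ v; rewrite -rad_endoE => /(_ _ _ (Nf i) (Ng j)) ->.
by rewrite map_mx0 !scaler0.
Qed.

Lemma ext_endo_decomp f : extend_space iota (endo M) f ->
  exists c, J (fun v => f v - c%:M).
Proof.
move=> [k [c [g [hg fE]]]].
have /choice[a aE] : forall i, exists a, nil_endo (fun v => g i v - a%:M).
  by move=> i; apply: endo_decomp.
exists (\sum_i c i * iota (a i)); exists k, c, (fun i v => g i v - (a i)%:M); split.
  by move=> i; rewrite rad_endoE.
move=> v; rewrite fE raddf_sum -sumrB; apply: eq_bigr => i _ /=.
by rewrite map_mxB map_scalar_mx scalerBr scale_scalar_mx.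
Qed.

Lemma ext_radZ c f : J f -> J (fun v => c *: f v).
Proof.
move=> Jf; have /(extend_space_sum (fun=> c)) : forall i : 'I_1, J f by [].
rewrite (_ : (fun v => \sum_i _) = (fun v => c *: f v)) //.
apply: functional_extensionality_dep => v.
by rewrite !big_ord_recl big_ord0 addr0.
Qed.

Lemma ext_rad1 : ~ J (@fam1 E n (extend iota M)).
Proof.
move=> J1; have D1 : (0 < vdim M t)%N.
  by move: ff; rewrite /row_full => /eqP eD; move: (rank_leq_row (th t)); rewrite eD; lia.
have := ext_radM J1 J1 t; rewrite /fam1 mulmx1.
by move=> /matrixP/(_ (Ordinal D1) (Ordinal D1))/eqP; rewrite !mxE eqxx oner_eq0.
Qed.

(** Modulo J every element is a scalar of E, so the quotient is E itself. *)
Lemma ext_quotient_is_field : quotient_is_field (extend_space iota (endo M)) J.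
Proof.
split; first exact: ext_rad1.
  move=> f g /ext_endo_decomp[a Jf] /ext_endo_decomp[b Jg].
  (* The commutator is exactly 0, which is written as the empty combination. *)
  exists 0%N, (fun=> 0), (fun=> @fam0 F n M); split=> [[]//|v]; rewrite big_ord0.
  have fE : f v = a%:M + (f v - a%:M) by rewrite addrC subrK.
  have gE : g v = b%:M + (g v - b%:M) by rewrite addrC subrK.
  have fg : (f v - a%:M) *m (g v - b%:M) = 0 := ext_radM Jf Jg v.
  have gf : (g v - b%:M) *m (f v - a%:M) = 0 := ext_radM Jg Jf v.
  rewrite /fam_sub /fam_mul fE gE.
  move: (f v - a%:M) (g v - b%:M) fg gf => nu mu fg gf.
  rewrite !mulmxDl !mulmxDr fg gf.
  rewrite !mul_scalar_mx !mul_mx_scalar !addr0 !scale_scalar_mx (mulrC b a).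
  by apply/eqP; rewrite subr_eq0 -!addrA; apply/eqP; congr (_ + _); rewrite addrC.
move=> f /ext_endo_decomp[a Jf] nJf.
have a0 : a != 0.
  apply/eqP=> a0; apply: nJf; rewrite (_ : f = (fun v => f v - a%:M)) //.
  by apply: functional_extensionality_dep => v; rewrite a0 -scalemx1 scale0r subr0.
exists (fun v => a^-1%:M).
  have := extend_space_sub (endo_scalar 1).
  move=> H; have /(extend_space_sum (fun=> a^-1)) := fun i : 'I_1 => H.
  rewrite (_ : (fun v => \sum_i _) = (fun v => a^-1%:M)) //.
  apply: functional_extensionality_dep => v.
  by rewrite big_ord_recl big_ord0 addr0 map_scalar_mx rmorph1 scale_scalar_mx mulr1.
rewrite (_ : fam_sub _ _ = fun v => a^-1 *: (f v - a%:M)); first exact: ext_radZ.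
apply: functional_extensionality_dep => v; rewrite /fam_sub /fam_mul /fam1.
by rewrite mul_scalar_mx scalerBr scale_scalar_mx mulVf.
Qed.

End Extension.

End Radical.

Lemma nice_quotient_is_field (K E : fieldType) (iota : {rmorphism K -> E}) n
    (M : qrep K n) : nice M ->
  quotient_is_field (extend_space iota (endo M)) (extend_space iota (rad_endo M)).
Proof.
move=> [t [D [th [N [fl D0 N2 com]]]]].
exact: (ext_quotient_is_field fl D0 N2 com).
Qed.

(** * Classification of the indecomposable modules *)

Section SubQuo.
Variables (F : fieldType) (n : nat) (M : qrep F n) (U : subfam M).
Hypothesis sU : stable_fam U.

Lemma stable_le v : (U v *m vmap M v <= U (arrow_end v))%MS.
Proof. by move/forallP: sU; apply. Qed.

Lemma sub_rep_hom : @is_hom F n (sub_rep U) M (fun v => val_submod (U := U v) 1%:M).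
Proof.
move=> v; rewrite /= -val_submodE in_submodK //.
by apply: submx_trans (stable_le v); apply: submxMr; apply: val_submodP.
Qed.

(** The induced map on M/U is computed on the complement given by [val_factmod]. Replacing a vector
    by its component there changes it by a vector of U, which stability sends into U. *)
Lemma quo_rep_hom : @is_hom F n M (quo_rep U) (fun v => in_factmod (U v) 1%:M).
Proof.
move=> v; rewrite /= (in_factmodE _ (val_factmod 1%:M *m vmap M v)).
have subE m1 m2 m3 m4 (A : 'M[F]_(m1, m3)) (Q : 'M_(m1, m2)) (B : 'M_(m2, m3)) (P : 'M_(m3,
  m4)) :
  A *m P - Q *m (B *m P) = (A - Q *m B) *m P by rewrite mulmxBl mulmxA.
apply/eqP; rewrite -subr_eq0 subE -in_factmodE in_factmod_eq0.
apply: submx_trans (stable_le v).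
have := add_sub_fact_mod (U v) 1%:M; rewrite (val_factmodE (in_factmod _ _)).
move: (in_factmod _ _) (val_factmod _) => P Q /(canRL (addrK _)) PQ.
have -> : vmap M v - P *m (Q *m vmap M v) = val_submod (in_submod (U v) 1%:M) *m vmap M v.
  by rewrite mulmxA PQ mulmxBl mul1mx.
by apply: submxMr; apply: val_submodP.
Qed.

End SubQuo.

Section Summands.
Variables (F : fieldType) (n : nat).

Lemma isom_intro (M N : qrep F n) f g : @is_hom F n M N f ->
  (forall v, f v *m g v = 1%:M) -> (forall v, g v *m f v = 1%:M) -> isom M N.
Proof.
move=> hf fg gf; exists f, g; split=> //.
apply: (hom_invr (hom_id M) hf) => // v.
by rewrite -sub1mx -(gf v) submxMl.
Qed.

Lemma dsum_bound (X Y : amod F n) : bound (dsum X Y).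
Proof.
move=> v vn; rewrite /= mulmx_block !mul0mx !mulmx0 !(add0r, addr0).
by rewrite !amodP // block_mx0.
Qed.

Definition dsum_amod (X Y : amod F n) : amod F n := AMod (dsum_bound X Y).

Lemma bound_sub (X M : qrep F n) f : @is_hom F n X M f ->
  (forall v, row_free (f v)) -> bound M -> bound X.
Proof.
move=> hf ff bM v vn; apply: (row_free_cancel (ff _)).
by rewrite mul0mx -mulmxA hf mulmxA hf -mulmxA bM // mulmx0.
Qed.

Lemma row_free_val_submod m (A : 'M[F]_m) : row_free (val_submod (U := A) 1%:M).
Proof. by rewrite /val_submod /= mul1mx; apply: row_base_free. Qed.

Lemma in_submodMl m p q (A : 'M[F]_m) (B : 'M_(p, q)) (C : 'M_(q, m)) :
  B *m in_submod A C = in_submod A (B *m C).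
Proof. by rewrite in_submodE [RHS]in_submodE mulmxA. Qed.

(** Correcting f by the inverse of the composite makes g a retraction, and the complement is the
    kernel of g. Units are allowed in place of identities because the maps found for U_{i,j} compose
    only to 1 + c N. *)
Lemma unit_summand (Z M : amod F n) f g : @is_hom F n Z M f -> @is_hom F n M Z g ->
  (forall v, f v *m g v \in unitmx) -> exists M', isom M (dsum Z (M' : amod F n)).
Proof.
move=> hf hg fgU.
pose f' v := invmx (f v *m g v) *m f v.
have hf' : is_hom f'.
  apply: (hom_invr hf (hom_comp hf hg)) => v; first by rewrite row_full_unit.
  by rewrite /f' mulmxA mulmxV // mul1mx.
have f'g v : f' v *m g v = 1%:M by rewrite -mulmxA mulVmx.
clearbody f'; clear f hf fgU.
pose U : subfam M := [ffun v => kermx (g v)].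
have sU : stable_fam U.
  apply/forallP => v; rewrite !ffunE; apply/sub_kermxP.
  by rewrite -mulmxA hg mulmxA mulmx_ker mul0mx.
have hU := sub_rep_hom sU.
pose M' := AMod (bound_sub hU (fun v => row_free_val_submod (U v)) (amodP M)).
exists M'; apply: isom_sym.
have sub_ker v : (1%:M - g v *m f' v <= U v)%MS.
  rewrite ffunE; apply/sub_kermxP.
  by rewrite mulmxBl mul1mx -mulmxA f'g mulmx1 subrr.
have val_ker v : val_submod (U := U v) 1%:M *m g v = 0.
  apply/sub_kermxP; apply: submx_trans (val_submodP _) _.
  by rewrite ffunE.
pose b v : 'M_(vdim (dsum Z M') v, vdim M v) := col_mx (f' v) (val_submod (U := U v) 1%:M).
pose a v : 'M_(vdim M v, vdim (dsum Z M') v) :=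
  row_mx (g v) (in_submod (U v) (1%:M - g v *m f' v)).
apply: (@isom_intro (dsum Z M') M b a) => v; rewrite /a /b.
- rewrite /= mul_block_col !mul0mx addr0 add0r hf' mul_col_mx; congr col_mx.
  exact: hU.
- rewrite mul_col_row f'g val_ker (@scalar_mx_block _ _ _ 1); congr block_mx.
    rewrite in_submodMl (_ : _ *m _ = 0) ?linear0 //.
    by rewrite mulmxBr mulmx1 mulmxA f'g mul1mx subrr.
  rewrite in_submodMl (_ : _ *m _ = val_submod 1%:M) ?val_submodK //.
  by rewrite mulmxBr mulmx1 mulmxA val_ker mul0mx subr0.
- by rewrite mul_row_col -val_submodE in_submodK // addrC subrK.
Qed.

Lemma isom_dsum0 (Z M : qrep F n) : is_zero M -> isom (dsum Z M) Z.
Proof.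
move=> z; apply: (@isom_intro (dsum Z M) Z (fun v => col_mx 1%:M 0) (fun v => row_mx 1%:M 0))
  => v.
- by rewrite /= mul_block_col mul_col_mx !(mul0mx, mulmx0, mulmx1, mul1mx, addr0).
- rewrite mul_col_row !(mul0mx, mulmx0, mulmx1) (@scalar_mx_block _ _ _ 1); congr block_mx.
  by apply: eq_mx_row0; rewrite z.
- by rewrite mul_row_col mul1mx mul0mx addr0.
Qed.

Lemma isom_dsumC (X Y : qrep F n) : isom (dsum X Y) (dsum Y X).
Proof.
apply: (@isom_intro (dsum X Y) (dsum Y X) (fun v => block_mx 0 1%:M 1%:M 0) (fun v =>
  block_mx 0 1%:M 1%:M 0)) => v.
- by rewrite /= !mulmx_block !(mul0mx, mulmx0, mul1mx, mulmx1, add0r, addr0).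
- by rewrite mulmx_block !(mul0mx, mulmx0, mul1mx, mulmx1, add0r, addr0) -scalar_mx_block.
- by rewrite mulmx_block !(mul0mx, mulmx0, mul1mx, mulmx1, add0r, addr0) -scalar_mx_block.
Qed.

Lemma isom_dsum (X X' Y Y' : qrep F n) : isom X X' -> isom Y Y' ->
  isom (dsum X Y) (dsum X' Y').
Proof.
move=> [a [b [ha hb ab ba]]] [c [d [hc hd cd dc]]].
apply: (@isom_intro (dsum X Y) (dsum X' Y') (fun v => block_mx (a v) 0 0 (c v))
  (fun v => block_mx (b v) 0 0 (d v))) => v.
- by rewrite /= !mulmx_block !(mul0mx, mulmx0, mul1mx, mulmx1, add0r, addr0) ha hc.
- by rewrite mulmx_block !(mul0mx, mulmx0, mul1mx, mulmx1, add0r, addr0) ab cd -scalar_mx_block.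
- by rewrite mulmx_block !(mul0mx, mulmx0, mul1mx, mulmx1, add0r, addr0) ba dc -scalar_mx_block.
Qed.

Lemma isom_vdim (X Y : qrep F n) : isom X Y -> forall v, vdim X v = vdim Y v.
Proof.
move=> [a [b [ha hb ab ba]]] v; apply/eqP; rewrite eqn_leq; apply/andP; split.
  rewrite -[X in (X <= _)%N](mxrank1 F) -ab.
  exact: leq_trans (mxrankM_maxl _ _) (rank_leq_col _).
rewrite -[X in (X <= _)%N](mxrank1 F) -ba.
exact: leq_trans (mxrankM_maxl _ _) (rank_leq_col _).
Qed.

End Summands.

(** * Composites of arrows *)

Section Paths.
Variables (F : fieldType) (n : nat) (M : qrep F n).

(** Recursion on the number of arrows lets the type of the target follow; [path_mx] then converts to
    a prescribed end vertex. *)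
Fixpoint path_iter k v : 'M[F]_(vdim M v, vdim M (iter k (@arrow_end n) v)) :=
  if k is k'.+1 then path_iter k' v *m vmap M (iter k' (@arrow_end n) v) else 1%:M.

(* Junk unless v <= w. *)
Definition path_mx (v w : 'I_n) : 'M[F]_(vdim M v, vdim M w) :=
  conform_mx 0 (path_iter (w - v) v).

Lemma iter_arrow_end k (v : 'I_n) : (v + k < n)%N -> iter k (@arrow_end n) v = (v + k)%N :> nat.
Proof.
elim: k => [|k IH] vk; first by rewrite addn0.
by rewrite iterS arrow_end_lt IH ?addnS //; lia.
Qed.

Lemma path_mx_iter k (v : 'I_n) : (v + k < n)%N ->
  path_mx v (iter k (@arrow_end n) v) = path_iter k v.
Proof.
move=> vk; rewrite /path_mx; have -> : (iter k (@arrow_end n) v - v = k)%N.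
  by rewrite iter_arrow_end // addKn.
exact: conform_mx_id.
Qed.

Lemma path_mx_refl v : path_mx v v = 1%:M.
Proof. by rewrite -[RHS](@path_mx_iter 0 v) // addn0. Qed.

Lemma path_mxS (v w : 'I_n) : (v <= w)%N -> (w.+1 < n)%N ->
  path_mx v w *m vmap M w = path_mx v (arrow_end w).
Proof.
move=> vw wn; have wE : w = iter (w - v) (@arrow_end n) v.
  by apply: val_inj; rewrite /= iter_arrow_end; lia.
have : (v + (w - v).+1 < n)%N by lia.
move: (w - v)%N wE => k wE vk; subst w.
by rewrite [RHS](@path_mx_iter k.+1 v) // path_mx_iter //; lia.
Qed.

Lemma path_mxM (u v w : 'I_n) : (u <= v <= w)%N ->
  path_mx u v *m path_mx v w = path_mx u w.
Proof.
have [k] := ubnP (w - v); elim: k w => // k IH w lek /andP[uv].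
rewrite leq_eqVlt => /orP[/eqP/val_inj<-|vw]; first by rewrite path_mx_refl mulmx1.
have [|w' [ww' w1]] := @arrow_end_surj _ w; first by lia.
subst w; move: (ltn_ord (arrow_end w')) => ln.
by rewrite -!path_mxS ?mulmxA ?IH //; lia.
Qed.

Lemma path_mxSl (v w : 'I_n) : (v < w)%N ->
  vmap M v *m path_mx (arrow_end v) w = path_mx v w.
Proof.
move=> vw; have vn : (v.+1 < n)%N by move: (ltn_ord w); lia.
have av := arrow_end_lt vn.
rewrite -(@path_mxM v (arrow_end v) w) ?av; last lia.
by rewrite -path_mxS // path_mx_refl mul1mx.
Qed.

End Paths.

Section Classification.
Variables (F : fieldType) (n : nat).

(* Seg i j stands for W_{i,j} if j < n and for V_i if j = n; Quad i j for U_{i,j}. *)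
Inductive label := Seg of nat & nat | Quad of nat & nat.

Definition valid l := match l with
  | Seg i j => (1 <= i <= j)%N && (j <= n)%N
  | Quad i j => (1 <= i <= n)%N && (1 <= j <= n)%N
  end.

Definition std l : amod F n :=
  match l with Seg i j => W F n i j | Quad i j => U F n i j end.

Lemma nice_std l : valid l -> nice (std l).
Proof. by case: l => i j /= /andP[]; [apply: nice_W|apply: nice_U]. Qed.

Lemma seg_flag_tr (b : bool) : seg_flag F b *m (seg_flag F b)^T = 1%:M.
Proof.
case: b; last exact: eq_mx_row0.
by apply/matrixP => i j; rewrite !mxE big_ord_recl big_ord0 !mxE !ord1 mulr1 addr0.
Qed.

Lemma seg_flag_step_tr (b1 b2 : bool) : b1 -> b2 ->
  (seg_flag F b1)^T *m id_map F b1 b2 = (seg_flag F b2)^T.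
Proof.
move=> -> ->; apply/matrixP=> i j; rewrite !mxE big_ord_recl big_ord0 !mxE !ord1 /=.
by rewrite mulr1 addr0.
Qed.

(* An element of the kernel at j that comes from the vertex i but not from any
   earlier vertex splits off W_{i,j}. *)
Lemma noninjective_summand (M : amod F n) (j : 'I_n) :
  (j.+1 < n)%N -> ~~ row_free (vmap M j) ->
  exists l, valid l /\ exists f g, [/\ @is_hom F n (std l) M f,
    @is_hom F n M (std l) g & forall v, f v *m g v \in unitmx].
Proof.
move=> jn nf; pose pm := path_mx M.
pose P (i : 'I_n) := (i <= j)%N && ((pm i j :&: kermx (vmap M j))%MS != 0).
have Pj : P j.
  rewrite /P leqnn /= /pm path_mx_refl; apply: contra nf => /eqP K.
  rewrite -kermx_eq0 -submx0 -{1}K sub_capmx submx_refl andbT.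
  by rewrite submx1.
case: (arg_minnP (fun i : 'I_n => i : nat) Pj) => i /andP[ij /rowV0Pn[y ycap y0]] imin.
move: ycap; rewrite sub_capmx => /andP[/submxP[x yE] /sub_kermxP yK].
(* For the map to W_{i,j} to be a homomorphism, lam must vanish on what arrives at j from the vertex
   just before i. Such a lam exists because minimality of i keeps y out of that image. *)
have [lam [yl hl]] : exists lam : 'cV_(vdim M j), y *m lam = 1%:M /\
    forall u : 'I_n, u.+1 = i -> pm u j *m lam = 0.
  have [i0|i0] := posnP i.
    have [|lam [yl _]] := @separating_functional F _ _ (0 : 'M_(vdim M j)) y;
      first by rewrite submx0.
    by exists lam; split=> // u; rewrite i0.
  have [u [ui u1]] := arrow_end_surj i0.
  have [|lam [yl ul]] := @separating_functional F _ _ (pm u j) y.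
    apply/negP => yu; have : P u.
      apply/andP; split; first lia.
      apply/rowV0Pn; exists y => //; rewrite sub_capmx yu.
      by apply/sub_kermxP.
    by move/imin; lia.
  exists lam; split=> // u' u'1; rewrite (_ : u' = u) //.
  by apply: val_inj => /=; lia.
(* Ordinals number the vertices from 0, labels from 1. *)
exists (Seg i.+1 j.+1); split; first by rewrite /=; lia.
pose s (v : 'I_n) := seg_flag F (i.+1 <= v.+1 <= j.+1)%N.
have [_ sm _ s0] : flag (M := W F n i.+1 j.+1) j s 0 by apply: W_flag => //; lia.
exists (fun v => s v *m (x *m pm i v)), (fun v => pm v j *m lam *m (s v)^T); split=> v.
- rewrite [LHS]mulmxA sm -[RHS]mulmxA.
  have /orP[iv|iv] := orbN (i.+1 <= v.+1 <= j.+1)%N; last first.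
    by apply: eq_mx_row0; rewrite /= (negPf iv).
  case: eqP => [vj|vj]; last first.
    have ve : (v < j)%N by rewrite ltn_neqAle; apply/andP; split; [apply/eqP => /val_inj|lia].
    by rewrite mulmx1 -[X in _ = _ *m X]mulmxA path_mxS //; lia.
  by subst v; rewrite mulmx0 mul0mx -yE yK mulmx0.
- have /orP[iv|iv] := orbN (i.+1 <= (arrow_end v).+1 <= j.+1)%N; last first.
    by apply: eq_mx_col0; rewrite /= (negPf iv).
  have vj : (v < j)%N by move: iv; rewrite val_arrow_end; case: ifP; lia.
  have vn : (v.+1 < n)%N by lia.
  have av := arrow_end_lt vn.
  rewrite !mulmxA path_mxSl //; have [iv'|vi] := leqP i v; last first.
    by rewrite hl ?mul0mx //; lia.
  rewrite -[RHS]mulmxA; congr (_ *m _); rewrite /s /= ifF; last lia.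
  by rewrite seg_flag_step_tr //; lia.
- suff -> : s v *m (x *m pm i v) *m (pm v j *m lam *m (s v)^T) = 1%:M by apply: unitmx1.
  have /orP[iv|iv] := orbN (i.+1 <= v.+1 <= j.+1)%N; last first.
    by apply: eq_mx_row0; rewrite /= (negPf iv).
  rewrite !mulmxA -[s v *m x *m _ *m _]mulmxA path_mxM; last lia.
  by rewrite -[s v *m x *m _]mulmxA -yE -[s v *m y *m _]mulmxA yl mulmx1 seg_flag_tr.
Qed.

Section Injective.
Variables (M : amod F n) (t : 'I_n).
Hypotheses (tn : t.+1 = n) (inj : forall v : 'I_n, (v.+1 < n)%N -> row_free (vmap M v)).

Let th v := path_mx M v t.
(** Since [arrow_end t] equals t only propositionally, composing with [th (arrow_end t)] is what
    turns the loop into a square matrix. *)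
Let N : 'M[F]_(vdim M t) := vmap M t *m th (arrow_end t).

Lemma path_flag : flag t th N.
Proof.
have le_t (v : 'I_n) : (v <= t)%N by move: (ltn_ord v); lia.
have thS (v : 'I_n) : (v < t)%N -> vmap M v *m th (arrow_end v) = th v.
  by move=> vt; rewrite path_mxSl.
split=> [v|v||v].
- have [k] := ubnP (t - v); elim: k v => // k IH v lek.
  have := le_t v; rewrite leq_eqVlt => /orP[/eqP/val_inj->|vt].
    by rewrite /th path_mx_refl row_free_unit unitmx1.
  have vn : (v.+1 < n)%N by lia.
  rewrite -thS //; apply: row_freeM; first exact: inj.
  by apply: IH; rewrite arrow_end_lt //; lia.
- case: eqP => [->|vt]; first by rewrite /th path_mx_refl mul1mx.
  rewrite mulmx1 thS // ltn_neqAle le_t andbT.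
  by apply/eqP => /val_inj.
- by rewrite /th path_mx_refl row_full_unit unitmx1.
- by move: (le_t v); lia.
Qed.

Lemma loop_sq0 : N *m N = 0.
Proof.
have at_ : arrow_end t = t by apply: arrow_end_last.
have E w : w = t -> th w *m vmap M t = vmap M w *m path_mx M (arrow_end w) (arrow_end t).
  by move=> ->; rewrite /th !path_mx_refl mul1mx mulmx1.
rewrite /N -mulmxA (mulmxA (th _)) (E _ at_) !mulmxA amodP // !mul0mx //.
Qed.

(* If N = 0, a nonzero element at the first nonzero vertex i splits off V_i.
   Otherwise take j minimal with N <> 0 on the space at j, then i minimal such that
   some N x <> 0, with x at j, lies in the space at i: x and N x span a summand U_{i,j}. *)
Lemma injective_summand : ~ is_zero M ->
  exists l, valid l /\ exists f g, [/\ @is_hom F n (std l) M f,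
    @is_hom F n M (std l) g & forall v, f v *m g v \in unitmx].
Proof.
move=> nz; have fl := path_flag; have N2 := loop_sq0.
have [hf hm hF _] := fl; have mono := flag_mono fl.
have le_t (v : 'I_n) : (v <= t)%N by move: (ltn_ord v); lia.
have n0 : (0 < n)%N by lia.
have [N0|N0] := eqVneq N 0.
  have [v0 v0P] : exists v, th v != 0.
    apply: contrapT => no; apply: nz => v; apply: (row_free_eq0 (hf v)).
    by apply/eqP/negPn/negP => ne; apply: no; exists v.
  case: (@arg_minnP _ v0 (fun v => th v != 0) (fun i : 'I_n => i : nat) v0P) => i ti imin.
  have /rowV0Pn[x xt x0] := ti.
  have [|lam [xl _]] := @separating_functional F _ _ (0 : 'M_(vdim M t)) x.
    by rewrite submx0.
  have flW : flag (M := W F n i.+1 n) t (fun v => seg_flag F (i.+1 <= v.+1 <= n)%N) 0.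
    by apply: W_flag => //; move: (ltn_ord i); lia.
  have [|_|f [homf fE]] := flag_hom (phi := x) flW fl (leqnn t).
  - move=> v _; have [iv|iv] := leqP i v.
      apply: submx_trans (submxMl _ _) _; apply: submx_trans xt _.
      by apply: mono; rewrite iv /=.
    rewrite (eq_mx_row0 (_ *m _) 0) ?sub0mx //=; lia.
  - by rewrite N0 mulmx0 mul0mx.
  have [|_|g [homg gE]] := flag_hom (phi := lam) fl flW (leqnn t).
  - move=> v _; have [iv|iv] := leqP i v.
      suff full d : d = 1%N -> (th v *m lam <= seg_flag F d)%MS.
        by apply: full => /=; move: (ltn_ord v); lia.
      move=> ->; apply: submx_full; have := row_free_seg_flag F true.
      by rewrite /row_free /row_full.
    have [/eqP->|tv] := boolP (th v == 0); first by rewrite mul0mx sub0mx.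
    by have := imin v tv; lia.
  - by rewrite N0 mulmx0 mul0mx.
  exists (Seg i.+1 n); split; first by rewrite /=; move: (ltn_ord i); lia.
  exists f, g; split=> // v.
  suff -> : f v *m g v = 1%:M by apply: unitmx1.
  case: (flW) => frW _ _ _; apply: (row_free_cancel (frW v)).
  by rewrite -mulmxA gE // mulmxA fE // -mulmxA xl mulmx1 mul1mx.
have tNt : th t *m N != 0 by rewrite /th path_mx_refl mul1mx.
case: (@arg_minnP _ t (fun v => th v *m N != 0) (fun i : 'I_n => i : nat) tNt) => j jN jmin.
pose P (i : 'I_n) := ((th j *m N) :&: th i)%MS != 0.
have Pt : P t.
  apply: contra jN => /eqP K; rewrite -submx0 -K sub_capmx submx_refl.
  exact: submx_full.
case: (arg_minnP (fun i : 'I_n => i : nat) Pt) => i iP imin.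
have /rowV0Pn[z zc z0] := iP.
move: zc; rewrite sub_capmx => /andP[/submxP[w zE] zi].
pose x := w *m th j; have zx : z = x *m N by rewrite zE mulmxA.
have xj : (x <= th j)%MS by apply: submxMl.
(* By minimality of i, z lies in no space strictly before i; lam separates it from the largest of
   these, hence from all. *)
have [lam [zl il]] : exists lam : 'cV_(vdim M t), z *m lam = 1%:M /\ forall u : 'I_n, (u <
  i)%N -> th u *m lam = 0.
  have [i0|i0] := posnP i.
    have [|lam [zl _]] := @separating_functional F _ _ (0 : 'M_(vdim M t)) z;
      first by rewrite submx0.
    by exists lam; split=> // u; rewrite i0.
  have [u [ui u1]] := arrow_end_surj i0.
  have [|lam [zl ul]] := @separating_functional F _ _ (th u) z.
    apply/negP => zu; have : P u.
      apply/rowV0Pn; exists z => //; rewrite sub_capmx zu andbT.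
      by rewrite zE; apply: submxMl.
    by move/imin; move: u1; clear; lia.
  exists lam; split=> // u' u'i.
  have /submxP[c ->] : (th u' <= th u)%MS.
    by apply: mono; rewrite le_t andbT; move: u'i u1; clear; lia.
  by rewrite -mulmxA ul mulmx0.
have vi : valid (Quad i.+1 j.+1) by rewrite /= !ltn_ord.
have flU : flag (M := U F n i.+1 j.+1) t (U_th F i.+1 j.+1) (sq_nil F).
  by apply: U_flag; rewrite ?ltn_ord.
(* The map phi sends e_1 to x and e_2 to z = N x, while psi takes y to the coordinates lam(N y) and
   lam(y). The first vanishes before j by minimality of j, the second before i by the choice of lam,
   and N^2 = 0 makes both maps commute with the loops. *)
pose phi : 'M[F]_(2, vdim M t) := col_mx x z.
pose psi : 'M[F]_(vdim M t, 2) := row_mx (N *m lam) lam.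
have phi0 : row 0 phi = x by apply: row0_col_mx.
have phi1 : row 1 phi = z by apply: row1_col_mx.
have psi0 : col 0 psi = N *m lam by apply: col0_row_mx.
have psi1 : col 1 psi = lam by apply: col1_row_mx.
clearbody phi psi x.
have [||f [homf fE]] := flag_hom (phi := phi) flU fl (leqnn t).
- move=> v _; rewrite (eqmxMr _ (U_th_axes _ _ _ _)).
  apply/row_subP; apply: forall_I2.
    rewrite row0_axes phi0; case: (ltnP j v.+1) => jv; last by rewrite scale0r sub0mx.
    apply: scalemx_sub; apply: submx_trans xj _.
    by apply: mono; rewrite le_t andbT.
  rewrite row1_axes phi1; case: (ltnP i v.+1) => jv; last by rewrite scale0r sub0mx.
  apply: scalemx_sub; apply: submx_trans zi _.
  by apply: mono; rewrite le_t andbT.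
- move=> _; apply/row_matrixP; apply: forall_I2; rewrite (row0_sq_nil, row1_sq_nil) row_mul.
    by rewrite phi0 phi1.
  by rewrite phi1 zx -mulmxA N2 mulmx0.
have [||g [homg gE]] := flag_hom (phi := psi) fl flU (leqnn t).
- move=> v _; rewrite U_th_axes; apply/sub_axesP => r; split; rewrite mulmx_entry ?psi0 ?psi1.
    case: (ltnP j v.+1) => jv; [by left|right].
    suff N0' : th v *m N = 0 by rewrite mulmxA -row_mul N0' row0 mul0mx mxE.
    apply/eqP/negPn/negP => /jmin; move: jv; clear; lia.
  case: (ltnP i v.+1) => jv; [by left|right].
  by rewrite -row_mul il // row0 mxE.
- move=> _; apply/trmx_inj/row_matrixP; apply: forall_I2; rewrite -!tr_col; congr _^T.
    by rewrite col0_sq_nil col_mulmx psi0 mulmxA N2 mul0mx.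
  by rewrite col1_sq_nil col_mulmx psi0 psi1.
exists (Quad i.+1 j.+1); split=> //; exists f, g; split=> // v.
(* The value lam(x) is not controlled, so the composite is unipotent but perhaps not the
   identity. *)
have E : phi *m psi = 1%:M + (x *m lam) 0 0 *: sq_nil F.
  have zN : z *m N = 0 by rewrite zx -mulmxA N2 mulmx0.
  have e00 : (phi *m psi) 0 0 = 1 by rewrite mulmx_entry phi0 psi0 mulmxA -zx zl mxE.
  have e01 : (phi *m psi) 0 1 = (x *m lam) 0 0 by rewrite mulmx_entry phi0 psi1.
  have e10 : (phi *m psi) 1 0 = 0 by rewrite mulmx_entry phi1 psi0 mulmxA zN mul0mx mxE.
  have e11 : (phi *m psi) 1 1 = 1 by rewrite mulmx_entry phi1 psi1 zl mxE.
  by apply: matrix2P; rewrite ?e00 ?e01 ?e10 ?e11 !mxE /= ?mulr0 ?mulr1 ?addr0 ?add0r.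
case: (flU) => frU _ _ _; rewrite -row_free_unit.
apply: (@row_free_Ml _ _ _ _ _ (U_th F i.+1 j.+1 v)).
rewrite -mulmxA gE // mulmxA fE // -mulmxA E; apply: row_freeM => //.
rewrite row_free_unit.
by have /mulmx1_unit[] := scalar_nil_unit ((x *m lam) 0 0) (sq_nil2 F) (oner_neq0 F).
Qed.

End Injective.

Theorem indecomposable_summand (M : amod F n) : ~ is_zero M ->
  exists l, valid l /\ exists M', isom M (dsum (std l) (M' : amod F n)).
Proof.
move=> nz.
suff [l [vl [f [g [hf hg fg]]]]] : exists l, valid l /\ exists f g, [/\ @is_hom F n (std l) M f,
    @is_hom F n M (std l) g & forall v, f v *m g v \in unitmx].
  by exists l; split=> //; apply: unit_summand hf hg fg.
have [inj|] := pselect (forall v : 'I_n, (v.+1 < n)%N -> row_free (vmap M v)).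
  have n0 : (0 < n)%N.
    by rewrite lt0n; apply/eqP => n0; apply: nz => v; have := ltn_ord v;
      rewrite [X in (_ < X)%N]n0.
  have tn : (n.-1 < n)%N by rewrite prednK.
  by apply: (@injective_summand M (Ordinal tn)) => //=; rewrite prednK.
move=> /existsNP[v /not_implyP[vn /negP nf]].
exact: noninjective_summand vn nf.
Qed.

Lemma indecomposable_std (M : amod F n) : indecomposable M ->
  exists l, valid l /\ isom M (std l).
Proof.
move=> [nz dec]; have [l [vl [M' iM]]] := indecomposable_summand nz.
exists l; split=> //; case: (dec _ _ iM) => [/nice_nonzero|z].
  by case; apply: nice_std.
exact: isom_trans iM (isom_dsum0 _ z).
Qed.

Lemma indecomposable_nice (M : amod F n) : indecomposable M -> nice M.
Proof.
move=> /indecomposable_std[l [vl /isom_sym iM]].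
exact: nice_isom iM (nice_std vl).
Qed.

End Classification.

(** * Hall numbers and short exact sequences *)

Section ShortExact.
Variables (F : fieldType) (n : nat).
Implicit Types X Y M : qrep F n.

Definition ses Y M X (f : forall v, 'M[F]_(vdim Y v, vdim M v))
    (g : forall v, 'M[F]_(vdim M v, vdim X v)) : Prop :=
  [/\ is_hom f, is_hom g, forall v, row_free (f v), forall v, row_full (g v) &
      forall v, (f v :=: kermx (g v))%MS].

Lemma ses_mul Y M X f g : @ses Y M X f g -> forall v, f v *m g v = 0.
Proof. by move=> [_ _ _ _ K] v; apply/sub_kermxP; rewrite K. Qed.

Lemma ses_dim Y M X f g : @ses Y M X f g ->
  forall v, vdim M v = (vdim Y v + vdim X v)%N.
Proof.
move=> [_ _ ff gf K] v; have := mxrank_ker (g v); rewrite -K.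
move: (ff v) (gf v) (rank_leq_row (g v)) => /eqP -> /eqP ->; lia.
Qed.

(** Exactness in the middle is a dimension count once the composite is 0. *)
Lemma ses_intro Y M X f g : @is_hom F n Y M f -> @is_hom F n M X g ->
  (forall v, row_free (f v)) -> (forall v, row_full (g v)) ->
  (forall v, f v *m g v = 0) -> (forall v, vdim M v = vdim Y v + vdim X v)%N ->
  ses f g.
Proof.
move=> hf hg ff gf fg dM; split=> // v.
have fk : (f v <= kermx (g v))%MS by apply/sub_kermxP.
apply/eqmxP; rewrite -(geq_leqif (mxrank_leqif_eq fk)) mxrank_ker.
by move: (ff v) (gf v) => /eqP -> /eqP ->; rewrite dM addnK.
Qed.

Lemma ses_sub_unique Y M X f g Y' X' f' g' : @ses Y M X f g -> @ses Y' M X' f' g' ->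
  (forall v, (f v :=: f' v)%MS) -> isom Y Y'.
Proof.
move=> [hf _ ff _ _] [hf' _ ff' _ _] E.
have aE v : f v *m pinvmx (f' v) *m f' v = f v by rewrite mulmxKpV // E.
have bE v : f' v *m pinvmx (f v) *m f v = f' v by rewrite mulmxKpV // E.
move: aE bE; set a := fun v => f v *m pinvmx (f' v); set b := fun v => f' v *m pinvmx (f v).
move=> aE bE; have {}aE v : a v *m f' v = f v := aE v.
have {}bE v : b v *m f v = f' v := bE v.
clearbody a b; apply: (@isom_intro _ _ _ _ a b) => [|v|v].
- exact: (hom_invl hf hf').
- by apply: (row_free_cancel (ff v)); rewrite -mulmxA bE aE mul1mx.
- by apply: (row_free_cancel (ff' v)); rewrite -mulmxA aE bE mul1mx.
Qed.

Lemma ses_quo_unique Y M X f g Y' X' f' g' : @ses Y M X f g -> @ses Y' M X' f' g' ->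
  (forall v, (f v :=: f' v)%MS) -> isom X X'.
Proof.
move=> [_ hg _ gf K] [_ hg' _ gf' K'] E.
have factor m p q (A : 'M[F]_(m, p)) (B : 'M[F]_(m, q)) :
    (kermx A <= kermx B)%MS -> A *m (pinvmx A *m B) = B.
  move=> AB.
  (* The matrix [pinvmx A] inverts A only partially: the rows of [A *m pinvmx A - 1%:M] lie in the
     kernel of A, hence in that of B. *)
  have : (A *m pinvmx A - 1%:M <= kermx A)%MS.
    by apply/sub_kermxP; rewrite mulmxBl mulmxKpV // mul1mx subrr.
  move=> /submx_trans/(_ AB)/sub_kermxP; rewrite mulmxBl mul1mx => /eqP.
  by rewrite subr_eq0 mulmxA => /eqP.
have kE v : (kermx (g v) :=: kermx (g' v))%MS.
  by apply: eqmx_trans (K' v); apply: eqmx_trans (E v); apply: eqmx_sym.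
have [a aE] : exists a : forall v, 'M_(vdim X v, vdim X' v), forall v, g v *m a v = g' v.
  by exists (fun v => pinvmx (g v) *m g' v) => v; apply: factor; rewrite kE.
have [b bE] : exists b : forall v, 'M_(vdim X' v, vdim X v), forall v, g' v *m b v = g v.
  by exists (fun v => pinvmx (g' v) *m g v) => v; apply: factor; rewrite kE.
apply: (@isom_intro _ _ _ _ a b) => [|v|v].
- exact: (hom_invr hg' hg).
- by apply: (row_full_cancel (gf v)); rewrite mulmxA aE bE mulmx1.
- by apply: (row_full_cancel (gf' v)); rewrite mulmxA bE aE mulmx1.
Qed.

Lemma ses_isom Y M X Y' X' f g : @ses Y M X f g -> isom Y' Y -> isom X X' ->
  exists f' g', @ses Y' M X' f' g' /\ forall v, (f' v :=: f v)%MS.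
Proof.
move=> [hf hg ff gf K] [a [b [ha hb ab ba]]] [c [d [hc hd cd dc]]].
have af v : (a v *m f v :=: f v)%MS.
  apply/eqmxP; rewrite submxMl /=; apply/submxP; exists (b v).
  by rewrite mulmxA ba mul1mx.
exists (fun v => a v *m f v), (fun v => g v *m c v); split=> //; split.
- exact: hom_comp ha hf.
- exact: hom_comp hg hc.
- move=> v; apply: row_freeM => //.
  by apply: (@row_free_Ml _ _ _ _ _ (b v)); rewrite ab row_free_unit unitmx1.
- move=> v; have /row_fullP[h hE] := gf v; apply/row_fullP.
  by exists (d v *m h); rewrite mulmxA -(mulmxA _ h) hE mulmx1.
- move=> v; apply: (eqmx_trans (af v)); apply: (eqmx_trans (K v)).
  apply/eqmxP/andP; split; apply/sub_kermxP; first by rewrite mulmxA mulmx_ker mul0mx.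
  have fc : row_free (c v).
    by apply: (@row_free_Ml _ _ _ _ _ (d v)); rewrite cd row_free_unit unitmx1.
  by apply: (row_free_cancel fc); rewrite mul0mx -mulmxA mulmx_ker.
Qed.

Lemma ses_isom_mid Y M X M' f g a b : @ses Y M X f g ->
  @is_hom F n M M' a -> @is_hom F n M' M b ->
  (forall v, a v *m b v = 1%:M) -> (forall v, b v *m a v = 1%:M) ->
  @ses Y M' X (fun v => f v *m a v) (fun v => b v *m g v).
Proof.
move=> S ha hb ab ba; case: (S) => hf hg ff gf _; apply: ses_intro.
- exact: hom_comp hf ha.
- exact: hom_comp hb hg.
- move=> v; apply: row_freeM => //.
  by apply: (@row_free_Ml _ _ _ _ _ (b v)); rewrite ab row_free_unit unitmx1.
- move=> v; have /row_fullP[h hE] := gf v; apply/row_fullP.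
  by exists (h *m a v); rewrite mulmxA -(mulmxA h) ab mulmx1.
- by move=> v; rewrite mulmxA -(mulmxA (f v)) ab mulmx1 (ses_mul S).
- move=> v; rewrite -(ses_dim S); apply/esym/isom_vdim.
  exact: (isom_intro ha ab ba).
Qed.

Lemma sub_quo_ses M (U : subfam M) : stable_fam U ->
  @ses (sub_rep U) M (quo_rep U) (fun v => val_submod (U := U v) 1%:M)
    (fun v => in_factmod (U v) 1%:M).
Proof.
move=> sU; apply: ses_intro.
- exact: sub_rep_hom.
- exact: quo_rep_hom.
- by move=> v; apply: row_free_val_submod.
- move=> v; apply/row_fullP; exists (val_factmod 1%:M).
  by rewrite -in_factmodE val_factmodK.
- by move=> v; rewrite -in_factmodE; apply/eqP; rewrite in_factmod_eq0; apply: val_submodP.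
- by move=> v; rewrite /= mxrank_coker subnKC // rank_leq_row.
Qed.

Lemma ses_stable Y M X f g (U : subfam M) : @ses Y M X f g ->
  (forall v, (f v :=: U v)%MS) -> stable_fam U.
Proof.
move=> [hf _ _ _ _] E; apply/forallP=> v; rewrite -(eqmxMr _ (E v)) -E -hf.
exact: submxMl.
Qed.

End ShortExact.

Section HallNumber.
Variables (F : finFieldType) (n : nat).
Implicit Types X Y M : qrep F n.

Definition canonical_fam M (U : subfam M) : bool := [forall v, <<U v>>%MS == U v].

Lemma canonical_inj M (U U' : subfam M) : canonical_fam U -> canonical_fam U' ->
  (forall v, (U v :=: U' v)%MS) -> U = U'.
Proof.
move=> /forallP cU /forallP cU' E; apply/ffunP => v.
by rewrite -(eqP (cU v)) -(eqP (cU' v)); apply: eq_genmx.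
Qed.

Definition span_fam M m (f : forall v, 'M[F]_(m v, vdim M v)) : subfam M :=
  [ffun v => <<f v>>%MS].

Lemma canonical_span M m (f : forall v, 'M[F]_(m v, vdim M v)) :
  canonical_fam (span_fam f).
Proof. by apply/forallP => v; rewrite ffunE genmx_id. Qed.

Lemma span_famE M m (f : forall v, 'M[F]_(m v, vdim M v)) v :
  (span_fam f v :=: f v)%MS.
Proof. by rewrite ffunE; apply: genmxE. Qed.

(** The canonical matrices U serve only as names for the images of the maps f in short exact
    sequences. *)
Definition hall_set X Y M : {set subfam M} :=
  [set U : subfam M | canonical_fam U &&
     `[< exists f g, @ses F n Y M X f g /\ forall v, (f v :=: U v)%MS >]].

Lemma hall_numberE X Y M : hall_number X Y M = #|hall_set X Y M|.
Proof.
apply: eq_card => U; rewrite !inE; congr andb; apply/idP/idP.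
  move=> /and3P[sU /asboolP iY /asboolP iX]; apply/asboolP.
  have [f [g [S fE]]] := ses_isom (sub_quo_ses sU) (isom_sym iY) iX.
  exists f, g; split=> // v; apply: (eqmx_trans (fE v)).
  exact: val_submod1.
move=> /asboolP[f [g [S fE]]]; have sU := ses_stable S fE.
have E v : (val_submod (U := U v) 1%:M :=: f v)%MS.
  by apply: (eqmx_trans (val_submod1 _)); apply: eqmx_sym.
rewrite sU /=; apply/andP; split; apply/asboolP.
  exact: ses_sub_unique (sub_quo_ses sU) S E.
exact: ses_quo_unique (sub_quo_ses sU) S E.
Qed.

Lemma hall_number_isom X Y M X' Y' M' : isom X X' -> isom Y Y' -> isom M M' ->
  hall_number X Y M = hall_number X' Y' M'.
Proof.
suff H X1 Y1 M1 X2 Y2 M2 : isom X1 X2 -> isom Y1 Y2 -> isom M1 M2 ->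
    (hall_number X1 Y1 M1 <= hall_number X2 Y2 M2)%N.
  move=> iX iY iM; apply/eqP; rewrite eqn_leq; apply/andP; split; apply: H => //;
  exact: isom_sym.
move=> iX iY [a [b [ha hb ab ba]]]; rewrite !hall_numberE.
pose T (U : subfam M1) : subfam M2 := span_fam (fun v => U v *m a v).
have TE U v : (T U v :=: U v *m a v)%MS by apply: span_famE.
have injT : {in hall_set X1 Y1 M1 &, injective T}.
  move=> U U' /= + + TU; rewrite !inE => /andP[cU _] /andP[cU' _].
  apply: canonical_inj => // v; apply: (@eqmx_row_free _ _ _ _ _ _ _ (a v)).
    by apply: (@row_free_Ml _ _ _ _ _ (b v)); rewrite ab row_free_unit unitmx1.
  apply: (eqmx_trans (eqmx_sym (TE U v))); rewrite TU; exact: TE.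
rewrite -(card_in_imset injT); apply: subset_leq_card.
apply/fintype.subsetP => _ /imsetP[U + ->]; rewrite !inE.
move=> /andP[cU /asboolP[f [g [S fE]]]]; rewrite canonical_span /=; apply/asboolP.
have S' := ses_isom_mid S ha hb ab ba.
have [f' [g' [S'' fE'']]] := ses_isom S' (isom_sym iY) iX.
exists f', g'; split=> // v; apply: (eqmx_trans (fE'' v)).
apply: eqmx_trans (eqmx_sym (TE U v)); exact: eqmxMr.
Qed.

(** The set S parametrises the submodules, which are read through the embeddings th as subspaces of
    fixed spaces; [im r v] is any matrix spanning the image, and the last hypothesis makes the
    parameter unique. *)
Lemma hall_number_count X Y M (D : 'I_n -> nat) (th : forall v, 'M[F]_(vdim M v, D v))
    (T : finType) (S : {set T}) m (im : T -> forall v : 'I_n, 'M[F]_(m v, D v)) :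
  (forall v, row_free (th v)) ->
  (forall r, r \in S -> exists f g, @ses F n Y M X f g /\
     forall v, (f v *m th v :=: im r v)%MS) ->
  (forall f g, @ses F n Y M X f g ->
     exists2 r, r \in S & forall v, (f v *m th v :=: im r v)%MS) ->
  (forall r r', r \in S -> r' \in S -> (forall v, (im r v :=: im r' v)%MS) -> r = r') ->
  hall_number X Y M = #|S|.
Proof.
move=> fth inS outS injS; rewrite hall_numberE.
pose I (r : T) : subfam M := span_fam (fun v => im r v *m pinvmx (th v)).
have IE r f g : @ses F n Y M X f g -> (forall v, (f v *m th v :=: im r v)%MS) ->
    forall v, (f v :=: I r v)%MS.
  move=> _ E v; apply: eqmx_sym; apply: (eqmx_trans (span_famE _ v)).
  apply: (eqmx_trans (eqmx_sym (eqmxMr _ (E v)))).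
  by rewrite mulmxKp.
rewrite (_ : hall_set X Y M = [set I r | r in S]).
  apply: card_in_imset => r r' rS r'S Irr'.
  apply: injS => // v.
  have [f [g [sfg E]]] := inS r rS; have [f' [g' [sfg' E']]] := inS r' r'S.
  apply: (eqmx_trans (eqmx_sym (E v))); apply: eqmx_trans (E' v).
  apply: eqmxMr; apply: (eqmx_trans (IE _ _ _ sfg E v)); rewrite Irr'.
  exact: (eqmx_sym (IE _ _ _ sfg' E' v)).
apply/setP => U; rewrite !inE; apply/idP/imsetP.
  move=> /andP[cU /asboolP[f [g [sfg fE]]]]; have [r rS E] := outS _ _ sfg.
  exists r => //; apply: canonical_inj => //; first exact: canonical_span.
  move=> v; apply: (eqmx_trans (eqmx_sym (fE v))); exact: IE sfg E v.
move=> [r rS ->]; rewrite canonical_span /=; apply/asboolP.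
have [f [g [sfg E]]] := inS r rS; exists f, g; split=> // v; exact: IE sfg E v.
Qed.

End HallNumber.

(** * Decomposable middle terms *)

Section Torus.
Variables (F : finFieldType) (n : nat) (M1 M2 X Y : qrep F n).
Hypotheses (nX : nice X) (nY : nice Y).
Hypotheses (nz1 : ~ is_zero M1) (nz2 : ~ is_zero M2).

Let M := dsum M1 M2.
Let p1 v : 'M[F]_(vdim M v) := block_mx 1%:M 0 0 0.

Lemma hom_p1 : @is_hom F n M M p1.
Proof.
by move=> v; rewrite /= !mulmx_block !(mulmx0, mul0mx, mulmx1, mul1mx, addr0, add0r).
Qed.

Lemma p1_idem v : p1 v *m p1 v = p1 v.
Proof. by rewrite mulmx_block !(mulmx0, mul0mx, mulmx1, mul1mx, addr0, add0r). Qed.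

(* A submodule which is homogeneous for the decomposition splits, and so does the
   quotient; as both are indecomposable, it must be one of the two summands. *)
Lemma homogeneous_summand f g : @ses F n Y M X f g ->
  (forall v, (f v *m p1 v <= f v)%MS) ->
  (isom Y M1 /\ isom X M2) \/ (isom Y M2 /\ isom X M1).
Proof.
move=> S sub; have [hf hg ff gf K] := S.
(* The projection onto M1 preserves the image of f, so it induces an idempotent e on Y and, below,
   an idempotent e' on X; each is 1 or 0. *)
pose e v := f v *m p1 v *m pinvmx (f v).
have eE v : e v *m f v = f v *m p1 v by rewrite /e mulmxKpV.
have he : is_hom e.
  exact: (hom_invl (hom_comp hf hom_p1) hf ff eE).
have ei v : e v *m e v = e v.
  by apply: (row_free_cancel (ff v)); rewrite -mulmxA eE mulmxA eE -mulmxA p1_idem.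
have kp v : (kermx (g v) <= kermx (p1 v *m g v))%MS.
  rewrite -K; apply/sub_kermxP; rewrite mulmxA; apply/sub_kermxP.
  by apply: submx_trans (sub v) _; rewrite K.
have [e' e'E] : exists e' : forall v, 'M_(vdim X v), forall v, g v *m e' v = p1 v *m g v.
  exists (fun v => pinvmx (g v) *m (p1 v *m g v)) => v.
  have : (g v *m pinvmx (g v) - 1%:M <= kermx (g v))%MS.
    by apply/sub_kermxP; rewrite mulmxBl mulmxKpV // mul1mx subrr.
  move=> /submx_trans/(_ (kp v))/sub_kermxP; rewrite mulmxBl mul1mx => /eqP.
  by rewrite subr_eq0 -mulmxA => /eqP.
have he' : is_hom e' by exact: (hom_invr (hom_comp hom_p1 hg) hg gf e'E).
have e'i v : e' v *m e' v = e' v.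
  apply: (row_full_cancel (gf v)).
  by rewrite mulmxA e'E -mulmxA e'E mulmxA p1_idem.
have fL v : f v = row_mx (lsubmx (f v)) (rsubmx (f v)) by rewrite hsubmxK.
have gL v : g v = col_mx (usubmx (g v)) (dsubmx (g v)) by rewrite vsubmxK.
have hfl : @is_hom F n Y M1 (fun v => lsubmx (f v)).
  move=> v; have := hf v; rewrite (fL v) (fL (arrow_end v)) /= mul_mx_row mul_row_block.
  by rewrite !mulmx0 addr0 add0r => /eq_row_mx[]; rewrite !row_mxKl.
have hfr : @is_hom F n Y M2 (fun v => rsubmx (f v)).
  move=> v; have := hf v; rewrite (fL v) (fL (arrow_end v)) /= mul_mx_row mul_row_block.
  by rewrite !mulmx0 addr0 add0r => /eq_row_mx[]; rewrite !row_mxKr.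
have hgu : @is_hom F n M1 X (fun v => usubmx (g v)).
  move=> v; have := hg v; rewrite (gL v) (gL (arrow_end v)) /= mul_block_col mul_col_mx.
  by rewrite !mul0mx addr0 add0r => /eq_col_mx[]; rewrite !col_mxKu.
have hgd : @is_hom F n M2 X (fun v => dsubmx (g v)).
  move=> v; have := hg v; rewrite (gL v) (gL (arrow_end v)) /= mul_block_col mul_col_mx.
  by rewrite !mul0mx addr0 add0r => /eq_col_mx[]; rewrite !col_mxKd.
have fp v : f v *m p1 v = row_mx (lsubmx (f v)) 0.
  by rewrite {1}(fL v) mul_row_block !(mulmx0, mulmx1, addr0).
have pg v : p1 v *m g v = col_mx (usubmx (g v)) 0.
  by rewrite {1}(gL v) mul_block_col !(mul0mx, mul1mx, addr0).
have dM := ses_dim S.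
have iso (A B : qrep F n) (h : forall v, 'M_(vdim A v, vdim B v)) :
    is_hom h -> (forall v, row_free (h v)) -> (forall v, row_full (h v)) -> isom A B.
  move=> hh hf' hf''; apply: (isom_intro (g := fun v => pinvmx (h v)) hh) => v.
    exact: mulmxVp.
  exact: mulVpmx.
have rank_eq v : \rank (f v) = vdim Y v /\ \rank (g v) = vdim X v.
  by split; apply/eqP; [apply: ff|apply: gf].
(* Equal values are impossible: both 1 would make M2 zero, both 0 would make M1 zero. The mixed
   cases give the two alternatives. *)
have [e1|e0] := nice_idem nY he ei; have [e1'|e0'] := nice_idem nX he' e'i.
- case: nz2 => v.
  have fr : rsubmx (f v) = 0.
    by have := eE v; rewrite e1 mul1mx fp {1}(fL v) => /eq_row_mx[].
  have gd : dsubmx (g v) = 0.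
    by have := e'E v; rewrite e1' mulmx1 pg {1}(gL v) => /eq_col_mx[].
  have : (row_mx 0 1%:M : 'M[F]_(_, vdim M1 v + vdim M2 v)) *m g v = 0.
    by rewrite (gL v) gd mul_row_col mul0mx mulmx0 addr0.
  move/sub_kermxP; rewrite -K (fL v) fr => /submxP[c].
  rewrite mul_mx_row mulmx0 => /eq_row_mx[_ E].
  by rewrite -[LHS](mxrank1 F) E mxrank0.
- left; have fr v : rsubmx (f v) = 0.
    by have := eE v; rewrite e1 mul1mx fp {1}(fL v) => /eq_row_mx[].
  have gu v : usubmx (g v) = 0.
    by have := e'E v; rewrite e0' mulmx0 pg -col_mx0 => /esym/eq_col_mx[].
  have fr' v : \rank (lsubmx (f v)) = vdim Y v.
    by have [E _] := rank_eq v; rewrite -[RHS]E [in RHS](fL v) fr rank_row_mx0.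
  have gr' v : \rank (dsubmx (g v)) = vdim X v.
    by have [_ E] := rank_eq v; rewrite -[RHS]E [in RHS](gL v) gu rank_col_0mx.
  have d1 v : vdim M1 v = vdim Y v /\ vdim M2 v = vdim X v.
    have := dM v; rewrite /=; have := rank_leq_col (lsubmx (f v)).
    by have := rank_leq_row (dsubmx (g v)); rewrite fr' gr'; lia.
  split; last apply: isom_sym.
    apply: (iso _ _ _ hfl) => v; rewrite /row_free /row_full fr' //.
    by have [-> _] := d1 v.
  apply: (iso _ _ _ hgd) => v; rewrite /row_free /row_full gr' //.
  by have [_ ->] := d1 v.
- right; have fl v : lsubmx (f v) = 0.
    by have := eE v; rewrite e0 mul0mx fp -row_mx0 => /eq_row_mx[].
  have gd v : dsubmx (g v) = 0.
    by have := e'E v; rewrite e1' mulmx1 pg {1}(gL v) => /eq_col_mx[].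
  have fr' v : \rank (rsubmx (f v)) = vdim Y v.
    by have [E _] := rank_eq v; rewrite -[RHS]E [in RHS](fL v) fl rank_row_0mx.
  have gr' v : \rank (usubmx (g v)) = vdim X v.
    by have [_ E] := rank_eq v; rewrite -[RHS]E [in RHS](gL v) gd rank_col_mx0.
  have d1 v : vdim M2 v = vdim Y v /\ vdim M1 v = vdim X v.
    have := dM v; rewrite /=; have := rank_leq_col (rsubmx (f v)).
    by have := rank_leq_row (usubmx (g v)); rewrite fr' gr'; lia.
  split; last apply: isom_sym.
    apply: (iso _ _ _ hfr) => v; rewrite /row_free /row_full fr' //.
    by have [-> _] := d1 v.
  apply: (iso _ _ _ hgu) => v; rewrite /row_free /row_full gr' //.
  by have [_ ->] := d1 v.
- case: nz1 => v.
  have fl : lsubmx (f v) = 0.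
    by have := eE v; rewrite e0 mul0mx fp -row_mx0 => /eq_row_mx[].
  have gu : usubmx (g v) = 0.
    by have := e'E v; rewrite e0' mulmx0 pg -col_mx0 => /esym/eq_col_mx[].
  have : (row_mx 1%:M 0 : 'M[F]_(_, vdim M1 v + vdim M2 v)) *m g v = 0.
    by rewrite (gL v) gu mul_row_col mul0mx mulmx0 addr0.
  move/sub_kermxP; rewrite -K (fL v) fl => /submxP[c].
  rewrite mul_mx_row mulmx0 => /eq_row_mx[E _].
  by rewrite -[LHS](mxrank1 F) E mxrank0.
Qed.

Hypothesis ne1 : ~ (isom Y M1 /\ isom X M2).
Hypothesis ne2 : ~ (isom Y M2 /\ isom X M1).

Let scal (t : F) v : 'M[F]_(vdim M v) := block_mx t%:M 0 0 1%:M.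

Lemma scal_mul s t v : scal s v *m scal t v = scal (s * t) v.
Proof.
rewrite /scal mulmx_block !(mulmx0, mul0mx, mulmx1, mul1mx, addr0, add0r).
by rewrite -scalar_mxM.
Qed.

Lemma scal1 v : scal 1 v = 1%:M.
Proof. by rewrite /scal -scalar_mx_block. Qed.

Lemma hom_scal t : @is_hom F n M M (scal t).
Proof.
move=> v; rewrite /= /scal !mulmx_block !(mulmx0, mul0mx, mulmx1, mul1mx, addr0, add0r).
by rewrite mul_scalar_mx mul_mx_scalar.
Qed.

Lemma scal_p1 t v : scal t v - 1%:M = (t - 1) *: p1 v.
Proof.
rewrite (@scalar_mx_block _ _ _ 1) /scal /p1 opp_block_mx add_block_mx.
by rewrite scale_block_mx !(oppr0, addr0, scaler0) subrr scale_scalar_mx mulr1 raddfB.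
Qed.

Let act (t : F) (U : subfam M) : subfam M := span_fam (fun v => U v *m scal t v).

Lemma actE t U v : (act t U v :=: U v *m scal t v)%MS.
Proof. exact: span_famE. Qed.

Lemma act_hall t U : t != 0 -> U \in hall_set X Y M -> act t U \in hall_set X Y M.
Proof.
move=> t0; rewrite !inE canonical_span /= => /andP[_ /asboolP[f [g [S fE]]]].
apply/asboolP; exists (fun v => f v *m scal t v), (fun v => scal t^-1 v *m g v); split.
  apply: (ses_isom_mid S) => [||v|v]; try exact: hom_scal.
    by rewrite scal_mul mulfV // scal1.
  by rewrite scal_mul mulVf // scal1.
move=> v; apply: eqmx_trans (eqmx_sym (actE t U v)); exact: eqmxMr.
Qed.

Lemma actM s t U : act t (act s U) = act (s * t) U.
Proof.
apply: canonical_inj; [exact: canonical_span|exact: canonical_span|] => v.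
apply: (eqmx_trans (actE _ _ v)); apply: eqmx_trans (eqmx_sym (actE _ _ v)).
by apply: (eqmx_trans (eqmxMr _ (actE s U v))); rewrite -mulmxA scal_mul.
Qed.

Lemma act1 U : U \in hall_set X Y M -> act 1 U = U.
Proof.
rewrite inE => /andP[cU _]; apply: canonical_inj => //; first exact: canonical_span.
by move=> v; apply: (eqmx_trans (actE 1 U v)); rewrite scal1 mulmx1.
Qed.

Lemma act_free t U : t != 0 -> U \in hall_set X Y M -> act t U = U -> t = 1.
Proof.
move=> t0; rewrite inE => /andP[cU /asboolP[f [g [S fE]]]] tU.
have [//|t1] := eqVneq t 1.
suff sub v : (f v *m p1 v <= f v)%MS by case: (homogeneous_summand S sub).
have Ut : (U v *m scal t v <= U v)%MS by rewrite -{2}tU actE.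
suff : (U v *m ((t - 1) *: p1 v) <= U v)%MS.
  rewrite -scalemxAr eqmx_scale ?subr_eq0 // -(eqmxMr _ (fE v)) => H.
  by apply: submx_trans H _; rewrite fE.
rewrite -scal_p1 mulmxBr mulmx1; apply: addmx_sub => //.
by rewrite eqmx_opp.
Qed.

(* The group F^* acts on the submodules by scaling M1.  For t <> 1, scal t - 1 is a
   multiple of the projection onto M1, so a submodule fixed by t is homogeneous, and
   there is none: the action is free. *)
Theorem torus_dvd : (#|F|.-1 %| hall_number X Y M)%N.
Proof.
rewrite hall_numberE; set S := hall_set X Y M.
pose R U U' := [exists t : F, (t != 0) && (U' == act t U)].
have eqR : {in S & &, equivalence_rel R}.
  move=> U1 U2 U3 S1 S2 S3; split.
    by apply/existsP; exists 1; rewrite oner_neq0 act1 // eqxx.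
  move=> /existsP[t /andP[t0 /eqP U2E]]; apply/existsP/existsP => -[s /andP[s0 /eqP U3E]].
    exists (t^-1 * s); rewrite mulf_neq0 ?invr_neq0 //= U2E actM mulrA mulfV // mul1r U3E.
    exact: eqxx.
  by exists (t * s); rewrite mulf_neq0 //= U3E U2E actM eqxx.
have := equivalence_partitionP eqR; set P := equivalence_partition R S.
move=> partP; rewrite (@card_uniform_partition _ #|F|.-1 P S) ?dvdn_mull // => A.
move=> /imsetP[U US ->].
rewrite (_ : [set _ in _ | _] = [set act t U | t in [set t : F | t != 0]]).
  rewrite card_in_imset => [|s t]; last first.
    rewrite !inE => s0 t0 st; have : act (s * t^-1) U = U.
      by rewrite -actM st actM mulfV // act1.
    move/act_free; rewrite mulf_neq0 ?invr_neq0 // => /(_ isT US)/(canRL (divfK t0)).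
    by rewrite mul1r.
  by rewrite (cardsE (predC1 0)) cardC1.
apply/setP => U'; rewrite !inE; apply/andP/imsetP.
  by move=> [_ /existsP[t /andP[t0 /eqP->]]]; exists t; rewrite ?inE.
move=> [t]; rewrite inE => t0 ->; have := act_hall t0 US; rewrite inE => -> ; split=> //.
by apply/existsP; exists t; rewrite t0 eqxx.
Qed.

End Torus.

(** * Extensions whose middle term is the direct sum of the ends *)

Local Notation famhom A B := {dffun forall v, 'M_(vdim A v, vdim B v)}.

Section HomSets.
Variables (F : finFieldType) (n : nat).
Implicit Types A B : qrep F n.

Definition hom_set A B : {set famhom A B} := [set f : famhom A B | `[< @is_hom F n A B f >]].

Lemma hom_setP A B (f : famhom A B) : reflect (@is_hom F n A B f) (f \in hom_set A B).
Proof. by rewrite inE; apply: asboolP. Qed.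

Definition mk_fam A B (f : forall v, 'M[F]_(vdim A v, vdim B v)) : famhom A B :=
  [ffun v => f v].

Lemma mk_famE A B (f : forall v, 'M[F]_(vdim A v, vdim B v)) v : mk_fam f v = f v.
Proof. by rewrite ffunE. Qed.

Lemma mk_fam_hom A B (f : forall v, 'M[F]_(vdim A v, vdim B v)) :
  is_hom f -> mk_fam f \in hom_set A B.
Proof. by move=> hf; apply/hom_setP => v; rewrite !mk_famE. Qed.

End HomSets.

Section SplitMiddle.
Variables (F : finFieldType) (n : nat) (X Y : qrep F n).

Let M := dsum X Y.

(* Miyata's theorem, by counting in 0 -> Hom(X,Y) -> Hom(X,M) -> Hom(X,X). *)
Lemma middle_dsum_splits f g : @ses F n Y M X f g ->
  exists2 s, @is_hom F n X M s & forall v, s v *m g v = 1%:M.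
Proof.
move=> S; have [hf hg ff gf K] := S.
pose T (s : famhom X M) : famhom X X := mk_fam (fun v => s v *m g v).
pose I := [set T s | s in hom_set X M].
have IX : I \subset hom_set X X.
  apply/fintype.subsetP => _ /imsetP[s /hom_setP hs ->].
  by apply: mk_fam_hom; apply: hom_comp.
have c1 : (#|hom_set X X| * #|hom_set X Y| <= #|hom_set X M|)%N.
  pose J (p : famhom X X * famhom X Y) : famhom X M :=
    @mk_fam F n X M (fun v => row_mx (p.1 v) (p.2 v)).
  have injJ : {in finset.setX (hom_set X X) (hom_set X Y) &, injective J}.
    move=> [a b] [a' b'] _ _ /ffunP E; congr pair; apply/ffunP => v;
    by have := E v; rewrite !mk_famE => /eq_row_mx[].
  rewrite -cardsX -(card_in_imset injJ); apply/subset_leq_card/fintype.subsetP.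
  move=> _ /imsetP[[a b] + ->]; rewrite inE => /andP[/hom_setP ha /hom_setP hb].
  apply: mk_fam_hom => v /=; rewrite mul_mx_row mul_row_block !mulmx0 addr0 add0r.
  by rewrite ha hb.
(* Left exactness bounds each fibre of composition with g by Hom(X,Y): [sg] picks a base point in
   each nonempty fibre, and [k] records the difference from it. *)
have c2 : (#|hom_set X M| <= #|I| * #|hom_set X Y|)%N.
  pose sg (h : famhom X X) : famhom X M :=
    odflt (mk_fam (fun=> 0)) [pick s in hom_set X M | T s == h].
  have sgE s : s \in hom_set X M -> sg (T s) \in hom_set X M /\ T (sg (T s)) = T s.
    move=> hs; rewrite /sg; case: pickP => [s' /andP[? /eqP] //|/(_ s)].
    by rewrite hs eqxx.
  pose k (s : famhom X M) : famhom X Y := @mk_fam F n X Y (fun v => (s v - sg (T s) v) *m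
    pinvmx (f v)).
  have kE s : s \in hom_set X M -> forall v, k s v *m f v = s v - sg (T s) v.
    move=> hs v; rewrite mk_famE mulmxKpV // K; apply/sub_kermxP.
    have [_ /ffunP/(_ v)] := sgE s hs; rewrite !mk_famE => E.
    by rewrite mulmxBl -E subrr.
  pose J (s : famhom X M) := (T s, k s).
  have injJ : {in hom_set X M &, injective J}.
    move=> s s' hs hs' [TE kk]; apply/ffunP => v.
    by have := kE s hs v; rewrite kk kE // TE => /addIr.
  rewrite -cardsX -(card_in_imset injJ); apply/subset_leq_card/fintype.subsetP.
  move=> _ /imsetP[s hs ->]; rewrite inE /= imset_f //=.
  apply/hom_setP; apply: (hom_invl _ hf ff (kE s hs)).
  apply: hom_sub; first exact/hom_setP.
  by apply/hom_setP; have [] := sgE s hs.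
have pos : (0 < #|hom_set X Y|)%N.
  by apply/card_gt0P; exists (mk_fam (fun=> 0)); apply: mk_fam_hom; apply: hom0.
(* The two bounds force composition with g to be onto End X, so the identity lifts to a section. *)
have : I == hom_set X X.
  by rewrite eqEcard IX /= -(leq_pmul2r pos) (leq_trans c1).
move=> /eqP IE; have : mk_fam (fun v => 1%:M) \in I.
  by rewrite IE; apply: mk_fam_hom; apply: hom_id.
move=> /imsetP[s /hom_setP hs /ffunP E]; exists s => // v.
by have := E v; rewrite !mk_famE.
Qed.

Hypotheses (nX : nice X) (nY : nice Y) (neXY : ~ isom X Y).

(** Otherwise X would be a direct summand of Y. The corresponding idempotent of Y is 1 or 0, so X
    would be isomorphic to Y or zero. *)
Lemma not_retract s d : @is_hom F n X Y s -> @is_hom F n Y X d ->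
  ~ forall v, s v *m d v \in unitmx.
Proof.
move=> hs hd U; pose q v := invmx (s v *m d v).
have qE v : q v *m (s v *m d v) = 1%:M by rewrite mulVmx.
have qE' v : (s v *m d v) *m q v = 1%:M by rewrite mulmxV.
have hq : @is_hom F n X X q.
  by apply: (hom_invl (hom_id X) (hom_comp hs hd) _ qE) => v; rewrite row_free_unit.
clearbody q.
have he := hom_comp hd (hom_comp hq hs).
have [v|e1|e0] := nice_idem nY he.
- rewrite -[LHS]mulmxA; congr (_ *m _); rewrite -!mulmxA; congr (_ *m _).
  by rewrite !mulmxA -[s v *m _]/(s v *m d v) qE' mul1mx.
- apply: neXY; apply: (isom_intro (g := fun v => d v *m q v) hs) => v.
    by rewrite mulmxA qE'.
  by rewrite -mulmxA e1.
- apply: (nice_nonzero nX) => v.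
  have : s v *m (d v *m (q v *m s v)) *m d v = 0 by rewrite e0 mulmx0 mul0mx.
  rewrite !mulmxA qE' mul1mx => sd0; have := qE v; rewrite sd0 mulmx0 => E.
  by rewrite -[LHS](mxrank1 F) -E mxrank0.
Qed.

(** A section of g writes the identity of X as the sum of an endomorphism through X and one through
    Y. The latter is not a unit, so by locality the former is; then g is invertible on the summand
    X, which makes the Y component of f injective. *)
Lemma split_ses_unit f g : @ses F n Y M X f g -> forall v, rsubmx (f v) \in unitmx.
Proof.
move=> S; have [s hs sg] := middle_dsum_splits S; have [hf hg ff gf K] := S.
have fL v : f v = row_mx (lsubmx (f v)) (rsubmx (f v)) by rewrite hsubmxK.
have gL v : g v = col_mx (usubmx (g v)) (dsubmx (g v)) by rewrite vsubmxK.
have sL v : s v = row_mx (lsubmx (s v)) (rsubmx (s v)) by rewrite hsubmxK.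
have hgu : @is_hom F n X X (fun v => usubmx (g v)).
  move=> v; have := hg v; rewrite (gL v) (gL (arrow_end v)) /= mul_block_col mul_col_mx.
  by rewrite !mul0mx addr0 add0r => /eq_col_mx[]; rewrite !col_mxKu.
have hgd : @is_hom F n Y X (fun v => dsubmx (g v)).
  move=> v; have := hg v; rewrite (gL v) (gL (arrow_end v)) /= mul_block_col mul_col_mx.
  by rewrite !mul0mx addr0 add0r => /eq_col_mx[]; rewrite !col_mxKd.
have hsl : @is_hom F n X X (fun v => lsubmx (s v)).
  move=> v; have := hs v; rewrite (sL v) (sL (arrow_end v)) /= mul_mx_row mul_row_block.
  by rewrite !mulmx0 addr0 add0r => /eq_row_mx[]; rewrite !row_mxKl.
have hsr : @is_hom F n X Y (fun v => rsubmx (s v)).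
  move=> v; have := hs v; rewrite (sL v) (sL (arrow_end v)) /= mul_mx_row mul_row_block.
  by rewrite !mulmx0 addr0 add0r => /eq_row_mx[]; rewrite !row_mxKr.
have [v|U1|U2] := nice_local nX (hom_comp hsl hgu) (hom_comp hsr hgd).
- by have := sg v; rewrite {1}(sL v) {1}(gL v) mul_row_col.
- move=> v; have := U1 v; rewrite unitmx_mul => /andP[_ cU].
  rewrite -row_free_unit -kermx_eq0; apply/eqP.
  set k := kermx _; have kb : k *m rsubmx (f v) = 0 by apply: mulmx_ker.
  have := ses_mul S v; rewrite {1}(fL v) {1}(gL v) mul_row_col.
  move=> /(congr1 (mulmx k)); rewrite mulmxDr !mulmxA kb mul0mx addr0 mulmx0 => kac.
  have ka : k *m lsubmx (f v) = 0.
    by rewrite -[LHS](mulmxK cU) kac mul0mx.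
  apply: (row_free_cancel (ff v)); rewrite mul0mx (fL v) mul_mx_row ka.
  by rewrite -/k kb row_mx0.
- by case: (not_retract hsr hgd).
Qed.

Lemma hall_number_split : hall_number X Y M = #|hom_set Y X|.
Proof.
apply: (@hall_number_count F n X Y M (vdim M) (fun v => 1%:M) _ (hom_set Y X)
  (vdim Y) (fun r v => row_mx (r v) 1%:M)) => [v|r /hom_setP hr|f g S|r r' _ _ E].
- by rewrite row_free_unit unitmx1.
- exists (fun v => row_mx (r v) 1%:M), (fun v => col_mx 1%:M (- r v)); split; last first.
    by move=> v; rewrite mulmx1.
  apply: ses_intro => v.
  + by rewrite /= mul_mx_row mul_row_block !mulmx0 addr0 add0r mulmx1 mul1mx hr.
  + by rewrite /= mul_block_col mul_col_mx !mul0mx addr0 add0r mulmx1 mul1mx mulmxN hr mulNmx.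
  + apply/row_freeP; exists (col_mx 0 1%:M).
    by rewrite mul_row_col mulmx0 mulmx1 add0r.
  + apply/row_fullP; exists (row_mx 1%:M 0).
    by rewrite mul_row_col mul0mx mulmx1 addr0.
  + by rewrite mul_row_col mulmx1 mul1mx subrr.
  + by rewrite /= addnC.
- have U := split_ses_unit S; have [hf _ _ _ _] := S.
  have fL v : f v = row_mx (lsubmx (f v)) (rsubmx (f v)) by rewrite hsubmxK.
  have hfl : @is_hom F n Y X (fun v => lsubmx (f v)).
    move=> v; have := hf v; rewrite (fL v) (fL (arrow_end v)) /= mul_mx_row mul_row_block.
    by rewrite !mulmx0 addr0 add0r => /eq_row_mx[]; rewrite !row_mxKl.
  have hfr : @is_hom F n Y Y (fun v => rsubmx (f v)).
    move=> v; have := hf v; rewrite (fL v) (fL (arrow_end v)) /= mul_mx_row mul_row_block.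
    by rewrite !mulmx0 addr0 add0r => /eq_row_mx[]; rewrite !row_mxKr.
  exists (mk_fam (fun v => invmx (rsubmx (f v)) *m lsubmx (f v))).
    apply: mk_fam_hom; apply: (hom_invr hfl hfr) => v; first by rewrite row_full_unit.
    by rewrite mulmxA mulmxV // mul1mx.
  move=> v; rewrite mulmx1 mk_famE.
  have -> : row_mx (invmx (rsubmx (f v)) *m lsubmx (f v)) 1%:M = invmx (rsubmx (f v)) *m f v.
    transitivity (invmx (rsubmx (f v)) *m row_mx (lsubmx (f v)) (rsubmx (f v))).
      by rewrite mul_mx_row mulVmx.
    by rewrite hsubmxK.
  by apply: eqmx_sym; apply: eqmxMfull; rewrite row_full_unit unitmx_inv.
- apply/ffunP => v; have /submxP[c] : (row_mx (r v) 1%:M <= row_mx (r' v) 1%:M)%MS.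
    by rewrite E.
  by rewrite mul_mx_row mulmx1 => /eq_row_mx[-> <-]; rewrite mul1mx.
Qed.

End SplitMiddle.

(** * Hall polynomials at 1 *)

Section LargeFields.

(** The field is a splitting field of X^N - 1 with N = q^(m+2) - 1. In K this N equals -1, so the
    polynomial is separable and has N > m roots. *)
Lemma large_finite_extension (K : finFieldType) m :
  exists (E : finFieldType) (iota : {rmorphism K -> E}), (m < #|E|)%N.
Proof.
pose q := #|K|; pose N := (q ^ m.+2).-1.
have q1 : (1 < q)%N by exact: finNzRing_gt1.
have qN : (q ^ m.+2 = N.+1)%N by rewrite prednK // expn_gt0; lia.
have mN : (m < N)%N by have := ltn_expl m.+2 q1; lia.
have N_gt0 : (0 < N)%N := leq_ltn_trans (leq0n _) mN.
have q0 : q%:R = 0 :> K.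
  have := expg_cardG (finset.in_setT (1 : K)).
  by rewrite FinRing.zmodXgE cardsT.
have N0 (R : fieldExtType K) : N%:R != 0 :> R.
  rewrite (_ : N%:R = -1) ?oppr_eq0 ?oner_eq0 //.
  apply/eqP; rewrite -addr_eq0 -(natrD _ _ 1) addn1 -qN natrX.
  by rewrite -(rmorph_nat (in_alg R)) q0 rmorph0 expr0n.
have [|L [zs DqL _]] := @FinSplittingFieldFor K ('X^N - 1).
  by rewrite monic_neq0 // monicXnsubC //; lia.
rewrite rmorphB rmorphXn /= map_polyX rmorph1 in DqL.
have Uzs : uniq zs.
  rewrite -separable_prod_XsubC -(eqp_separable DqL).
  apply: cyclotomic.separable_Xn_sub_1; exact: N0.
exists (FinFieldExtType L), (in_alg L).
have : (size zs <= #|FinFieldExtType L|)%N.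
  have := @max_card (FinFieldExtType L) (mem zs).
  by rewrite (card_uniqP _).
apply: leq_trans; apply: leq_trans mN _.
rewrite -ltnS -(size_prod_XsubC zs id) -(eqp_size DqL) size_XnsubC //.
Qed.

End LargeFields.

Section Extension.
Variables (K E : finFieldType) (iota : {rmorphism K -> E}) (n : nat).
Implicit Types A B M : qrep K n.

Lemma eq_qrep (F : fieldType) (d : 'I_n -> nat)
    (f g : forall v, 'M[F]_(d v, d (arrow_end v))) :
  (forall v, f v = g v) -> QRep f = QRep g.
Proof. by move=> fg; congr QRep; apply: functional_extensionality_dep. Qed.

Lemma extend_std l : extend iota (std K n l) = std E n l :> qrep E n.
Proof.
case: l => i j; apply: eq_qrep => v /=; apply/matrixP => a b.
  by case: ifP; rewrite !mxE ?rmorph0 // rmorph_nat.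
by case: ifP => _; [|case: ifP => _]; rewrite !mxE rmorph_nat.
Qed.

Lemma extend_dsum A B : extend iota (dsum A B) = dsum (extend iota A) (extend iota B).
Proof. by apply: eq_qrep => v /=; rewrite map_block_mx !map_mx0. Qed.

Lemma extend_isom A B : isom A B -> isom (extend iota A) (extend iota B).
Proof.
move=> [f [g [hf hg fg gf]]].
exists (fun v => map_mx iota (f v)), (fun v => map_mx iota (g v)); split=> v /=.
- by rewrite -!map_mxM hf.
- by rewrite -!map_mxM hg.
- by rewrite -map_mxM fg map_mx1.
- by rewrite -map_mxM gf map_mx1.
Qed.

Lemma extend_conservative : conservative iota n.
Proof. by move=> M /indecomposable_nice; apply: nice_quotient_is_field. Qed.

End Extension.

(** * Hom spaces under extension of scalars *)

Section HomDimension.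
Variable n : nat.

Section OneField.
Variables (F : fieldType) (A B : qrep F n).

(** One finite type lists all matrix entries of a family, which turns the family into a single row
    vector and the homomorphism condition into a linear system. *)
Definition hom_idx : predArgType := {v : 'I_n & ('I_(vdim A v) * 'I_(vdim B v))%type}.
Definition rel_idx : predArgType := {v : 'I_n & ('I_(vdim A v) * 'I_(vdim B (arrow_end
  v)))%type}.
HB.instance Definition _ := Finite.on hom_idx.
HB.instance Definition _ := Finite.on rel_idx.

Definition fam_of_row (u : 'rV[F]_#|hom_idx|) v : 'M[F]_(vdim A v, vdim B v) :=
  \matrix_(a, b) u 0 (enum_rank (Tagged _ (a, b) : hom_idx)).

Definition row_of_fam (f : forall v, 'M[F]_(vdim A v, vdim B v)) : 'rV[F]_#|hom_idx| :=
  \row_k (let: i := enum_val k in f (tag i) (tagged i).1 (tagged i).2).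

Lemma row_of_famK f v : fam_of_row (row_of_fam f) v = f v.
Proof. by apply/matrixP => a b; rewrite !mxE enum_rankK. Qed.

Lemma fam_of_rowK u : row_of_fam (fam_of_row u) = u.
Proof.
apply/rowP => k; rewrite !mxE -[k in RHS]enum_valK.
by case: (enum_val k) => v [a b].
Qed.

Lemma fam_of_row_linear c u w v :
  fam_of_row (c *: u + w) v = c *: fam_of_row u v + fam_of_row w v.
Proof. by apply/matrixP => a b; rewrite !mxE. Qed.

Definition defect_mx (u : 'rV[F]_#|hom_idx|) v : 'M[F]_(vdim A v, vdim B (arrow_end v)) :=
  vmap A v *m fam_of_row u (arrow_end v) - fam_of_row u v *m vmap B v.

Lemma defect_mx_linear c u w v :
  defect_mx (c *: u + w) v = c *: defect_mx u v + defect_mx w v.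
Proof.
rewrite /defect_mx !fam_of_row_linear mulmxDr mulmxDl -scalemxAr -scalemxAl.
by rewrite scalerBr opprD addrACA.
Qed.

Definition hom_defect (u : 'rV[F]_#|hom_idx|) : 'rV[F]_#|rel_idx| :=
  \row_k (let: i := enum_val k in defect_mx u (tag i) (tagged i).1 (tagged i).2).

Lemma hom_defect_linear : linear hom_defect.
Proof.
move=> c u w; apply/rowP => k; rewrite [LHS]mxE defect_mx_linear.
rewrite [LHS]mxE [RHS]mxE; congr (_ + _); last by rewrite [RHS]mxE.
by rewrite [LHS]mxE [RHS]mxE; congr (_ * _); rewrite [RHS]mxE.
Qed.

HB.instance Definition _ := GRing.isLinear.Build F _ _ _ hom_defect hom_defect_linear.

Lemma hom_defectP u : is_hom (fam_of_row u) <-> hom_defect u = 0.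
Proof.
split=> [hu|/rowP hu v].
  by apply/rowP => k; rewrite [LHS]mxE /defect_mx hu subrr !mxE.
apply/eqP; rewrite -subr_eq0; apply/eqP/matrixP => a b.
rewrite [RHS]mxE; have := hu (enum_rank (Tagged _ (a, b) : rel_idx)).
rewrite [X in _ = X -> _]mxE => <-.
by rewrite [RHS]mxE enum_rankK.
Qed.

Definition hom_dim := \rank (kermx (lin1_mx hom_defect)).

End OneField.

(** Homomorphisms solve a linear system with coefficients in K; extension preserves its rank, hence
    the dimension of the solution space. *)
Lemma hom_set_card (K E : finFieldType) (iota : {rmorphism K -> E}) (A B : qrep K n) :
  #|hom_set (extend iota A) (extend iota B)| = (#|E| ^ hom_dim A B)%N.
Proof.
set A' := extend iota A; set B' := extend iota B.
have -> : hom_dim A B = hom_dim A' B'.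
  rewrite /hom_dim !mxrank_ker; congr (_ - _)%N.
  rewrite -(mxrank_map iota); congr mxrank.
  rewrite (map_lin1_mx (gf := @hom_defect E A' B')) // => u.
  have famE v : @fam_of_row E A' B' (map_mx iota u) v = map_mx iota (fam_of_row u v).
    by apply/matrixP => a b; rewrite !mxE.
  have defE v : @defect_mx E A' B' (map_mx iota u) v = map_mx iota (defect_mx u v).
    by rewrite /defect_mx !famE map_mxB !map_mxM.
  apply/rowP => k; rewrite [LHS]mxE [X in iota X]mxE [RHS]mxE defE.
  by rewrite [RHS]mxE.
rewrite /hom_dim -card_rowg.
have injT : {in hom_set A' B' &, injective (fun f : famhom A' B' => row_of_fam f)}.
  move=> f g _ _ fg; apply/ffunP => v.
  by rewrite -[LHS](row_of_famK f) -[RHS](row_of_famK g) fg.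
rewrite -(card_in_imset injT); apply: eq_card => u; rewrite !inE.
apply/imsetP/sub_kermxP => [[f /hom_setP hf ->]|].
  rewrite mul_rV_lin1; apply/hom_defectP => v.
  by rewrite !row_of_famK.
rewrite mul_rV_lin1 => /hom_defectP hu; exists (mk_fam (fam_of_row u)).
  exact: mk_fam_hom.
by rewrite -[LHS]fam_of_rowK; congr row_of_fam; apply: functional_extensionality_dep => v;
  rewrite mk_famE.
Qed.

End HomDimension.

(** * Values at 1 by divisibility *)

Section Values.
Variables (K : finFieldType) (n : nat).

Lemma horner_modulo (p : {poly int}) (q : int) : exists k, p.[q] = p.[1] + k * (q - 1).
Proof.
have /factor_theorem[r rE] : root (p - p.[1]%:P) 1 by rewrite /root !hornerE subrr.
exists r.[q]; have := congr1 (horner^~ q) rE; rewrite !hornerE => <-.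
by rewrite addrC subrK.
Qed.

Lemma large_divisors_eq0 (c : int) :
  (forall (E : finFieldType) (iota : {rmorphism K -> E}), exists k, c = k * (#|E|%:R - 1)) ->
  c = 0.
Proof.
(* The bound |c| + 1 makes |E| - 1 larger than |c|, so only the multiple 0 remains. *)
move=> H; have [E [iota cE]] := large_finite_extension K `|c|.+1.
have [k kE] := H E iota; move: cE kE; move: #|E| => q qc kE.
have [k0|k0] := eqVneq k 0; first by rewrite kE k0 mul0r.
nia.
Qed.

Variables (X Y M : amod K n).

(** Both polynomials agree at |E| for every E, so |E| - 1 divides the difference of their values at
    1. Any explicit Hall polynomial thus computes the structure constant. *)
Lemma hall_poly_eq1 p : is_hall_poly X Y M p -> (hall_poly X Y M).[1] = p.[1].
Proof.
move=> hp; have hp' : is_hall_poly X Y M (hall_poly X Y M).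
  by rewrite /hall_poly; apply: (@xgetPex _ 0 [set p | is_hall_poly X Y M p]%classic); exists p.
apply/eqP; rewrite -subr_eq0 -hornerN -hornerD; apply/eqP.
apply: large_divisors_eq0 => E iota.
have [k] := horner_modulo (hall_poly X Y M - p) #|E|%:R.
have cons := @extend_conservative K E iota n.
rewrite [LHS]hornerD hornerN (hp' _ _ cons) (hp _ _ cons).
by rewrite subrr => /esym/eqP; rewrite addr_eq0 => /eqP ->; exists (- k); rewrite mulNr.
Qed.

Lemma hall_poly_eq0 :
  (forall (E : finFieldType) (iota : {rmorphism K -> E}),
     (#|E|.-1 %| hall_number (extend iota X) (extend iota Y) (extend iota M))%N) ->
  (hall_poly X Y M).[1] = 0.
Proof.
move=> H; have [[p hp]|no] := pselect (exists p, is_hall_poly X Y M p); last first.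
  (* In this branch [hall_poly] is its default 0. *)
  rewrite /hall_poly xgetPN ?horner0 // => p hp; apply: no; by exists p.
rewrite (hall_poly_eq1 hp); apply: large_divisors_eq0 => E iota.
have [k] := horner_modulo p #|E|%:R; rewrite (hp _ _ (@extend_conservative K E iota n)).
have /dvdnP[d ->] := H E iota; have := finNzRing_gt1 E; move: #|E| => q q1 kE.
exists (d%:R - k); rewrite mulrBl.
apply/eqP; rewrite eq_sym subr_eq -kE natrM; apply/eqP; congr (_ * _).
by rewrite -[in LHS](prednK (ltnW q1)) -natr1 addrK.
Qed.

End Values.

(** * Indecomposable middle terms *)

Section FlagSes.
Variables (F : fieldType) (n : nat).

(** The common top t of Y and M is what [ses_top] forces on nonzero chains. The chain X may stop
    earlier, at t', and the conditions on psi concern only the vertices up to there. *)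
Lemma flag_ses (Y M X : qrep F n) t t' DY DM DX thY thM thX NY NM NX
    (phi : 'M[F]_(DY, DM)) (psi : 'M[F]_(DM, DX)) :
  @flag F n Y t DY thY NY -> @flag F n M t DM thM NM -> @flag F n X t' DX thX NX ->
  (t' <= t)%N ->
  (forall v : 'I_n, (v <= t)%N -> (thY v *m phi <= thM v)%MS) -> NY *m phi = phi *m NM ->
  row_free phi ->
  (forall v : 'I_n, (v <= t')%N -> (thM v *m psi <= thX v)%MS) ->
  (t = t' -> NM *m psi = psi *m NX) ->
  (forall v : 'I_n, (v <= t')%N -> thY v *m phi *m psi = 0) ->
  (forall v : 'I_n, (v <= t')%N -> \rank (thM v *m psi) = vdim X v) ->
  (forall v, vdim M v = vdim Y v + vdim X v)%N ->
  exists f g, @ses F n Y M X f g /\ forall v, f v *m thM v = thY v *m phi.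
Proof.
move=> flY flM flX tt sY comY fphi sX comX zero rk dM.
have [frY _ _ zY] := flY; have [frM _ _ _] := flM; have [frX _ _ zX] := flX.
have [f [hf fE]] := flag_hom flY flM (leqnn t) sY (fun _ => comY).
have [g [hg gE]] := flag_hom flM flX tt sX comX.
have fE' v : f v *m thM v = thY v *m phi.
  have [/fE//|vt] := leqP v t; by apply: eq_mx_row0; apply: zY.
exists f, g; split=> //; apply: ses_intro => // v.
- apply: (@row_free_Ml _ _ _ _ _ (thM v)); rewrite fE'; exact: row_freeM.
- have [vt|vt] := leqP v t'; last by apply: row_full0; apply: zX.
  by rewrite /row_full -(mxrankMfree _ (frX v)) gE // rk.
- have [vt|vt] := leqP v t'; last by apply: eq_mx_col0; apply: zX.
  by apply: (row_free_cancel (frX v)); rewrite -mulmxA gE // mulmxA fE' zero // mul0mx.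
Qed.

Lemma sub_seg_flag m (A : 'M[F]_(m, 1)) (b : bool) : b \/ A = 0 -> (A <= seg_flag F b)%MS.
Proof.
move=> [->|->]; last exact: sub0mx.
by apply: submx_full; have := row_free_seg_flag F true; rewrite /row_free /row_full.
Qed.

Lemma seg_flag_mul (b : bool) m (A : 'M[F]_(1, m)) :
  (seg_flag F b *m A :=: b%:R *: A)%MS.
Proof.
case: b; rewrite ?scale1r ?scale0r.
  have -> : seg_flag F true = 1%:M by apply/matrixP => i j; rewrite !ord1 !mxE.
  by rewrite mul1mx.
have -> : seg_flag F false *m A = 0 by exact: eq_mx_row0.
by apply/eqmxP; rewrite !sub0mx.
Qed.

Lemma quad_mul i j (v : 'I_n) m (A : 'M[F]_(2, m)) :
  (U_th F i j v *m A :=: axes F (j <= v.+1)%N (i <= v.+1)%N *m A)%MS.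
Proof. exact: eqmxMr (U_th_axes F i j v). Qed.

(** The column s lists the values of a functional on e_1 and e_2, and the space at v is spanned by
    those of the two that have already entered. *)
Lemma quad_mul_eq0 i j (v : 'I_n) (s : 'cV[F]_2) : U_th F i j v *m s = 0 <->
  ((j <= v.+1)%N -> s 0 0 = 0) /\ ((i <= v.+1)%N -> s 1 0 = 0).
Proof.
have -> : U_th F i j v *m s = 0 <-> axes F (j <= v.+1)%N (i <= v.+1)%N *m s = 0.
  by split=> /eqP; rewrite -submx0 => H; apply/eqP; rewrite -submx0; move: H; rewrite quad_mul.
split=> [E|[H0 H1]].
  split=> b; first by have /matrixP/(_ 0 0) := E;
    rewrite !mxE sum_I2 !mxE /= b mul1r mul0r addr0.
  by have /matrixP/(_ 1 0) := E; rewrite !mxE sum_I2 !mxE /= b mul1r mul0r add0r.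
apply/matrixP => a b; rewrite ord1 [RHS]mxE mxE sum_I2 !mxE; move: a {b}.
apply: forall_I2; rewrite /= ?mul0r ?addr0 ?add0r.
  by case: (leqP j v.+1) H0 => [_ -> //|_ _]; rewrite ?mulr0 ?mul0r.
by case: (leqP i v.+1) H1 => [_ -> //|_ _]; rewrite ?mulr0 ?mul0r.
Qed.

Lemma rank_col1 m (A : 'cV[F]_m) : A != 0 -> \rank A = 1%N.
Proof.
move=> A0; apply/eqP; rewrite eqn_leq rank_leq_col /= lt0n mxrank_eq0 //.
Qed.

(** On row vectors e_1 goes to p e_1 + r e_2 and e_2 to p e_2. By [sq_nil_comm] these are all the
    endomorphisms of the plane that commute with the loop. *)
Definition upper (p r : F) : 'M[F]_2 := p%:M + r *: sq_nil F.

Lemma upperE p r : [/\ upper p r 0 0 = p, upper p r 0 1 = r, upper p r 1 0 = 0 & upper p r 1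
  1 = p].
Proof. by rewrite !mxE /= !(mulr0n, mulr1n, mulr0, mulr1, add0r, addr0). Qed.

Lemma upper_comm p r : sq_nil F *m upper p r = upper p r *m sq_nil F.
Proof.
by rewrite mulmxDr mulmxDl -scalemxAr -scalemxAl sq_nil2 mul_scalar_mx mul_mx_scalar.
Qed.

Lemma upper_free p r : p != 0 -> row_free (upper p r).
Proof.
move=> p0; rewrite row_free_unit.
by have /mulmx1_unit[] := scalar_nil_unit r (sq_nil2 F) p0.
Qed.

Lemma upper_scale p r : p != 0 -> upper p r = p *: upper 1 (r / p).
Proof.
by move=> p0; rewrite /upper scalerDr scale_scalar_mx mulr1 scalerA mulrCA mulfV // mulr1.
Qed.

Lemma sub_upper i j i' j' (v : 'I_n) p r :
  ((j <= v.+1)%N -> (j' <= v.+1)%N /\ ((i' <= v.+1)%N \/ r = 0)) ->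
  ((i <= v.+1)%N -> (i' <= v.+1)%N) ->
  (U_th F i j v *m upper p r <= U_th F i' j' v)%MS.
Proof.
move=> H0 H1; rewrite quad_mul U_th_axes; apply/sub_axesP => a.
have [u00 u01 u10 u11] := upperE p r.
split; rewrite mxE sum_I2 !mxE; move: a; apply: forall_I2 => /=.
- case: (leqP j v.+1) H0 => [_ /(_ isT)[-> _]|_ _]; [by left|right].
  by rewrite !mul0r addr0.
- by right; rewrite mul0r add0r; rewrite !(mulr0n, mulr0, addr0, mulr1n).
- case: (leqP j v.+1) H0 => [_ /(_ isT)[_ [->|->]]|_ _]; [by left|right|right].
    by rewrite !(mulr0n, mul0r, mulr0, addr0, mul1r).
  by rewrite !mul0r addr0.
- case: (leqP i v.+1) H1 => [_ /(_ isT) ->|_ _]; [by left|right].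
  by rewrite !mul0r addr0.
Qed.

Lemma sub_upper_inv i j i' j' (v : 'I_n) p r : p != 0 ->
  (U_th F i j v *m upper p r <= U_th F i' j' v)%MS ->
  ((j <= v.+1)%N -> (j' <= v.+1)%N /\ ((i' <= v.+1)%N \/ r = 0)) /\
  ((i <= v.+1)%N -> (i' <= v.+1)%N).
Proof.
move=> p0; rewrite quad_mul U_th_axes => /sub_axesP H.
have [u00 u01 u10 u11] := upperE p r.
split=> b.
  have [] := H 0; rewrite !mxE !sum_I2 !mxE /= b !(mulr0n, mulr1n, mul0r, mul1r, mulr0,
    mulr1, addr0, add0r).
  by move=> [//|/eqP]; rewrite (negPf p0).
have [_] := H 1; rewrite !mxE !sum_I2 !mxE /= b !(mulr0n, mulr1n, mul0r, mul1r, mulr0, mulr1,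
  addr0, add0r).
by move=> [//|/eqP]; rewrite (negPf p0).
Qed.

Lemma flag_dim_gt0 M t D th N : @flag F n M t D th N -> (0 < D)%N -> (0 < vdim M t)%N.
Proof.
move=> [_ _ + _] D0; rewrite /row_full => /eqP E.
by apply: leq_trans (rank_leq_row (th t)); rewrite E.
Qed.

(** A top of Y below that of M contradicts injectivity of f, which vanishes there by
    [flag_hom_top_lt]; a top above it contradicts the dimensions. *)
Lemma ses_top Y M X t t' D D' th th' N N' f g :
  @flag F n Y t D th N -> @flag F n M t' D' th' N' -> (0 < D)%N ->
  @ses F n Y M X f g -> t = t'.
Proof.
move=> flY flM D0 S; have [hf _ ff _ _] := S; have Yt := flag_dim_gt0 flY D0.
case: (ltngtP t t') => [tt'|tt'|/val_inj //].
  have f0 := flag_hom_top_lt flY flM tt' hf.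
  by have := row_free_eq0 (ff t) f0; lia.
by have := ses_dim S t; case: flM => _ _ _ ->; lia.
Qed.

(** The vertex x is numbered from 1, whereas ordinals start at 0; hence the successor in
    [vdim_std]. *)
Definition dim_std l x : nat := match l with
  | Seg i j => (i <= x <= j)%N
  | Quad i j => (j <= x)%N + (i <= x)%N
  end.

Lemma vdim_std l v : vdim (std F n l) v = dim_std l v.+1.
Proof. by case: l => i j //=; apply: U_dimE. Qed.

Lemma ses_dim_std x y z f g : @ses F n (std F n y) (std F n z) (std F n x) f g ->
  forall k, (1 <= k <= n)%N -> (dim_std z k = dim_std y k + dim_std x k)%N.
Proof.
move=> S k kn; have kn' : (k.-1 < n)%N by lia.
by have := ses_dim S (Ordinal kn'); rewrite !vdim_std /= prednK //; lia.
Qed.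

(** Equal tops give d = m. The dimension vectors then make [i,m] the disjoint union of [a,b] and
    [c,m]. *)
Lemma ses_seg_seg_seg a b c d i m f g : valid n (Seg a b) -> valid n (Seg c d) -> valid n
  (Seg i m) ->
  @ses F n (std F n (Seg c d)) (std F n (Seg i m)) (std F n (Seg a b)) f g ->
  [/\ a = i, d = m & b.+1 = c].
Proof.
move=> /andP[ab bn] /andP[cd dn] /andP[im mn] S.
have dn' : (d.-1 < n)%N by lia.
have mn' : (m.-1 < n)%N by lia.
have flY : flag (M := W F n c d) (Ordinal dn') (fun v => seg_flag F (c <= v.+1 <= d)%N) 0.
  by apply: W_flag => //=; lia.
have flM : flag (M := W F n i m) (Ordinal mn') (fun v => seg_flag F (i <= v.+1 <= m)%N) 0.
  by apply: W_flag => //=; lia.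
have /(congr1 val) /= dm := ses_top flY flM isT S.
have D := ses_dim_std S; rewrite /= in D.
have dm' : d = m by clear - dm cd im; lia.
have [ha hca] : (i <= a <= m)%N /\ ~~ (c <= a <= d)%N.
  by have Da := D a; clear - ab bn Da; lia.
have [hb hcb] : (i <= b <= m)%N /\ ~~ (c <= b <= d)%N.
  by have Db := D b; clear - ab bn Db; lia.
have ac : (a < c)%N by clear - ha hca dm'; lia.
have bc : (b < c)%N by clear - hb hcb dm'; lia.
have ai : a = i by have Di := D i; clear - Di im mn ac ha; lia.
have cb : (c <= b.+1)%N.
  by rewrite leqNgt; apply/negP => cb; have Db := D b.+1; clear - Db bc cb cd dn dm' hb; lia.
by split=> //; apply/eqP; rewrite eqn_leq bc cb.
Qed.

Lemma seg_ses a b d : valid n (Seg a b) -> valid n (Seg b.+1 d) ->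
  exists f g, @ses F n (std F n (Seg b.+1 d)) (std F n (Seg a d)) (std F n (Seg a b)) f g.
Proof.
move=> /andP[ab bn] /andP[cd dn].
have dn' : (d.-1 < n)%N by lia.
have bn' : (b.-1 < n)%N by lia.
have flY : flag (M := W F n b.+1 d) (Ordinal dn') (fun v => seg_flag F (b.+1 <= v.+1 <= d)%N) 0.
  by apply: W_flag => //=; lia.
have flM : flag (M := W F n a d) (Ordinal dn') (fun v => seg_flag F (a <= v.+1 <= d)%N) 0.
  by apply: W_flag => //=; lia.
have flX : flag (M := W F n a b) (Ordinal bn') (fun v => seg_flag F (a <= v.+1 <= b)%N) 0.
  by apply: W_flag => //=; lia.
have [||||||||v|f [g [S _]]] := flag_ses (phi := 1%:M) (psi := 1%:M) flY flM flX.
- by rewrite /=; lia.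
- move=> v _; rewrite mulmx1; apply: sub_seg_flag.
  have /orP[cv|cv] := orbN (b.+1 <= v.+1 <= d)%N.
    by left; move: cv ab; clear; lia.
  by right; apply: eq_mx_row0; rewrite /= (negPf cv).
- by rewrite mul0mx mulmx0.
- by rewrite row_free_unit unitmx1.
- move=> v vt; rewrite mulmx1; apply: sub_seg_flag.
  have /orP[cv|cv] := orbN (a <= v.+1 <= d)%N.
    by left; move: cv vt ab => /=; clear; lia.
  by right; apply: eq_mx_row0; rewrite /= (negPf cv).
- by rewrite mul0mx mulmx0.
- by move=> v vt; apply: eq_mx_row0; move: vt => /=; lia.
- move=> v vt; rewrite mulmx1 (eqP (row_free_seg_flag F _)) /=.
  by move: vt => /=; lia.
- by rewrite /=; lia.
by exists f, g.
Qed.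

End FlagSes.

Section HallNumbers.
Variables (F : finFieldType) (n : nat).

Lemma hall_number_eq0 (X Y M : qrep F n) :
  (forall f g, ~ @ses F n Y M X f g) -> hall_number X Y M = 0%N.
Proof.
move=> no; rewrite hall_numberE; apply/eqP; rewrite cards_eq0; apply/eqP/setP => U.
rewrite inE [RHS]inE; apply/negP => /andP[_ /asboolP[f [g [S _]]]]; exact: no S.
Qed.

Lemma hall_number_seg a b c d i m :
  valid n (Seg a b) -> valid n (Seg c d) -> valid n (Seg i m) ->
  hall_number (std F n (Seg a b)) (std F n (Seg c d)) (std F n (Seg i m)) =
    [&& a == i, d == m & b.+1 == c].
Proof.
move=> vx vy vz; have [E|ne] := boolP [&& a == i, d == m & b.+1 == c]; last first.
  apply: hall_number_eq0 => f g S; case/negP: ne.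
  by have [-> -> ->] := ses_seg_seg_seg vx vy vz S; rewrite !eqxx.
case/and3P: E => /eqP aE /eqP dE /eqP cE; subst i m c.
have [f0 [g0 S0]] := seg_ses F vx vy.
transitivity #|[set: unit]|; last by rewrite cardsT card_unit.
apply: (@hall_number_count F n _ _ _ (vdim (std F n (Seg a d))) (fun v => 1%:M) _ _
   (vdim (std F n (Seg b.+1 d))) (fun _ => f0)).
- by move=> v; rewrite row_free_unit unitmx1.
- by move=> _ _; exists f0, g0; split=> // v; rewrite mulmx1.
(* The dimensions decide at each vertex whether the submodule is 0 or the whole space, so it is
   unique. *)
- move=> f g S; exists tt => // v; rewrite mulmx1.
  have := vdim_std F (Seg a d) v; have := vdim_std F (Seg b.+1 d) v.
  have [_ _ ff _ _] := S; have [_ _ ff0 _ _] := S0.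
  move: (f v) (f0 v) (ff v) (ff0 v) => A B fA fB dY dM.
  have rA : \rank A = vdim (std F n (Seg b.+1 d)) v by apply/eqP.
  have rB : \rank B = vdim (std F n (Seg b.+1 d)) v by apply/eqP.
  have [bv|bv] := leqP b.+1 v.+1; last first.
    have A0 : A = 0 by apply: eq_mx_row0; rewrite dY /=; lia.
    have B0 : B = 0 by apply: eq_mx_row0; rewrite dY /=; lia.
    by rewrite A0 B0.
  have dd : vdim (std F n (Seg b.+1 d)) v = vdim (std F n (Seg a d)) v.
    by rewrite dY dM /=; move: vx => /=; lia.
  have fullA : row_full A by rewrite /row_full rA dd.
  have fullB : row_full B by rewrite /row_full rB dd.
  by apply/eqmxP; rewrite !submx_full.
- by move=> [] [].
Qed.

End HallNumbers.

(** * Segments as submodule and quotient of U_{l,m} *)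

Section SegInQuad.
Variables (F : fieldType) (n : nat).

Lemma W_top_flag c (t : 'I_n) : t.+1 = n -> (1 <= c <= n)%N ->
  flag (M := W F n c n) t (fun v => seg_flag F (c <= v.+1 <= n)%N) 0.
Proof. by move=> tn cn; apply: W_flag. Qed.

Lemma seg_flagE (b : bool) m (A : 'M[F]_(1, m)) : b -> (seg_flag F b *m A :=: A)%MS.
Proof. by move=> bT; apply: (eqmx_trans (seg_flag_mul b A)); rewrite bT scale1r. Qed.

(** The loop acts by 0 on both ends, so the inclusion lands in the line of e_2 and the projection
    kills e_2. Hence e_2 is present at c and e_1 at a, which gives l <= c and m <= a; dimensions
    turn these into equalities. *)
Lemma ses_seg_seg_quad a b c d l m f g :
  valid n (Seg a b) -> valid n (Seg c d) -> valid n (Quad l m) ->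
  @ses F n (std F n (Seg c d)) (std F n (Quad l m)) (std F n (Seg a b)) f g ->
  [/\ b = n, d = n, l = c & m = a] /\
  exists2 p, p != 0 & forall v, f v *m U_th F l m v =
    seg_flag F (c <= v.+1 <= d)%N *m (p *: delta_mx 0 1).
Proof.
move=> /andP[ab bn] /andP[cd dn] /andP[ln mn] S; have D := ses_dim_std S.
have n0 : (n.-1 < n)%N by lia.
pose t := Ordinal n0; have tn : t.+1 = n by rewrite /= prednK //; lia.
have dn' : (d.-1 < n)%N by lia.
have flM : flag (M := U F n l m) t (U_th F l m) (sq_nil F) by apply: U_flag.
have flY : flag (M := W F n c d) (Ordinal dn') (fun v => seg_flag F (c <= v.+1 <= d)%N) 0.
  by apply: W_flag => //=; lia.
have /(congr1 val) /= dE := ses_top flY flM isT S.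
have {dE} dE : d = n by clear - dE cd dn n0; lia.
subst d.
have {}flY : flag (M := W F n c n) t (fun v => seg_flag F (c <= v.+1 <= n)%N) 0.
  exact: W_top_flag.
have bE : b = n by have := D n; rewrite /=; clear - ab bn cd ln mn; lia.
subst b.
have flX : flag (M := W F n a n) t (fun v => seg_flag F (a <= v.+1 <= n)%N) 0.
  exact: W_top_flag.
have [hf hg ff gf K] := S.
have le_t (v : 'I_n) : (v <= t)%N by move: (ltn_ord v) => /=; lia.
have [phi [fE /(_ erefl)]] := hom_flag flY flM (leqnn t) hf.
rewrite mul0mx => /esym phiN.
have [psi [gE /(_ erefl)]] := hom_flag flM flX (leqnn t) hg.
rewrite mulmx0 => Npsi.
have phi0 : phi 0 0 = 0.
  by have := congr1 (fun A => col 1 A 0 0) phiN; rewrite /= col1_sq_nil !mxE.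
have psi1 : psi 1 0 = 0.
  by have := congr1 (fun A => row 0 A 0 0) Npsi; rewrite /= row0_sq_nil !mxE.
have phiE : phi = phi 0 1 *: delta_mx 0 1.
  apply/rowP; apply: forall_I2; rewrite !mxE /= ?phi0 ?mulr0 ?mulr1 //.
have p0 : phi 0 1 != 0.
  apply/eqP => p0; have ft : f t = 0.
    have [frM _ _ _] := flM; apply: (row_free_cancel (frM t)).
    by rewrite fE // phiE p0 scale0r mulmx0 mul0mx.
  by have := row_free_eq0 (ff t) ft; rewrite /=; clear - cd tn; lia.
have lc : (l <= c)%N.
  have c0 : (c.-1 < n)%N by clear - cd; lia.
  pose v := Ordinal c0; have cE : v.+1 = c by rewrite /=; clear - cd; lia.
  have : (phi <= U_th F l m v)%MS.
    rewrite -(seg_flagE phi (_ : (c <= v.+1 <= n)%N)); last by rewrite cE; clear - cd; lia.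
    by rewrite -fE // submxMl.
  rewrite U_th_axes => /sub_axesP/(_ 0)[_ [|/eqP]]; first by rewrite cE.
  by rewrite (negPf p0).
have ma : (m <= a)%N.
  have a0 : (a.-1 < n)%N by clear - ab; lia.
  pose v := Ordinal a0; have aE : v.+1 = a by rewrite /=; clear - ab; lia.
  rewrite leqNgt; apply/negP => am.
  have [frX _ _ _] := flX.
  have gv : g v = 0.
    apply: (row_free_cancel (frX v)); rewrite gE // mul0mx.
    by apply/quad_mul_eq0; split=> //; rewrite aE leqNgt am.
  have := gf v; rewrite /row_full gv mxrank0 => /eqP;
    rewrite -[vdim _ _]/(vdim (std F n (Seg a n)) v) vdim_std aE /=.
  by clear - ab; lia.
split; last by exists (phi 0 1) => // v; rewrite -phiE fE.
have Dl := D l ln; have Dm := D m mn; rewrite /= in Dl Dm.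
have lcE : l = c by clear - lc ma ln Dl cd ab; lia.
by split=> //; clear - lc ma mn Dm Dl cd ab lcE; lia.
Qed.

Lemma quad_seg_ses a c : (1 <= a <= n)%N -> (1 <= c <= n)%N ->
  exists f g, @ses F n (std F n (Seg c n)) (std F n (Quad c a)) (std F n (Seg a n)) f g /\
   forall v, f v *m U_th F c a v = seg_flag F (c <= v.+1 <= n)%N *m delta_mx 0 1.
Proof.
move=> an cn.
have n0 : (n.-1 < n)%N by lia.
pose t := Ordinal n0; have tn : t.+1 = n by rewrite /= prednK //; lia.
have flM : flag (M := U F n c a) t (U_th F c a) (sq_nil F) by apply: U_flag.
have flY := W_top_flag tn cn; have flX := W_top_flag tn an.
pose psi : 'cV[F]_2 := delta_mx 0 0.
have pp : (delta_mx 0 1 : 'rV[F]_2) *m psi = 0 by rewrite mul_delta_mx_0.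
apply: (flag_ses (phi := delta_mx 0 1) (psi := psi) flY flM flX) => //.
- move=> v _; have /orP[cv|cv] := orbN (c <= v.+1 <= n)%N; last first.
    by rewrite (eq_mx_row0 (_ *m _) 0) ?sub0mx //= (negPf cv).
  rewrite (seg_flagE _ cv) U_th_axes; apply/sub_axesP => r; rewrite !mxE /= !ord1.
  by split; [right|left; move: cv; clear; lia].
- by rewrite mul0mx; apply/rowP; apply: forall_I2;
  rewrite !mxE sum_I2 !mxE /= ?(mulr0, mul0r, addr0).
- by apply/row_freeP; exists (delta_mx 1 0); rewrite mul_delta_mx; apply/matrixP => i j;
  rewrite !ord1 !mxE.
- move=> v _; apply: sub_seg_flag.
  have /orP[av|av] := orbN (a <= v.+1 <= n)%N; first by left.
  right; apply/quad_mul_eq0; rewrite !mxE /=; split=> // av'.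
  by move: av av' (ltn_ord v); clear; lia.
- by move=> _; rewrite mulmx0; apply/colP; apply: forall_I2;
  rewrite !mxE sum_I2 !mxE /= ?(mulr0, mul0r, addr0).
- by move=> v _; rewrite -mulmxA pp mulmx0.
- move=> v _; have [av|av] := leqP a v.+1; last first.
    rewrite (_ : U_th F c a v *m psi = 0) ?mxrank0 /=; first by lia.
    by apply/quad_mul_eq0; rewrite !mxE /=; split=> //; lia.
  rewrite rank_col1; first by rewrite /=; move: (ltn_ord v); lia.
  by apply/eqP => /quad_mul_eq0[/(_ av)/eqP]; rewrite mxE /= oner_eq0.
- move=> v; rewrite -!/(std F n _) -[vdim (W _ _ a n) v]/(vdim (std F n (Seg a n)) v).
  rewrite -[vdim (W _ _ c n) v]/(vdim (std F n (Seg c n)) v).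
  rewrite -[vdim (U _ _ c a) v]/(vdim (std F n (Quad c a)) v) !vdim_std /=.
  by move: (ltn_ord v); lia.
Qed.

End SegInQuad.

Lemma hall_number_seg_quad (F : finFieldType) n a b c d l m :
  valid n (Seg a b) -> valid n (Seg c d) -> valid n (Quad l m) ->
  hall_number (std F n (Seg a b)) (std F n (Seg c d)) (std F n (Quad l m)) =
    [&& b == n, d == n, l == c & m == a].
Proof.
move=> vx vy vz; have [E|ne] := boolP [&& b == n, d == n, l == c & m == a]; last first.
  apply: hall_number_eq0 => f g S; case/negP: ne.
  by have [[bE dE lE mE] _] := ses_seg_seg_quad vx vy vz S; apply/and4P; split; apply/eqP.
case/and4P: E => /eqP bE /eqP dE /eqP lE /eqP mE; subst b d l m.
have /andP[cn an] := vz.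
have [f0 [g0 [S0 E0]]] := quad_seg_ses F an cn.
transitivity #|[set: unit]|; last by rewrite cardsT card_unit.
apply: (@hall_number_count F n _ _ _ (fun=> 2%N) (U_th F c a) _ _
   _ (fun _ v => seg_flag F (c <= v.+1 <= n)%N *m delta_mx 0 1)).
- by move=> v; apply: row_free_quad_flag; rewrite /= U_dimE; lia.
- by move=> _ _; exists f0, g0; split=> // v; rewrite E0.
- move=> f g S; exists tt => // v.
  have [_ [p p0 ->]] := ses_seg_seg_quad vx vy vz S.
  by rewrite -scalemxAr; apply: eqmx_scale.
- by move=> [] [].
Qed.

(** * Submodules U_{l,m} of U_{c,d} whose quotient is a segment *)

Section QuadInQuad.
Variables (F : fieldType) (n : nat).

(* The submodules of [Quad c d] isomorphic to [Quad l m] are the images of the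
   matrices [upper 1 r]; the quotient map to [Seg a b] is given by the functional
   (s0, s1) on the span of e_1 and e_2. *)
Definition quad_cond a b l m c d (r s0 s1 : F) : Prop :=
 [/\ forall v, (1 <= v <= n)%N -> (m <= v)%N -> (d <= v)%N /\ ((c <= v)%N \/ r = 0),
     forall v, (1 <= v <= n)%N -> (l <= v)%N -> (c <= v)%N,
     forall v, (1 <= v <= b)%N -> (v < a)%N ->
       ((d <= v)%N -> s0 = 0) /\ ((c <= v)%N -> s1 = 0),
     forall v, (a <= v <= b)%N -> ~ (((d <= v)%N -> s0 = 0) /\ ((c <= v)%N -> s1 = 0)) &
     forall v, (1 <= v <= b)%N ->
       ((m <= v)%N -> s0 + r * s1 = 0) /\ ((l <= v)%N -> s1 = 0)].

Lemma ord_of x : (1 <= x <= n)%N -> exists v : 'I_n, v.+1 = x.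
Proof.
move=> xn; have xn' : (x.-1 < n)%N by lia.
by exists (Ordinal xn'); rewrite /= prednK //; lia.
Qed.

Lemma upper_col r (psi : 'cV[F]_2) :
  (upper 1 r *m psi) 0 0 = psi 0 0 + r * psi 1 0 /\ (upper 1 r *m psi) 1 0 = psi 1 0.
Proof.
by split; rewrite mxE sum_I2 !mxE /= !(mulr0n, mulr1n, mulr0, mulr1, mul0r, mul1r, add0r,
  addr0).
Qed.

(** At the last vertex both representations are the whole plane, so phi is invertible; with scalar
    part 0 it would have square 0. *)
Lemma quad_mono l m c d f : valid n (Quad l m) -> valid n (Quad c d) ->
  @is_hom F n (std F n (Quad l m)) (std F n (Quad c d)) f -> (forall v, row_free (f v)) ->
  exists p r, p != 0 /\ forall v, f v *m U_th F c d v = U_th F l m v *m upper p r.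
Proof.
move=> /andP[ln mn] /andP[cn dn] hf ff; have n0 : (n.-1 < n)%N by lia.
pose t := Ordinal n0; have tn : t.+1 = n by rewrite /= prednK //; lia.
have flM : flag (M := U F n c d) t (U_th F c d) (sq_nil F) by apply: U_flag.
have flY : flag (M := U F n l m) t (U_th F l m) (sq_nil F) by apply: U_flag.
have le_t (v : 'I_n) : (v <= t)%N by move: (ltn_ord v) => /=; lia.
have [phi [fE /(_ erefl) /sq_nil_comm phiE]] := hom_flag flY flM (leqnn t) hf.
have [frM _ _ _] := flM.
exists (phi 0 0), (phi 0 1); split; last by move=> v; rewrite fE // {1}phiE.
apply/eqP => p0; have phi2 : phi *m phi = 0.
  by rewrite phiE p0 -scalemx1 scale0r add0r -scalemxAl -scalemxAr sq_nil2 !scaler0.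
have fphi : row_free phi.
  have : row_free (f t *m U_th F c d t) by apply: row_freeM.
  rewrite fE // /row_free => /eqP rk.
  have dt : vdim (U F n l m) t = 2%N.
    by rewrite -[LHS]/(vdim (std F n (Quad l m)) t) vdim_std tn /=; clear - ln mn; lia.
  by rewrite eqn_leq rank_leq_row /= -{1}dt -rk mxrankM_maxr.
move: phi2; rewrite -[RHS](mul0mx _ phi) => /(row_free_cancel fphi) z.
by have := row_free_eq0 fphi z.
Qed.

Lemma quad_mono_le l m c d f : valid n (Quad l m) -> valid n (Quad c d) ->
  @is_hom F n (std F n (Quad l m)) (std F n (Quad c d)) f -> (forall v, row_free (f v)) ->
  (c <= l)%N /\ (d <= m)%N.
Proof.
move=> vy vz hf ff; have [p [r [p0 fE]]] := quad_mono vy vz hf ff.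
have subE (v : 'I_n) : (U_th F l m v *m upper p r <= U_th F c d v)%MS.
  by rewrite -fE submxMl.
have /andP[ln mn] := vy; split.
  have [v vx] := ord_of ln; have [_] := sub_upper_inv p0 (subE v).
  by rewrite vx; apply.
have [v vx] := ord_of mn; have [+ _] := sub_upper_inv p0 (subE v).
by rewrite vx => /(_ (leqnn m))[].
Qed.

(** Dimension vectors separate all labels except [Quad i j] and [Quad j i]; for these, the
    embeddings in both directions compare the indices one by one. *)
Lemma std_isom_eq x y : valid n x -> valid n y -> isom (std F n x) (std F n y) -> x = y.
Proof.
move=> vx vy i; have D k : (1 <= k <= n)%N -> dim_std x k = dim_std y k.
  by move=> /ord_of[v <-]; rewrite -!(vdim_std F); apply: isom_vdim.
case: x y vx vy i D => [a b|a b] [c d|c d] vx vy i D.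
- have /andP[ab bn] := vx; have /andP[cd dn] := vy; rewrite /= in D.
  have Da := D a; have Db := D b; have Dc := D c; have Dd := D d.
  have ha : (c <= a <= d)%N by clear - Da ab bn; lia.
  have hb : (c <= b <= d)%N by clear - Db ab bn; lia.
  have hc : (a <= c <= b)%N by clear - Dc cd dn; lia.
  have hd : (a <= d <= b)%N by clear - Dd cd dn; lia.
  by congr Seg; clear - ha hb hc hd; lia.
- have /andP[ab bn] := vx; have /andP[cd dn] := vy; have := D n; rewrite /=.
  by clear - ab bn cd dn; lia.
- have /andP[ab bn] := vx; have /andP[cd dn] := vy; have := D n; rewrite /=.
  by clear - ab bn cd dn; lia.
- have [f [g [hf hg fg gf]]] := i.
  have ff v : row_free (f v).
    by apply: (@row_free_Ml _ _ _ _ _ (g v)); rewrite fg row_free_unit unitmx1.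
  have fg' v : row_free (g v).
    by apply: (@row_free_Ml _ _ _ _ _ (f v)); rewrite gf row_free_unit unitmx1.
  have [h1 h2] := quad_mono_le vx vy hf ff; have [h3 h4] := quad_mono_le vy vx hg fg'.
  by congr Quad; clear - h1 h2 h3 h4; lia.
Qed.

(** Dividing the embedding by its scalar part p keeps the image and normalises it to
    [upper 1 (r' / p)]. The clauses of [quad_cond] express that the image lies in U_{c,d} (the first
    two), that the functional vanishes where the quotient is 0, that it does not where the quotient
    is a line, and that it kills the image. *)
Lemma ses_seg_quad_quad a b l m c d f g :
  valid n (Seg a b) -> valid n (Quad l m) -> valid n (Quad c d) ->
  @ses F n (std F n (Quad l m)) (std F n (Quad c d)) (std F n (Seg a b)) f g ->
  (b < n)%N /\ exists r s0 s1, quad_cond a b l m c d r s0 s1 /\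
    forall v, (f v *m U_th F c d v :=: U_th F l m v *m upper 1%R r)%MS.
Proof.
move=> /andP[ab bn] vy vz S; have /andP[ln mn] := vy; have /andP[cn dn] := vz.
have D := ses_dim_std S; have bn' : (b < n)%N.
  by have := D n; rewrite /=; clear - ab bn ln mn cn dn; lia.
split=> //; have n0 : (n.-1 < n)%N by lia.
have b0 : (b.-1 < n)%N by lia.
pose t := Ordinal n0; have tn : t.+1 = n by rewrite /= prednK //; lia.
pose t' := Ordinal b0; have tb : t'.+1 = b by rewrite /= prednK //; lia.
have flM : flag (M := U F n c d) t (U_th F c d) (sq_nil F) by apply: U_flag.
have flX : flag (M := W F n a b) t' (fun v => seg_flag F (a <= v.+1 <= b)%N) 0.
  exact: W_flag.
have [hf hg ff gf K] := S.
have le_t (v : 'I_n) : (v <= t)%N by move: (ltn_ord v) => /=; lia.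
have [p [r' [p0 fE]]] := quad_mono vy vz hf ff.
have [psi [gE _]] := hom_flag flM flX (le_t t') hg.
have [frX _ _ _] := flX.
have phiE : upper p r' = p *: upper 1 (r' / p) by rewrite -upper_scale.
have fE' v : (f v *m U_th F c d v :=: U_th F l m v *m upper 1%R (r' / p))%MS.
  by rewrite fE // phiE -scalemxAr; apply: eqmx_scale.
exists (r' / p), (psi 0 0), (psi 1 0); split; last exact: fE'.
have subE (v : 'I_n) : (U_th F l m v *m upper 1%R (r' / p) <= U_th F c d v)%MS.
  by rewrite (eqmx_sym (fE' v)) submxMl.
have vX v : vdim (std F n (Seg a b)) v = (a <= v.+1 <= b)%N by [].
split.
- move=> x /ord_of[v vx]; have [H _] := sub_upper_inv (oner_neq0 F) (subE v).
  by rewrite vx in H.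
- move=> x /ord_of[v vx]; have [_ H] := sub_upper_inv (oner_neq0 F) (subE v).
  by rewrite vx in H.
- move=> x xb xa; have [|v vx] := @ord_of x; first by clear - xb bn; lia.
  subst x; apply/quad_mul_eq0; rewrite -gE; last by rewrite /=; clear - xb; lia.
  rewrite [X in X *m _](eq_mx_col0 (g v) 0) ?mul0mx //.
  by rewrite vX; clear - xa; lia.
- move=> x xb; have [|v vx] := @ord_of x; first by clear - xb bn ab; lia.
  subst x => /quad_mul_eq0; rewrite -gE; last by rewrite /=; clear - xb; lia.
  rewrite -[RHS](mul0mx _ (seg_flag F (a <= v.+1 <= b)%N)) => /(row_free_cancel (frX v)) gv.
  by have := gf v; rewrite /row_full gv mxrank0 vX xb.
- move=> x xb; have [|v vx] := @ord_of x; first by clear - xb bn; lia.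
  subst x; have [<- <-] := upper_col (r' / p) psi; apply/quad_mul_eq0.
  apply: (scalerI p0); rewrite scaler0 scalemxAr scalemxAl -phiE mulmxA -fE // -mulmxA.
  rewrite -gE; last by rewrite /=; clear - xb; lia.
  by rewrite mulmxA (ses_mul S) mul0mx.
Qed.

Lemma seg_quad_quad_ses a b l m c d r s0 s1 :
  valid n (Seg a b) -> valid n (Quad l m) -> valid n (Quad c d) -> (b < n)%N ->
  (forall k, (1 <= k <= n)%N ->
     dim_std (Quad c d) k = dim_std (Quad l m) k + dim_std (Seg a b) k)%N ->
  quad_cond a b l m c d r s0 s1 ->
  exists f g, @ses F n (std F n (Quad l m)) (std F n (Quad c d)) (std F n (Seg a b)) f g /\
    forall v, f v *m U_th F c d v = U_th F l m v *m upper 1 r.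
Proof.
move=> /andP[ab bn] /andP[ln mn] /andP[cn dn] bn' D [G1 G2 G3 G4 G5].
have n0 : (n.-1 < n)%N by lia.
have b0 : (b.-1 < n)%N by lia.
pose t := Ordinal n0; have tn : t.+1 = n by rewrite /= prednK //; lia.
pose t' := Ordinal b0; have tb : t'.+1 = b by rewrite /= prednK //; lia.
have flM : flag (M := U F n c d) t (U_th F c d) (sq_nil F) by apply: U_flag.
have flY : flag (M := U F n l m) t (U_th F l m) (sq_nil F) by apply: U_flag.
have flX : flag (M := W F n a b) t' (fun v => seg_flag F (a <= v.+1 <= b)%N) 0.
  exact: W_flag.
pose psi : 'cV[F]_2 := \col_i (if i == 0 then s0 else s1).
have psi0 : psi 0 0 = s0 by rewrite mxE.
have psi1 : psi 1 0 = s1 by rewrite mxE.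
apply: (flag_ses (phi := upper 1 r) (psi := psi) flY flM flX).
- by rewrite /=; clear - bn; lia.
- move=> v _; apply: sub_upper; [apply: G1|apply: G2]; by move: (ltn_ord v); clear; lia.
- exact: upper_comm.
- exact: upper_free (oner_neq0 F).
- move=> v vt; apply: sub_seg_flag.
  have [av|av] := leqP a v.+1; first by left; move: vt av; rewrite /=; clear - ab; lia.
  right; apply/quad_mul_eq0; rewrite psi0 psi1; apply: G3 => //.
  by move: vt; rewrite /=; clear - ab; lia.
- by move=> /(congr1 val) /=; clear - bn' ab; lia.
- move=> v vt; rewrite -mulmxA; apply/quad_mul_eq0.
  have [-> ->] := upper_col r psi; rewrite psi0 psi1; apply: G5.
  by move: vt; rewrite /=; clear - ab; lia.
- move=> v vt; have [av|av] := leqP a v.+1.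
    rewrite rank_col1; first by move: vt; rewrite /=; clear - ab av; lia.
    apply/eqP => /quad_mul_eq0; rewrite psi0 psi1; apply: G4.
    by move: vt; rewrite /=; clear - ab av; lia.
  rewrite (_ : U_th F c d v *m psi = 0) ?mxrank0 /=; first by clear - av; lia.
  apply/quad_mul_eq0; rewrite psi0 psi1; apply: G3 => //.
  by move: vt; rewrite /=; clear - ab; lia.
- move=> v; have := D v.+1; rewrite -!(vdim_std F) /=; apply.
  by move: (ltn_ord v); clear; lia.
Qed.

(** The hypothesis on dimensions makes the half-open interval [a, b+1) the disjoint union of [c, l)
    and [d, m). Either one of these is empty, or they are adjacent in one of two orders. *)
Lemma interval_split a b l m c d :
  (1 <= a <= b)%N -> (b < n)%N -> (1 <= c <= l)%N -> (l <= n)%N -> (1 <= d <= m)%N -> (m <=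
    n)%N ->
  (forall k, (1 <= k <= n)%N -> ((d <= k) + (c <= k) = (m <= k) + (l <= k) + (a <= k <=
    b))%N) ->
  [\/ [/\ c = l, d = a & m = b.+1], [/\ d = m, c = a & l = b.+1],
      [/\ c = a, l = d, m = b.+1, (c < l)%N & (d < m)%N] |
      [/\ d = a, m = c, l = b.+1, (c < l)%N & (d < m)%N]].
Proof.
move=> ab bn cl ln dm mn D.
have E k : (1 <= k <= n)%N -> ((c <= k < l) + (d <= k < m) = (a <= k <= b))%N.
  by move=> kn; have := D k kn; clear - cl dm; lia.
have Ea : ((c <= a < l) + (d <= a < m) = 1)%N.
  by rewrite E; clear - ab bn; lia.
have Eb : ((c <= b < l) + (d <= b < m) = 1)%N.
  by rewrite E; clear - ab bn; lia.
have Eb1 : ((c <= b.+1 < l) + (d <= b.+1 < m) = 0)%N.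
  by rewrite E; clear - ab bn; lia.
have Ec : (c < l)%N -> (a <= c <= b)%N /\ ~~ (d <= c < m)%N.
  by move=> cl'; have := E c; clear - cl' cl ln; lia.
have Ed : (d < m)%N -> (a <= d <= b)%N /\ ~~ (c <= d < l)%N.
  by move=> dm'; have := E d; clear - dm' dm mn; lia.
have [clE|cl'] : c = l \/ (c < l)%N by clear - cl; lia.
  have dm' : (d < m)%N by clear - Ea clE; lia.
  by apply: Or41; have [h _] := Ed dm'; clear - h Ea Eb Eb1 clE; split; lia.
have [dmE|dm'] : d = m \/ (d < m)%N by clear - dm; lia.
  by apply: Or42; have [h _] := Ec cl'; clear - h Ea Eb Eb1 dmE; split; lia.
have [h1 h2] := Ec cl'; have [h3 h4] := Ed dm'.
have [cd|cd] : (c < d)%N \/ (d < c)%N by clear - h2 h4 cl' dm'; lia.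
  have ld : (l <= d)%N by clear - h4 cd; lia.
  have ca : c = a by clear - Ea h1 cd; lia.
  have bm : m = b.+1 by clear - Eb Eb1 ld h3; lia.
  apply: Or43; split=> //; apply/eqP; rewrite eqn_leq ld /= leqNgt; apply/negP => ld'.
  by have := E l; clear - ld' cl' ca h3 ln ab; lia.
have mc : (m <= c)%N by clear - h2 cd; lia.
have da : d = a by clear - Ea h3 cd; lia.
have bl : l = b.+1 by clear - Eb Eb1 mc h1; lia.
apply: Or44; split=> //; apply/eqP; rewrite eqn_leq mc /= leqNgt; apply/negP => mc'.
by have := E m; clear - mc' dm' da h1 mn ab; lia.
Qed.

(** The parameter r is visible only where e_1 has entered U_{l,m} and e_2 has not; with both present
    the image is the whole plane. *)
Lemma upper_image_eq l m (v : 'I_n) r r' :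
  ((m <= v.+1)%N -> (l <= v.+1)%N \/ r = r') ->
  (U_th F l m v *m upper 1%R r :=: U_th F l m v *m upper 1%R r')%MS.
Proof.
move=> H; apply: (eqmx_trans (quad_mul _ _ _ _));
  apply: eqmx_trans (eqmx_sym (quad_mul _ _ _ _)).
case: (leqP m v.+1) H => [_ /(_ isT)[->|->]//|_ _].
  have -> : axes F true true = 1%:M by apply: matrix2P; rewrite !mxE.
  rewrite !mul1mx; apply/eqmxP/andP; split; apply: submx_full;
  by rewrite row_full_unit -row_free_unit; apply: upper_free (oner_neq0 F).
by have -> : axes F false (l <= v.+1)%N *m upper 1 r = axes F false (l <= v.+1)%N *m upper 1 r'
  by apply: matrix2P; rewrite !mxE !sum_I2 !mxE /= ?(mulr0n, mulr1n, mulr0, mul0r, add0r,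
    addr0).
Qed.

Lemma upper_image_inj l m (v : 'I_n) r r' : (m <= v.+1)%N -> (v.+1 < l)%N ->
  (U_th F l m v *m upper 1%R r :=: U_th F l m v *m upper 1%R r')%MS -> r = r'.
Proof.
move=> mv vl E; have : (U_th F l m v *m upper 1%R r <= U_th F l m v *m upper 1%R r')%MS by
  rewrite E.
rewrite !quad_mul mv leqNgt vl /= => /submxP[C /matrixP CE].
have := CE 0 0; have := CE 0 1; rewrite !mxE !sum_I2 !mxE !sum_I2 !mxE /=.
rewrite !(mulr0n, mulr1n, mulr0, mulr1, mul1r, mul0r, add0r, addr0).
by move=> -> <-; rewrite mul1r.
Qed.

End QuadInQuad.

Section HallNumberQuad.
Variables (F : finFieldType) (n a b l m c d : nat).
Hypotheses (vx : valid n (Seg a b)) (vy : valid n (Quad l m)) (vz : valid n (Quad c d)).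

(** A parameter may be replaced by one of S when the two differ only where r is invisible. The
    condition m < l provides a vertex, namely m, at which r is determined by the image. *)
Lemma hall_number_quad_count (S : {set F}) : (b < n)%N ->
  (forall k, (1 <= k <= n)%N -> ((d <= k) + (c <= k) = (m <= k) + (l <= k) + (a <= k <=
    b))%N) ->
  (forall r, r \in S -> exists s0 s1, quad_cond n a b l m c d r s0 s1) ->
  (forall r s0 s1, quad_cond n a b l m c d r s0 s1 ->
     exists2 r', r' \in S & forall v, (m <= v)%N -> (l <= v)%N \/ r = r') ->
  (forall r r', r \in S -> r' \in S -> r = r' \/ (m < l)%N) ->
  hall_number (std F n (Seg a b)) (std F n (Quad l m)) (std F n (Quad c d)) = #|S|.
Proof.
move=> bn D inS outS injS.
apply: (@hall_number_count F n _ _ _ (fun=> 2%N) (U_th F c d) _ _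
   _ (fun r v => U_th F l m v *m upper 1 r)).
- by move=> v; apply: row_free_quad_flag; rewrite /= U_dimE; lia.
- move=> r /inS[s0 [s1 Q]].
  have [f [g [sfg E]]] := seg_quad_quad_ses vx vy vz bn D Q.
  by exists f, g; split=> // v; rewrite E.
- move=> f g sfg; have [_ [r [s0 [s1 [Q E]]]]] := ses_seg_quad_quad vx vy vz sfg.
  have [r' r'S H] := outS _ _ _ Q; exists r' => // v.
  apply: (eqmx_trans (E v)); apply: upper_image_eq; exact: H.
- move=> r r' rS r'S E; have [//|ml] := injS r r' rS r'S.
  have [|v vm] := @ord_of n m; first by have /andP[_ ->] := vy.
  by apply: (upper_image_inj _ _ (E v)); rewrite vm.
Qed.

End HallNumberQuad.

Lemma leq_interval a b k : (a <= b)%N -> ((a <= k) = (b < k) + (a <= k <= b) :> nat)%N.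
Proof. by move=> ab; case: (leqP a k); case: (leqP k b) => /=; lia. Qed.

(** In the first case only e_1 enters later in the submodule, and one image remains. In the second
    only e_2 does; r is free exactly if e_1 enters at a vertex m between a and b, where e_2 lies in
    the ambient module but not yet in the submodule. In the third the quotient identifies e_1 with a
    nonzero multiple of e_2, so r is nonzero. The remaining splitting of [interval_split] is
    contradictory. *)
Lemma hall_number_quad (F : finFieldType) n a b l m c d :
  valid n (Seg a b) -> valid n (Quad l m) -> valid n (Quad c d) ->
  hall_number (std F n (Seg a b)) (std F n (Quad l m)) (std F n (Quad c d)) =
  if [&& c == l, d == a & m == b.+1] then 1%N
  else if [&& d == m, c == a & l == b.+1] then (if (a <= m <= b)%N then #|F| else 1%N)
  else if [&& d == a, m == c, l == b.+1, (c < l)%N & (d < m)%N] then #|F|.-1 else 0%N.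
Proof.
move=> vx vy vz; have /andP[ab bn] := vx; have /andP[ln mn] := vy; have /andP[cn dn] := vz.
case: ifPn => [/and3P[/eqP cE /eqP dE /eqP mE]|notA].
  subst c d m; rewrite -(cards1 (0 : F)); apply: hall_number_quad_count => //.
  - by move=> k kn; rewrite (@leq_interval a b k) //; [rewrite /=; lia|case/andP: ab].
  - move=> r /set1P ->; exists 1, 0; split=> v vn; rewrite ?(mulr0, addr0).
    + by move=> bv; split; [clear - ab bv; lia|right].
    + by [].
    + by move=> va; split=> //; clear - va; lia.
    + by move=> [/(_ (proj1 (andP vn)))/eqP]; rewrite oner_eq0.
    + by split=> // bv; clear - vn bv; lia.
  - move=> r s0 s1 [G1 _ _ _ _]; exists 0; first exact/set1P.
    move=> v bv; have [vn|vn] := leqP v n; last by left; clear - vn ln; lia.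
    by have [|_ []] := G1 v _ bv; [clear - bv vn; lia|left|right].
  - by move=> r r' /set1P -> /set1P ->; left.
case: ifPn => [/and3P[/eqP dE /eqP cE /eqP lE]|notB].
  subst d c l; have [amb|amb] := boolP (a <= m <= b)%N; last rewrite -(cards1 (0 : F));
    last first.
    apply: hall_number_quad_count => //.
    - by move=> k kn; rewrite (@leq_interval a b k) //; [rewrite /=; lia|case/andP: ab].
    - move=> r /set1P ->; exists 0, 1; split=> v vn; rewrite ?(mul0r, addr0).
      + by move=> bv; split=> //; right.
      + by move=> bv; clear - ab bv; lia.
      + by move=> va; split=> //; clear - va; lia.
      + by move=> [_ /(_ (proj1 (andP vn)))/eqP]; rewrite oner_eq0.
      + by split=> // bv; clear - vn bv; lia.
    - move=> r s0 s1 [G1 _ _ _ _]; exists 0; first exact/set1P.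
      have [ma|ma] := ltnP m a; last by move=> v mv; left; clear - mv ma amb; lia.
      have [_ [am|->]] := G1 m mn (leqnn m); last by move=> v _; right.
      by clear - am ma; lia.
    - by move=> r r' /set1P -> /set1P ->; left.
  rewrite -cardsT; apply: hall_number_quad_count => //.
  - by move=> k kn; rewrite (@leq_interval a b k) //; [rewrite /=; lia|case/andP: ab].
  (* The functional (-r, 1) kills e_1 + r e_2. *)
  - move=> r _; exists (- r), 1; split=> v vn; rewrite ?mulr1.
    + by move=> bv; split=> //; left; clear - bv amb; lia.
    + by move=> bv; clear - ab bv; lia.
    + by move=> va; split; [clear - va amb|clear - va]; lia.
    + by move=> [_ /(_ (proj1 (andP vn)))/eqP]; rewrite oner_eq0.
    + by rewrite addNr; split=> // bv; clear - vn bv; lia.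
  - by move=> r s0 s1 _; exists r; rewrite ?inE // => v _; right.
  - by move=> r r' _ _; right; clear - amb; lia.
case: ifPn => [/and5P[/eqP dE /eqP mE /eqP lE cl dm]|notC].
  subst d m l; rewrite -[#|F|.-1](_ : #|[set r : F | r != 0]| = _); last first.
    by rewrite (cardsE (predC1 (0 : F))) cardC1.
  apply: hall_number_quad_count => //.
  - by move=> k kn; rewrite (@leq_interval a b k) //; [rewrite /=; lia|case/andP: ab].
  (* The functional (1, -1/r) kills e_1 + r e_2 and is nonzero on e_1, the only basis vector present
     at a. *)
  - move=> r; rewrite inE => r0; exists 1, (- r^-1); split=> v vn.
    + by move=> bv; split; [clear - bv dm; lia|left].
    + by move=> bv; clear - cl bv; lia.
    + by move=> va; split; clear - va dm; lia.
    + by move=> [/(_ (proj1 (andP vn)))/eqP]; rewrite oner_eq0.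
    + by rewrite mulrN mulfV // subrr; split=> // bv; clear - vn bv; lia.
  - move=> r s0 s1 [_ _ _ G4 G5]; exists r; last by move=> v _; right.
    rewrite inE; apply/eqP => r0.
    have [|/(_ (leqnn c))] := G5 c; first by clear - cl cn; lia.
    rewrite r0 mul0r addr0 => s00 _.
    case: (G4 a); first by rewrite leqnn; have /andP[] := ab.
    by split=> // ca; clear - ca dm; lia.
  - by move=> r r' _ _; right.
apply: hall_number_eq0 => f g S.
have [bn' [r [s0 [s1 [[G1 G2 G3 G4 G5] _]]]]] := ses_seg_quad_quad vx vy vz S.
have cl : (c <= l)%N by apply: G2.
have dm : (d <= m)%N by have [] := G1 m mn (leqnn m).
have D := ses_dim_std S; rewrite /= in D.
have := @interval_split n a b l m c d ab bn' _ _ _ _ D.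
case; rewrite ?cl ?dm ?andbT //.
- by have /andP[] := cn.
- by have /andP[] := ln.
- by have /andP[] := dn.
- by have /andP[] := mn.
- by move=> [cE dE mE]; rewrite cE dE mE !eqxx in notA.
- by move=> [cE dE mE]; rewrite cE dE mE !eqxx in notB.
(* The submodule contains e_2 at the vertex l <= b, so the functional kills e_2; but e_2 is the only
   basis vector present at a, where the quotient is a line. *)
- move=> [cE lE mE cl' dm'].
  have s10 : s1 = 0.
    have [|_] := G5 l; first by clear - lE dm' mE ln; lia.
    by apply.
  case: (G4 a); first by rewrite leqnn; have /andP[] := ab.
  by split=> // da; clear - da lE cl' cE; lia.
- by move=> [dE mE lE cl' dm']; rewrite dE mE lE !eqxx -lE cl' -mE -dE dm' in notC.
Qed.

(** * The degenerate Hall algebra *)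

(* The indecomposable middle terms of the product [x][y] at q = 1. *)
Definition mul_terms n x y : seq label :=
  match x, y with
  | Seg a b, Seg c d =>
      nseq (b.+1 == c) (Seg a d) ++ nseq ((b == n) && (d == n)) (Quad c a)
  | Seg a b, Quad l m => nseq (b.+1 == m) (Quad l a) ++ nseq (b.+1 == l) (Quad a m)
  | _, _ => [::]
  end.

Definition label_code l : bool * nat * nat :=
  match l with Seg i j => (true, i, j) | Quad i j => (false, i, j) end.
Definition label_decode c : label := let: (b, i, j) := c in if b then Seg i j else Quad i j.
Lemma label_codeK : cancel label_code label_decode. Proof. by case. Qed.
HB.instance Definition _ := Equality.copy label (can_type label_codeK).

Lemma eq_Seg a b c d : (Seg a b == Seg c d) = (a == c) && (b == d).
Proof. by apply/eqP/andP => [[-> ->]|[/eqP-> /eqP->]]. Qed.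

Lemma eq_Quad a b c d : (Quad a b == Quad c d) = (a == c) && (b == d).
Proof. by apply/eqP/andP => [[-> ->]|[/eqP-> /eqP->]]. Qed.

Lemma eq_Seg_Quad a b c d : (Seg a b == Quad c d) = false.
Proof. by apply/eqP. Qed.

Lemma eq_Quad_Seg a b c d : (Quad a b == Seg c d) = false.
Proof. by apply/eqP. Qed.

Definition eq_label := (eq_Seg, eq_Quad, eq_Seg_Quad, eq_Quad_Seg).

Lemma mem_nseqb (T : eqType) (b : bool) (x y : T) : (y \in nseq b x) = b && (y == x).
Proof. by rewrite mem_nseq lt0b. Qed.

(** * Structure constants of the standard modules *)

Section StandardValues.
Variables (K : finFieldType) (n : nat).

Notation value X Y M := (hall_poly X Y M).[1].

Lemma is_hall_poly_isom (X Y M X' Y' M' : amod K n) p :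
  isom X X' -> isom Y Y' -> isom M M' -> is_hall_poly X Y M p -> is_hall_poly X' Y' M' p.
Proof.
move=> iX iY iM H E iota co; rewrite (H E iota co); congr (_%:R).
by apply: hall_number_isom; apply: extend_isom.
Qed.

Lemma hall_poly_isom (X Y M X' Y' M' : amod K n) :
  isom X X' -> isom Y Y' -> isom M M' -> hall_poly X Y M = hall_poly X' Y' M'.
Proof.
move=> iX iY iM; rewrite /hall_poly; congr (xget 0 _); apply/seteqP; split=> p /=.
  exact: is_hall_poly_isom.
by apply: is_hall_poly_isom; apply: isom_sym.
Qed.

Lemma value_std x y z : valid n x -> valid n y -> valid n z ->
  value (std K n x) (std K n y) (std K n z) = (z \in mul_terms n x y)%:R.
Proof.
have top w : valid n w -> dim_std w n = (if w is Seg i j then (j == n) : nat else 2%N).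
  by case: w => i j /andP[] /=; clear; lia.
move=> vx vy vz.
have zero : (forall (E : finFieldType) f g,
      ~ @ses E n (std E n y) (std E n z) (std E n x) f g) ->
    value (std K n x) (std K n y) (std K n z) = 0.
  move=> no; apply: hall_poly_eq0 => E iota; rewrite !extend_std hall_number_eq0 ?dvdn0 //.
have n0 : (1 <= n <= n)%N.
  by case: (x) vx => i j /andP[] /=; clear; lia.
(* At the last vertex a segment has dimension at most 1 and U_{i,j} has dimension 2. Additivity
   there leaves four patterns of types. *)
case: x y z vx vy vz zero => [a b|a b] [c d|c d] [i m|i m] vx vy vz zero;
  rewrite [mul_terms _ _ _]/= ?in_nil; try by rewrite ?(mem_cat, mem_nseqb, eq_label, andbF);
    apply: zero => E f g /ses_dim_std/(_ n n0);
    rewrite !top //=; clear; lia.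
- rewrite (@hall_poly_eq1 _ _ _ _ _ ([&& a == i, d == m & b.+1 == c]%:R)%:P).
    rewrite hornerC mem_cat !mem_nseqb !eq_label andbF orbF; congr ((nat_of_bool _)%:R).
    by rewrite [RHS]andbC -andbA (eq_sym a) (eq_sym d).
  by move=> E iota _; rewrite !extend_std hornerC hall_number_seg.
- rewrite (@hall_poly_eq1 _ _ _ _ _ ([&& b == n, d == n, i == c & m == a]%:R)%:P).
    by rewrite hornerC mem_cat !mem_nseqb !eq_label andbF orFb -andbA.
  by move=> E iota _; rewrite !extend_std hornerC hall_number_seg_quad.
- have /andP[ab bn] := vx.
  pose p : {poly int} := if [&& i == c, m == a & d == b.+1] then 1
    else if [&& m == d, i == a & c == b.+1] then (if (a <= d <= b)%N then 'X else 1)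
    else if [&& m == a, d == i, c == b.+1, (i < c)%N & (m < d)%N] then 'X - 1 else 0.
  rewrite (@hall_poly_eq1 _ _ _ _ _ p); last first.
    move=> E iota _; rewrite !extend_std hall_number_quad // /p.
    have q0 := ltnW (finNzRing_gt1 E).
    do 2![case: ifP => _; first by rewrite ?(fun_if (fun P : {poly int} => P.[_])) ?hornerE
      //; case: ifP].
    case: ifP => _; last by rewrite horner0.
    by rewrite !hornerE -[in LHS](prednK q0) -natr1 addrK.
  rewrite mem_cat !mem_nseqb !eq_label /p.
  case: ifPn => [/and3P[iE mE dE]|notA].
    by rewrite hornerE (eq_sym b.+1 d) dE iE mE.
  case: ifPn => [/and3P[mE iE cE]|notB].
    by rewrite (eq_sym b.+1 c) cE iE mE orbT; case: ifP; rewrite !hornerE.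
  have -> : [&& b.+1 == d, i == c & m == a] || [&& b.+1 == c, i == a & m == d] = false.
    apply/negbTE; rewrite negb_or; apply/andP; split.
      by apply: contra notA => /and3P[dE -> ->]; rewrite eq_sym.
    by apply: contra notB => /and3P[dE -> ->]; rewrite eq_sym.
  by case: ifP; rewrite !hornerE ?subrr.
(* Dimensions at n only give d < n here; this contradicts [ses_top], by which the segment reaches
   the last vertex. *)
- apply: zero => E f g S; have /andP[cd dn] := vy; have /andP[_ _] := vx.
  have n1 : (n.-1 < n)%N by case/andP: n0; clear; lia.
  have d1 : (d.-1 < n)%N by clear - cd dn; lia.
  have flM : flag (M := U E n i m) (Ordinal n1) (U_th E i m) (sq_nil E).
    by have /andP[] := vz => ? ?; apply: U_flag => //=; clear - n1; lia.
  have flY : flag (M := W E n c d) (Ordinal d1) (fun v => seg_flag E (c <= v.+1 <= d)%N) 0.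
    by apply: W_flag => //=; clear - cd; lia.
  have /(congr1 val) /= dE := ses_top flY flM isT S.
  have := ses_dim_std S n0; rewrite !top //=; clear - dE cd dn n1; lia.
Qed.

Lemma extend_bound (E : finFieldType) (iota : {rmorphism K -> E}) (M : amod K n) :
  bound (extend iota M).
Proof. by move=> v vn; rewrite /= -map_mxM amodP // map_mx0. Qed.

(** Over K a standard summand splits off from M, and after extension it is a summand of the
    indecomposable [std E n l]. So the complement is zero, and the label of the summand is l. *)
Lemma extend_std_isom (E : finFieldType) (iota : {rmorphism K -> E}) l (M : amod K n) :
  valid n l -> isom (std E n l) (extend iota M) -> isom (std K n l) M.
Proof.
move=> vl i; have nE := nice_std E vl.
have nzM : ~ is_zero M.
  by move=> z; apply: (nice_nonzero nE) => v; rewrite (isom_vdim i) /=.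
have [l' [vl' [M' iM]]] := indecomposable_summand nzM.
pose ME := AMod (extend_bound iota M').
have iE : isom (std E n l) (dsum (std E n l') ME).
  apply: (isom_trans i); rewrite -(extend_std iota) -extend_dsum; exact: extend_isom.
have [_ dec] := nice_indec nE.
have [z|z] := dec _ _ iE; first by case: (nice_nonzero (nice_std E vl') z).
have ll' : l = l'.
  by apply: (std_isom_eq vl vl'); apply: isom_trans iE (isom_dsum0 _ z).
rewrite ll'; apply: isom_sym; apply: isom_trans iM _.
by apply: isom_dsum0 => v; apply: z.
Qed.

Section Pair.
Variables (x y : label).
Hypotheses (vx : valid n x) (vy : valid n y) (xy : x != y).

Lemma value_zero (M : amod K n) : is_zero M -> value (std K n x) (std K n y) M = 0.
Proof.
move=> z; apply: hall_poly_eq0 => E iota; rewrite hall_number_eq0 ?dvdn0 // => f g S.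
apply: (nice_nonzero (nice_std K vy)) => v.
have := ses_dim S v; rewrite /= z; lia.
Qed.

(** The torus argument applies over every E to the extended decomposition. Its two exceptional cases
    descend to K by [extend_std_isom], where they say that M is X (+) Y. *)
Lemma value_decomposable (M M' : amod K n) z : valid n z -> isom M (dsum (std K n z) M') ->
  ~ is_zero M' -> ~ isom M (dsum (std K n x) (std K n y)) ->
  value (std K n x) (std K n y) M = 0.
Proof.
move=> vz iM nz ne; apply: hall_poly_eq0 => E iota.
rewrite (hall_number_isom (isom_refl _) (isom_refl _) (extend_isom iota iM)).
rewrite extend_dsum !extend_std; apply: torus_dvd.
- exact: nice_std.
- exact: nice_std.
- exact: nice_nonzero (nice_std E vz).
- by move=> z0; apply: nz => v; apply: z0.
- move=> [/(std_isom_eq vy vz) yz /(extend_std_isom vx) xM].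
  apply: ne; apply: (isom_trans iM); rewrite -yz; apply: isom_trans (isom_dsumC _ _).
  by apply: isom_dsum; [exact: isom_refl|exact: isom_sym].
- move=> [/(extend_std_isom vy) yM /(std_isom_eq vx vz) xz].
  apply: ne; apply: (isom_trans iM); rewrite -xz.
  by apply: isom_dsum; [exact: isom_refl|exact: isom_sym].
Qed.

Lemma value_dsum :
  value (std K n x) (std K n y) (dsum_amod (std K n x) (std K n y)) = 1.
Proof.
rewrite (@hall_poly_eq1 _ _ _ _ _ 'X^(hom_dim (std K n y) (std K n x))).
  by rewrite hornerXn expr1n.
move=> E iota _; rewrite hornerXn extend_dsum !extend_std hall_number_split.
- by rewrite -!(extend_std iota) hom_set_card natrX.
- exact: nice_std.
- exact: nice_std.
- by move=> /(std_isom_eq vx vy) e; move: xy; rewrite e eqxx.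
Qed.

End Pair.

End StandardValues.

(** * Products and brackets of standard classes *)

Section Products.
Local Open Scope quotient_scope.
Variables (K : finFieldType) (n : nat).

Notation iso_pi M := (\pi_(isoclass K n) (M : amod K n)).

Lemma pi_isomP (M N : amod K n) : reflect (isom M N) (iso_pi M == iso_pi N).
Proof. by rewrite eqmodE; apply: asboolP. Qed.

Lemma pi_repr (M : amod K n) : isom (repr (iso_pi M)) M.
Proof. by apply/pi_isomP; rewrite reprK. Qed.

Lemma mul_terms_valid x y z : valid n x -> valid n y -> z \in mul_terms n x y -> valid n z.
Proof.
case: x y => [a b|a b] [c d|c d] // /andP[ab bn] /andP[cd dn];
  rewrite mem_cat !mem_nseqb => /orP[/andP[/eqP E /eqP->]|/andP[E /eqP->]]; rewrite /=.
- by lia.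
- by move: E => /andP[/eqP ? /eqP ?]; lia.
- by lia.
- by lia.
Qed.

Lemma mul_terms_uniq x y : valid n x -> valid n y -> uniq (mul_terms n x y).
Proof.
case: x y => [a b|a b] [c d|c d] // /andP[ab bn] /andP[cd dn] /=.
  by case: (b.+1 == c); case: ((b == n) && (d == n)).
case: eqP => [E|_]; case: eqP => [E'|_] //=; rewrite ?inE ?eq_label ?orbF ?andbT.
by apply/negP => /andP[/eqP]; lia.
Qed.

(** The list r carries the whole sum: a class outside it is zero, or decomposable and different from
    X (+) Y, or indecomposable but not among [mul_terms]. It has no repetitions, since X (+) Y is
    decomposable and a standard module determines its label. *)
Lemma isoclass_mul_std x y : valid n x -> valid n y -> x != y ->
  isoclass_mul (iso_pi (std K n x)) (iso_pi (std K n y)) =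
  << iso_pi (dsum_amod (std K n x) (std K n y)) >> +
    \sum_(z <- mul_terms n x y) cls (std K n z).
Proof.
move=> vx vy xy; set X := std K n x; set Y := std K n y.
pose s : seq (isoclass K n) := [seq iso_pi (std K n z) | z <- mul_terms n x y].
pose r := iso_pi (dsum_amod X Y) :: s.
have val c : (hall_poly (repr (iso_pi X)) (repr (iso_pi Y)) (repr c)).[1] =
    (hall_poly X Y (repr c)).[1].
  by rewrite (hall_poly_isom (pi_repr X) (pi_repr Y) (isom_refl _)).
have valM (M : amod K n) : (hall_poly (repr (iso_pi X)) (repr (iso_pi Y)) (repr (iso_pi
  M))).[1] =
    (hall_poly X Y M).[1].
  by rewrite (hall_poly_isom (pi_repr X) (pi_repr Y) (pi_repr M)).
have indec_dsum z : valid n z -> ~ isom (dsum X Y) (std K n z).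
  move=> vz /isom_sym i; have [_ dec] := nice_indec (nice_std K vz).
  by have [/nice_nonzero|/nice_nonzero] := dec _ _ i; apply; apply: nice_std.
have ur : uniq r.
  rewrite /= map_inj_in_uniq ?mul_terms_uniq ?andbT //.
    apply/mapP => -[z zin /eqP/pi_isomP i].
    by apply: (indec_dsum z) => //; apply: mul_terms_valid zin.
  move=> z z' zin zin' /eqP/pi_isomP; apply: std_isom_eq; exact: mul_terms_valid vx vy _.
rewrite /isoclass_mul (fsbigE r) //; last first.
  move=> c _; rewrite val => cr.
  suff -> : (hall_poly X Y (repr c)).[1] = 0 by rewrite scale0r.
  have [z0|nz] := pselect (is_zero (repr c)); first exact: value_zero.
  have [z [vz [M' iM]]] := indecomposable_summand nz.
  have [z0|nz'] := pselect (is_zero M'); last first.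
    apply: (value_decomposable vx vy vz iM nz') => i; move: cr.
    rewrite inE negb_or => /andP[/eqP h _]; apply: h; rewrite -[LHS]reprK.
    by apply/eqP/pi_isomP.
  have iz : isom (repr c) (std K n z) by apply: isom_trans iM (isom_dsum0 _ z0).
  rewrite (hall_poly_isom (isom_refl _) (isom_refl _) iz) value_std //.
  case: (boolP (z \in _)) => // zin; case/negP: cr; rewrite inE; apply/orP; right.
  apply/mapP; exists z => //; rewrite -[LHS]reprK.
  by apply/eqP/pi_isomP.
rewrite (eq_bigl xpredT) => [|c]; last by rewrite classical_sets.in_setT.
rewrite big_cons /= valM value_dsum // scale1r; congr (_ + _).
rewrite big_map big_seq [RHS]big_seq; apply: eq_bigr => z zin.
rewrite valM value_std ?zin ?scale1r //; exact: mul_terms_valid zin.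
Qed.

Lemma hall_mul_cls (X Y : amod K n) :
  hall_mul (cls X) (cls Y) = isoclass_mul (iso_pi X) (iso_pi Y).
Proof. by rewrite /hall_mul /cls !liftU !scale1r. Qed.

Definition std_bracket x y : hall_alg K n :=
  \sum_(z <- mul_terms n x y) cls (std K n z) - \sum_(z <- mul_terms n y x) cls (std K n z).

Lemma bracket_std x y : valid n x -> valid n y ->
  bracket (cls (std K n x)) (cls (std K n y)) = std_bracket x y.
Proof.
move=> vx vy; rewrite /bracket /std_bracket.
have [->|xy] := eqVneq x y; first by rewrite !subrr.
rewrite !hall_mul_cls !isoclass_mul_std // 1?eq_sym //.
have -> : iso_pi (dsum_amod (std K n y) (std K n x)) = iso_pi (dsum_amod (std K n x) (std K n
  y)).
  by apply/eqP/pi_isomP/isom_dsumC.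
by rewrite opprD addrACA subrr add0r.
Qed.

Lemma cls_isom (X Y : amod K n) : isom X Y -> cls X = cls Y.
Proof. by move=> i; rewrite /cls; congr << _ >>; apply/eqP/pi_isomP. Qed.

End Products.

Section FreeLift.
Variables (T : choiceType) (M : lmodType int).
Implicit Types (f g : T -> M) (x y : {freeg T / int}).

Lemma fglift_sum f x : fglift f x = \sum_(z <- dom x) coeff z x *: f z.
Proof.
pose F : {additive {freeg T / int} -> M} :=
  HB.pack (fglift f) (GRing.isAdditive.Build _ _ (fglift f) (lift_is_additive f)).
rewrite -[LHS]/(F x) -{1}[x]freeg_sumE raddf_sum; apply: eq_bigr => z _.
exact: liftU.
Qed.

Lemma fglift_linear f a x y : fglift f (a *: x + y) = a *: fglift f x + fglift f y.
Proof.
pose F : {additive {freeg T / int} -> M} :=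
  HB.pack (fglift f) (GRing.isAdditive.Build _ _ (fglift f) (lift_is_additive f)).
rewrite -![fglift f _]/(F _) raddfD; congr (_ + _).
by rewrite -[a]intz !scaler_int raddfMz.
Qed.

Lemma fglift_linear_fun f g a x :
  fglift (fun z => a *: f z + g z) x = a *: fglift f x + fglift g x.
Proof.
rewrite !fglift_sum scaler_sumr -big_split; apply: eq_bigr => z _ /=.
by rewrite scalerDr !scalerA mulrC.
Qed.

End FreeLift.

(** * The Lie algebra spanned by the indecomposables *)

Section Bracket.
Variables (K : finFieldType) (n : nat).
Implicit Types x y z : hall_alg K n.

Lemma hall_mul_linearl a x y z :
  hall_mul (a *: x + y) z = a *: hall_mul x z + hall_mul y z.
Proof. exact: fglift_linear. Qed.

Lemma hall_mul_linearr a x y z :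
  hall_mul z (a *: x + y) = a *: hall_mul z x + hall_mul z y.
Proof.
rewrite /hall_mul -fglift_linear_fun; congr fglift; apply/funext => b.
exact: fglift_linear.
Qed.

Lemma bracket_linearl a x y z :
  bracket (a *: x + y) z = a *: bracket x z + bracket y z.
Proof.
rewrite /bracket hall_mul_linearl hall_mul_linearr scalerBr.
by rewrite opprD addrACA.
Qed.

Lemma bracketC x y : bracket x y = - bracket y x.
Proof. by rewrite opprB. Qed.

Lemma bracket_linearr a x y z :
  bracket z (a *: x + y) = a *: bracket z x + bracket z y.
Proof.
by rewrite bracketC bracket_linearl opprD -scalerN -!bracketC.
Qed.

Lemma bracket0r x : bracket x 0 = 0.
Proof.
have := bracket_linearr 1 0 0 x; rewrite scale1r addr0 scale1r => /eqP.
by rewrite -[X in X == _]addr0 (inj_eq (addrI _)) => /eqP.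
Qed.

Lemma bracketDr x y z : bracket z (x + y) = bracket z x + bracket z y.
Proof. by have := bracket_linearr 1 x y z; rewrite !scale1r. Qed.

Lemma bracketZr a x z : bracket z (a *: x) = a *: bracket z x.
Proof. by have := bracket_linearr a x 0 z; rewrite bracket0r !addr0. Qed.

Lemma bracketNr x z : bracket z (- x) = - bracket z x.
Proof. by rewrite -scaleN1r bracketZr scaleN1r. Qed.

Definition jacobi x y z :=
  bracket x (bracket y z) + bracket y (bracket z x) + bracket z (bracket x y).

Lemma jacobi_cycle x y z : jacobi x y z = jacobi y z x.
Proof. by rewrite /jacobi -addrA addrC. Qed.

Lemma jacobi_linear a x x' y z :
  jacobi (a *: x + x') y z = a *: jacobi x y z + jacobi x' y z.
Proof.
rewrite /jacobi !(bracket_linearl, bracket_linearr) !scalerDr.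
have sum3 (V : zmodType) (p p' q q' r r' : V) :
  p + p' + (q + q') + (r + r') = p + q + r + (p' + q' + r').
  by rewrite (addrACA p) (addrACA (p + q)).
exact: sum3.
Qed.

(** By the classification the standard classes generate the span, so a linear statement has to be
    checked only on them. *)
Lemma indec_span_ind (P : hall_alg K n -> Prop) :
  P 0 -> (forall a x y, P x -> P y -> P (a *: x + y)) ->
  (forall l, valid n l -> P (cls (std K n l))) ->
  forall x, indec_span K n x -> P x.
Proof.
move=> P0 Plin Pl _ [m [c [M [ind ->]]]].
elim: m c M ind => [|m IH] c M ind; first by rewrite big_ord0.
rewrite big_ord_recl; apply: Plin; last by apply: IH => i; apply: ind.
by have [l [vl i]] := indecomposable_std (ind ord0); rewrite (cls_isom i); apply: Pl.
Qed.

Lemma indec_span0 : indec_span K n 0.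
Proof. by exists 0%N, (fun=> 0), (fun=> std K n (Seg 0 0)); split=> [[]//|];
  rewrite big_ord0. Qed.

Lemma indec_span_linear a x y :
  indec_span K n x -> indec_span K n y -> indec_span K n (a *: x + y).
Proof.
move=> [m [c [M [ind ->]]]] [m' [c' [M' [ind' ->]]]].
exists (m + m')%N, (fun i => match split i with inl i => a * c i | inr i => c' i end),
  (fun i => match split i with inl i => M i | inr i => M' i end); split.
  by move=> i; case: (split i).
rewrite big_split_ord scaler_sumr /=; congr (_ + _); apply: eq_bigr => i _.
  by rewrite scalerA (unsplitK (inl i : 'I_m + 'I_m')).
by rewrite (unsplitK (inr i : 'I_m + 'I_m')).
Qed.

Lemma indec_span_std l : valid n l -> indec_span K n (cls (std K n l)).
Proof.
move=> vl; exists 1%N, (fun=> 1), (fun=> std K n l); split.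
  by move=> _; apply/nice_indec/nice_std.
by rewrite big_ord_recl big_ord0 addr0 scale1r.
Qed.

Lemma indec_span_bracket x y :
  indec_span K n x -> indec_span K n y -> indec_span K n (bracket x y).
Proof.
move=> hx; move: x hx y; apply: indec_span_ind.
- by move=> y _; rewrite bracketC bracket0r oppr0; apply: indec_span0.
- by move=> a x x' H H' y hy; rewrite bracket_linearl; apply: indec_span_linear;
  [exact: H|exact: H'].
move=> l vl; apply: indec_span_ind.
- by rewrite bracket0r; apply: indec_span0.
- by move=> a x x' H H'; rewrite bracket_linearr; apply: indec_span_linear.
move=> l' vl'; rewrite bracket_std // /std_bracket.
have sum (s : seq label) : (forall k, k \in s -> valid n k) ->
    indec_span K n (\sum_(k <- s) cls (std K n k)).
  elim: s => [|k s IH] H; first by rewrite big_nil; apply: indec_span0.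
  rewrite big_cons -[cls _]scale1r; apply: indec_span_linear.
    by apply: indec_span_std; apply: H; rewrite mem_head.
  by apply: IH => k' k's; apply: H; rewrite inE k's orbT.
rewrite addrC -scaleN1r; apply: indec_span_linear; apply: sum => k; exact: mul_terms_valid.
Qed.

Notation I a b := (cls (std K n (Seg a b))).
Notation Q a b := (cls (std K n (Quad a b))).

Lemma sum_nseqb (b : bool) l :
  \sum_(k <- nseq b l) cls (std K n k) = b%:R *: cls (std K n l).
Proof. by case: b; rewrite /= ?big_cons big_nil ?scale1r ?scale0r ?addr0. Qed.

(** This contains (a), (b) and (d), with V_i as [Seg i n]. The last term occurs when both segments
    end at n; the two Kronecker terms then vanish, since n + 1 is not a vertex. *)
Lemma bracket_seg_seg a b c d : valid n (Seg a b) -> valid n (Seg c d) ->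
  bracket (I a b) (I c d) = (b.+1 == c)%:R *: I a d - (d.+1 == a)%:R *: I c b
    + ((b == n)%:R * (d == n)%:R) *: (Q c a - Q a c).
Proof.
move=> vx vy; rewrite bracket_std // /std_bracket /= !big_cat /= !sum_nseqb.
rewrite -natrM mulnb scalerBr [in X in _ - X](andbC (d == n)) opprD.
by rewrite addrACA.
Qed.

Lemma bracket_seg_quad a b l m : valid n (Seg a b) -> valid n (Quad l m) ->
  bracket (I a b) (Q l m) = (b.+1 == m)%:R *: Q l a + (b.+1 == l)%:R *: Q a m.
Proof.
move=> vx vy; rewrite bracket_std // /std_bracket /= big_cat /= !sum_nseqb.
by rewrite big_nil subr0.
Qed.

Lemma bracket_quad_quad l m l' m' : valid n (Quad l m) -> valid n (Quad l' m') ->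
  bracket (Q l m) (Q l' m') = 0.
Proof. by move=> vx vy; rewrite bracket_std // /std_bracket /= big_nil subrr. Qed.

(** The Kronecker condition may be assumed when its coefficient is rewritten; labels such as the
    concatenation of two segments are known to be valid only under it. *)
Lemma scale_bool (b : bool) (x y : hall_alg K n) : (b -> x = y) -> b%:R *: x = b%:R *: y.
Proof. by case: b => [-> //|_]; rewrite !scale0r. Qed.

(** Double brackets expand into products of Kronecker symbols with basis elements. With segments
    involved, the identity holds with these symbols as independent variables, so [ring] proves it
    without cases on the indices. *)
Lemma jacobi_std (x y z : label) : valid n x -> valid n y -> valid n z ->
  jacobi (cls (std K n x)) (cls (std K n y)) (cls (std K n z)) = 0.
Proof.
(* Comparing coefficients moves the identity from the free module to the integers, where [ring]
   applies. *)
have scoeff (u v : hall_alg K n) : (forall t, coeff t u = coeff t v) -> u = v.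
  by move=> H; apply/eqP/freeg_eqP.
have SSS a b c d e f : valid n (Seg a b) -> valid n (Seg c d) -> valid n (Seg e f) ->
    bracket (I a b) (bracket (I c d) (I e f)) =
    (d.+1 == e)%:R *: ((b.+1 == c)%:R *: I a f - (f.+1 == a)%:R *: I c b
        + ((b == n)%:R * (f == n)%:R) *: (Q c a - Q a c))
    - (f.+1 == c)%:R *: ((b.+1 == e)%:R *: I a d - (d.+1 == a)%:R *: I e b
        + ((b == n)%:R * (d == n)%:R) *: (Q e a - Q a e))
    + ((d == n)%:R * (f == n)%:R) *: (((b.+1 == c)%:R *: Q e a + (b.+1 == e)%:R *: Q a c)
       - ((b.+1 == e)%:R *: Q c a + (b.+1 == c)%:R *: Q a e)).
  move=> vx vy vz; have /andP[ab bn] := vx; have /andP[cd dn] := vy; have /andP[ef fn] := vz.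
  rewrite bracket_seg_seg // !(bracketDr, bracketNr, bracketZr).
  congr (_ - _ + _ *: _).
  - apply: scale_bool => /eqP de; rewrite bracket_seg_seg //.
    by apply/andP; split=> //; clear - cd de ef; lia.
  - apply: scale_bool => /eqP fc; rewrite bracket_seg_seg //.
    by apply/andP; split=> //; clear - cd fc ef; lia.
  - rewrite !bracket_seg_quad //; apply/andP; split; clear - cd dn ef fn; lia.
have SSQ a b c d l m : valid n (Seg a b) -> valid n (Seg c d) -> valid n (Quad l m) ->
    bracket (I a b) (bracket (I c d) (Q l m)) =
    (d.+1 == m)%:R *: ((b.+1 == c)%:R *: Q l a + (b.+1 == l)%:R *: Q a c)
    + (d.+1 == l)%:R *: ((b.+1 == m)%:R *: Q c a + (b.+1 == c)%:R *: Q a m).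
  move=> vx vy vz; have /andP[ab bn] := vx; have /andP[cd dn] := vy; have /andP[ln mn] := vz.
  rewrite bracket_seg_quad // !(bracketDr, bracketZr) !bracket_seg_quad //.
    by apply/andP; split=> //; clear - cd dn; lia.
  by apply/andP; split=> //; clear - cd dn; lia.
have QSS a b c d l m : valid n (Seg a b) -> valid n (Seg c d) -> valid n (Quad l m) ->
    bracket (Q l m) (bracket (I a b) (I c d)) =
    - ((b.+1 == c)%:R *: ((d.+1 == m)%:R *: Q l a + (d.+1 == l)%:R *: Q a m))
    + (d.+1 == a)%:R *: ((b.+1 == m)%:R *: Q l c + (b.+1 == l)%:R *: Q c m).
  move=> vx vy vz; have /andP[ab bn] := vx; have /andP[cd dn] := vy; have /andP[ln mn] := vz.
  have an : (1 <= a <= n)%N by clear - ab bn; lia.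
  have cn : (1 <= c <= n)%N by clear - cd dn; lia.
  rewrite bracket_seg_seg // !(bracketDr, bracketNr, bracketZr).
  rewrite !bracket_quad_quad ?subrr ?scaler0 ?addr0 //; try exact/andP.
  rewrite -!scalerN; congr (_ + _); apply: scale_bool => /eqP E.
    rewrite bracketC bracket_seg_quad //.
    by apply/andP; split=> //; clear - ab E cd; lia.
  rewrite bracketC opprK bracket_seg_quad //.
  by apply/andP; split=> //; clear - ab E cd; lia.
have SSQ0 a b c d l m : valid n (Seg a b) -> valid n (Seg c d) -> valid n (Quad l m) ->
    jacobi (I a b) (I c d) (Q l m) = 0.
  move=> vx vy vz; rewrite /jacobi SSQ // [bracket (Q l m) (I a b)]bracketC bracketNr SSQ //
    QSS //.
  apply: scoeff => t; rewrite !(coeffD, coeffB, coeffN, coeffZ, coeff0).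
  ring.
have SQQ0 a b l m l' m' : valid n (Seg a b) -> valid n (Quad l m) -> valid n (Quad l' m') ->
    jacobi (I a b) (Q l m) (Q l' m') = 0.
  move=> vx vy vz; have /andP[ab bn] := vx; have an : (1 <= a <= n)%N by clear - ab bn; lia.
  have /andP[ln mn] := vy; have /andP[ln' mn'] := vz.
  rewrite /jacobi bracket_quad_quad // bracket0r add0r [bracket _ (I a b)]bracketC bracketNr.
  rewrite !bracket_seg_quad // !bracketDr !bracketZr !bracket_quad_quad ?scaler0 ?addr0
    ?oppr0 //;
  exact/andP.
move=> vx vy vz; case: x y z vx vy vz => [a b|a b] [c d|c d] [e f|e f] vx vy vz.
- rewrite /jacobi !SSS //; apply: scoeff => t.
  rewrite !(coeffD, coeffB, coeffN, coeffZ, coeff0).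
  ring.
- exact: SSQ0.
- by rewrite jacobi_cycle jacobi_cycle SSQ0.
- exact: SQQ0.
- by rewrite jacobi_cycle SSQ0.
- by rewrite jacobi_cycle SQQ0.
- by rewrite jacobi_cycle jacobi_cycle SQQ0.
- by rewrite /jacobi !bracket_quad_quad // !bracket0r !addr0.
Qed.

Lemma indec_span_lie : lie_subalgebra (indec_span K n).
Proof.
split.
- exact: indec_span0.
- exact: indec_span_linear.
- exact: indec_span_bracket.
- by move=> x _; rewrite /bracket subrr.
(* The induction is trilinear: cyclic symmetry of [jacobi] brings each variable to the first place
   in turn. *)
suff J x : indec_span K n x -> forall y, indec_span K n y -> forall z, indec_span K n z ->
    jacobi x y z = 0 by move=> x y z hx hy hz; apply: J.
have j0 y z : jacobi 0 y z = 0.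
  by rewrite /jacobi !(bracketC 0, bracket0r, oppr0) ?addr0.
move: x; apply: indec_span_ind.
- by move=> y _ z _.
- by move=> a x x' H H' y hy z hz; rewrite jacobi_linear H // H' // scaler0 addr0.
move=> l vl; apply: indec_span_ind.
- by move=> z _; rewrite jacobi_cycle j0.
- move=> a x x' H H' z hz; rewrite jacobi_cycle jacobi_linear -![jacobi _ z _]jacobi_cycle.
  by rewrite H // H' // scaler0 addr0.
move=> l' vl'; apply: indec_span_ind.
- by rewrite -jacobi_cycle j0.
- move=> a x x' H H'; rewrite -jacobi_cycle jacobi_linear ![jacobi _ (cls _) (cls
  _)]jacobi_cycle.
  by rewrite H H' scaler0 addr0.
by move=> l'' vl''; apply: jacobi_std.
Qed.

End Bracket.

Lemma V_seg (K : finFieldType) n i : V K n i = std K n (Seg i n).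
Proof.
rewrite /= /W /V.
have -> : (fun v : 'I_n => nat_of_bool (i <= v.+1)%N) = (fun v : 'I_n => nat_of_bool (i <=
  v.+1 <= n)%N).
  by apply/funext => v; rewrite ltn_ord andbT.
by [].
Qed.

Theorem corollary3p3 (n : nat) (hn : (1 <= n)%N) (K : finFieldType) :
  let w i j : hall_alg K n := cls (W K n i j) in
  let v i : hall_alg K n := cls (V K n i) in
  let u i j : hall_alg K n := cls (U K n i j) in
  lie_subalgebra (indec_span K n)
  /\ (forall i j l m : nat,
        (1 <= i <= j)%N -> (j <= n - 1)%N ->
        (1 <= l <= m)%N -> (m <= n - 1)%N ->
        bracket (w i j) (w l m) =
          ((j + 1)%N == l)%:R *: w i m - ((m + 1)%N == i)%:R *: w l j)
  /\ (forall i j l : nat,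
        (1 <= i <= j)%N -> (j <= n - 1)%N -> (1 <= l <= n)%N ->
        bracket (w i j) (v l) = ((j + 1)%N == l)%:R *: v i)
  /\ (forall i j l m : nat,
        (1 <= i <= j)%N -> (j <= n - 1)%N ->
        (1 <= l <= n)%N -> (1 <= m <= n)%N ->
        bracket (w i j) (u l m) =
          ((j + 1)%N == m)%:R *: u l i + ((j + 1)%N == l)%:R *: u i m)
  /\ (forall i j : nat,
        (1 <= i <= n)%N -> (1 <= j <= n)%N ->
        bracket (v i) (v j) = u j i - u i j)
  /\ (forall X Y : amod K n,
        indecomposable X -> indecomposable Y ->
        ~ tabulated X Y -> ~ tabulated Y X ->
        bracket (cls X) (cls Y) = 0).
Proof.
move=> w v u.
have vE i : v i = cls (std K n (Seg i n)) by rewrite /v V_seg.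
split; first exact: indec_span_lie.
split.
  move=> i j l m ij jn lm mn; rewrite -[w i j]/(cls (std K n (Seg i j))).
  rewrite -[w l m]/(cls (std K n (Seg l m))) bracket_seg_seg.
  - have -> : (j == n) = false by clear - jn hn; lia.
    by rewrite mul0r scale0r addr0 !addn1.
  - by rewrite /= ij; clear - jn; lia.
  - by rewrite /= lm; clear - mn; lia.
split.
  move=> i j l ij jn ln; rewrite !vE -[w i j]/(cls (std K n (Seg i j))) bracket_seg_seg.
  - have -> : (j == n) = false by clear - jn hn; lia.
    have -> : (n.+1 == i) = false by clear - jn ij; lia.
    by rewrite mul0r !scale0r addr0 subr0 !addn1.
  - by rewrite /= ij; clear - jn; lia.
  - by rewrite /= ln leqnn.
split.
  move=> i j l m ij jn ln mn; rewrite -[w i j]/(cls (std K n (Seg i j))).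
  rewrite -[u l m]/(cls (std K n (Quad l m))) bracket_seg_quad ?addn1 //.
  - by rewrite /= ij; clear - jn; lia.
  - by rewrite /= ln mn.
split.
  move=> i j ni nj; rewrite !vE bracket_seg_seg.
  - have -> : (n.+1 == i) = false by clear - ni; lia.
    have -> : (n.+1 == j) = false by clear - nj; lia.
    by rewrite eqxx mulr1 !scale0r subr0 add0r scale1r.
  - by rewrite /= ni leqnn.
  - by rewrite /= nj leqnn.
move=> X Y indX indY nXY nYX.
have [x [vx iX]] := indecomposable_std indX.
have [y [vy iY]] := indecomposable_std indY.
rewrite (cls_isom iX) (cls_isom iY).
(* A segment is of type W if it ends before n and of type V if it ends at n; this translates labels
   into the table. *)
have kind (Z : amod K n) i j : valid n (Seg i j) -> isom Z (std K n (Seg i j)) ->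
    (j < n)%N /\ is_W Z \/ j = n /\ is_V Z.
  move=> /andP[ij]; rewrite leq_eqVlt => /orP[/eqP jn|jn] iZ.
    subst j; right; split=> //; exists i; split; first by clear - ij; lia.
    by rewrite V_seg.
  by left; split=> //; exists i, j.
case: x y vx vy iX iY => [a b|a b] [c d|c d] vx vy iX iY.
- have [[_ WX]|[_ VX]] := kind _ _ _ vx iX; have [[_ WY]|[_ VY]] := kind _ _ _ vy iY.
  + by case: nXY; left; split=> //; left.
  + by case: nXY; left; split=> //; right; left.
  + by case: nYX; left; split=> //; right; left.
  + by case: nXY; right.
- have UY : is_U Y by exists c, d; have /andP[] := vy.
  (* The pair of types V and U remains: the segment ends at n, and n + 1 matches neither index of
     U. *)
  have [[_ WX]|[bn _]] := kind _ _ _ vx iX.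
    by case: nXY; left; split=> //; right; right.
  rewrite bracket_seg_quad //; have /andP[cn dn] := vy.
  have -> : (b.+1 == d) = false by clear - bn dn; lia.
  have -> : (b.+1 == c) = false by clear - bn cn; lia.
  by rewrite !scale0r addr0.
- have UX : is_U X by exists a, b; have /andP[] := vx.
  have [[_ WY]|[dn' _]] := kind _ _ _ vy iY.
    by case: nYX; left; split=> //; right; right.
  rewrite bracketC bracket_seg_quad //; have /andP[an bn] := vx.
  have -> : (d.+1 == b) = false by clear - bn dn'; lia.
  have -> : (d.+1 == a) = false by clear - an dn'; lia.
  by rewrite !scale0r addr0 oppr0.
- exact: bracket_quad_quad.
Qed.
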